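(* Let $T>0$, $n\ge 1$, and let $G:\mathbb{R}^{2n}\to[0,\infty)$ be a differentiable $G$-function such that $G^\star$ is semi-symplectic and $G^\star\in\Delta_2$. Let $C_1>0$ be a constant for which there is a constant $C_2>0$ such that $$\int_0^T\langle Jv',v\rangle\,dt\ \ge\ -C_1\int_0^T G^\star(Tv')\,dt-C_2\qquad\text{for every } v\in W^{1,G^\star}_T([0,T],\mathbb{R}^{2n})$$ (such constants, depending only on $G^\star$ and $T$, exist because $G^\star$ is semi-symplectic). Suppose that $\mathcal{H}:[0,T]\times\mathbb{R}^{2n}\to\mathbb{R}$ is such that $\mathcal{H}(t,\cdot)$ is convex for almost every $t\in[0,T]$, $\mathcal{H}(\cdot,u)$ is measurable for each fixed $u\in\mathbb{R}^{2n}$, and the following conditions hold: 1. There exists $\xi\in L^{G^\star}([0,T],\mathbb{R}^{2n})$ such that for all $y\in\mathbb{R}^{2n}$ and for almost every $t\in[0,T]$, $\mathcal{H}(t,y)\ge\langle\xi(t),y\rangle$. 2. There exist $\Lambda$ with $\Lambda^{-1}>T\max\{1,C_1/2\}$ and $\alpha\in L^1([0,T],\mathbb{R})$ such that for all $y\in\mathbb{R}^{2n}$ and for almost every $t\in[0,T]$, $\mathcal{H}(t,y)\le G(\Lambda y)+\alpha(t)$. 3. $\int_0^T\mathcal{H}(t,y)\,dt\to\infty$ as $|y|\to\infty$. Then there exists $u\in W^{1,G}_T([0,T],\mathbb{R}^{2n})$ which solves $$u'(t)\in J\,\partial\mathcal{H}(t,u(t))\ \text{ for a.e. } t\in[0,T],\qquad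 u(0)=u(T),$$ and such that $v=-J\tilde u$ minimizes over $W^{1,G^\star}_T([0,T],\mathbb{R}^{2n})$ the dual action $$\chi(v)=\int_0^T \frac12\langle Jv',v\rangle+\mathcal{H}^\star(t,v')\,dt .$$
   Context: $\langle\cdot,\cdot\rangle$ is the Euclidean inner product and $J=\begin{pmatrix}0&I_n\\-I_n&0\end{pmatrix}$ is the canonical symplectic $2n\times 2n$ matrix. A function $\phi:\mathbb{R}^d\to[0,+\infty]$ is a $G$-function if it is convex, lower semicontinuous, even ($\phi(-x)=\phi(x)$), $\phi(0)=0$, bounded in some neighborhood of $0$, and $\lim_{|x|\to\infty}\phi(x)=\infty$. Its complementary (conjugate) function is $\phi^\star(\xi)=\sup_{x\in\mathbb{R}^d}\big(\langle\xi,x\rangle-\phi(x)\big)$. A $G$-function $\phi:\mathbb{R}^d\to[0,\infty)$ satisfies $\phi\in\Delta_2$ if there is $C>0$ with $\phi(2x)\le C\phi(x)+1$ for all $x\in\mathbb{R}^d$. A $G$-function $F:\mathbb{R}^{2n}\to[0,\infty)$ (finite-valued) is semi-symplectic if there exist $K>0$ and $C\ge 0$ such that $F^\star(Ju)\le F(Ku)+C$ for all $u\in\mathbb{R}^{2n}$. (The hypothesis that $G^\star$ is semi-symplectic is this condition with $F=G^\star$; in particular $G^\star$ is finite-valued.) For a $G$-function $\phi$, the Orlicz space $L^\phi=L^\phi([0,T],\mathbb{R}^d)$ is the set of (classes of) measurable $u:[0,T]\to\mathbb{R}^d$ such that $\int_0^T\phi(\lambda u)\,dt<\infty$ for some $\lambda>0$,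 with Luxemburg norm $\|u\|_{L^\phi}=\inf\{\lambda>0:\int_0^T\phi(u/\lambda)\,dt\le1\}$. $W^{1,\phi}=\{u:[0,T]\to\mathbb{R}^d \text{ absolutely continuous},\ u'\in L^\phi\}$ and $W^{1,\phi}_T=\{u\in W^{1,\phi}:u(0)=u(T)\}$. For $u\in L^1([0,T],\mathbb{R}^d)$, $\overline u=\frac1T\int_0^Tu(t)\,dt$ and $\tilde u=u-\overline u$. $\partial\mathcal{H}(t,u)$ is the subdifferential in the sense of convex analysis of $\mathcal{H}(t,\cdot)$ at $u$, and $\mathcal{H}^\star(t,y)=\sup_{x\in\mathbb{R}^{2n}}\big(\langle y,x\rangle-\mathcal{H}(t,x)\big)\in(-\infty,+\infty]$ is the conjugate with respect to the second variable; thus $\chi$ takes values in $(-\infty,+\infty]$. *)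

(* Defs.v *)
From mathcomp Require Import all_boot all_order all_algebra.
From mathcomp Require Import all_classical all_reals all_analysis.

Set Implicit Arguments.
Unset Strict Implicit.
Unset Printing Implicit Defensive.

Import Order.TTheory GRing.Theory Num.Theory.
Import numFieldNormedType.Exports.

Local Open Scope classical_set_scope.
Local Open Scope ring_scope.

(* Lebesgue measure on the sigma-algebra of Lebesgue (not just Borel)
   measurable sets. *)
Notation leb := (@completed_lebesgue_measure _).

(* R equipped with the sigma-algebra of the Lebesgue measurable sets. *)
Notation lebR R := (caratheodory_type ((@wlength R idfun)^*)%mu).

Section Euclidean.
Context {R : realType}.

Definition dotp d (x y : 'cV[R]_d) : R := \sum_(i < d) x i 0 * y i 0.

(* The library norm `|x| on 'cV[R]_d is the sup norm. *)
Definition enorm d (x : 'cV[R]_d) : R := Num.sqrt (dotp x x).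

Definition Jmx n : 'M[R]_(n + n) := block_mx 0 1%:M (- 1%:M) 0.

Definition tends_to_infty d (f : 'cV[R]_d -> \bar R) :=
  forall M : R, exists r : R,
    forall x : 'cV[R]_d, r < enorm x -> (M%:E <= f x)%E.

End Euclidean.

Section Gfunctions.
Context {R : realType} {d : nat}.
Implicit Types phi : 'cV[R]_d -> \bar R.
Local Open Scope ereal_scope.

(* In the cases t = 0 and t = 1, the convention 0 * +oo = 0 applies. *)
Definition convex_efun phi :=
  forall (x y : 'cV[R]_d) (t : R), (0 <= t <= 1)%R ->
    phi (t *: x + (1 - t) *: y)%R <= t%:E * phi x + (1 - t)%:E * phi y.

Definition Gfunction phi :=
  [/\ forall x, 0 <= phi x, convex_efun phi & lower_semicontinuous phi] /\
  [/\ forall x, phi (- x)%R = phi x, phi 0%R = 0,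
      exists M : R, \forall x \near (0%R : 'cV[R]_d), phi x <= M%:E
    & tends_to_infty phi].

Definition finite_Gfunction phi :=
  Gfunction phi /\ forall x, phi x \is a fin_num.

Definition conjugate phi (xi : 'cV[R]_d) : \bar R :=
  ereal_sup (range (fun x : 'cV[R]_d => (dotp xi x)%:E - phi x)).

Definition Delta2 phi :=
  finite_Gfunction phi /\
  exists2 C : R, (0 < C)%R &
    forall x : 'cV[R]_d, phi (2 *: x)%R <= C%:E * phi x + 1.

Definition subdifferential (f : 'cV[R]_d -> R) (x : 'cV[R]_d) : set 'cV[R]_d :=
  [set p | forall y : 'cV[R]_d, f x + dotp p (y - x) <= f y]%R.

End Gfunctions.

Definition semi_symplectic {R : realType} n (F : 'cV[R]_(n + n) -> \bar R) :=
  finite_Gfunction F /\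
  exists K C : R, [/\ 0 < K, 0 <= C &
    forall u : 'cV[R]_(n + n),
      (conjugate F (Jmx n *m u) <= F (K *: u) + C%:E)%E].

(* Functions on [0, T] are represented by functions on R of which only the
   restriction to [0, T] matters. *)
Section Spaces.
Context {R : realType} {d : nat}.
Implicit Types (T : R) (phi : 'cV[R]_d -> \bar R) (u : R -> 'cV[R]_d).

Definition orlicz T phi u :=
  (forall i : 'I_d,
     measurable_fun (`[0, T] : set (lebR R)) (fun t : lebR R => u t i 0)) /\
  exists2 lam : R, 0 < lam &
    (\int[leb]_(t in `[0%R, T]) phi (lam *: u t)%R < +oo)%E.

Definition abs_continuous T u :=
  forall e : R, 0 < e -> exists2 delta : R, 0 < delta &
    forall (m : nat) (a b : 'I_m -> R),
      (forall i, [/\ 0 <= a i, a i <= b i & b i <= T]) ->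
      trivIset setT (fun i => `]a i, b i[%classic) ->
      \sum_(i < m) (b i - a i) < delta ->
      \sum_(i < m) enorm (u (b i) - u (a i)) < e.

(* An absolutely continuous u is differentiable almost everywhere on [0, T];
   the value of [derive1 u] elsewhere is irrelevant. *)
Definition W1 T phi u := abs_continuous T u /\ orlicz T phi (derive1 u).

Definition W1per T phi u := W1 T phi u /\ u 0 = u T.

Definition mean T u : 'cV[R]_d :=
  \col_i (T^-1 * \int[leb]_(t in `[0, T]) u t i 0).

End Spaces.

Definition dual_action {R : realType} n (T : R)
    (H : R -> 'cV[R]_(n + n) -> R) (v : R -> 'cV[R]_(n + n)) : \bar R :=
  (\int[leb]_(t in `[0%R, T])
    ((2^-1 * dotp (Jmx n *m derive1 v t) (v t))%R%:E
     + conjugate (EFin \o H t) (derive1 v t)))%E.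

(* Main.v *)
Require Import Defs.
From HB Require Import structures.
From mathcomp Require Import all_boot all_order all_algebra.
From mathcomp Require Import all_classical all_reals all_analysis.
From mathcomp Require Import measurable_realfun.
From mathcomp Require Import ring lra.

(* Direct method for the dual action.  Put v' = p, so that chi becomes
   1/2 <Jp, Ip> + int H*(t, p) on integrable fields p of zero mean, I being the
   primitive.  The growth condition H <= G(Lam .) + alpha gives
   G*(p / Lam) <= H*(t, p) + alpha; with the inequality defining C1 and
   Lam^-1 > T C1 / 2 this makes chi coercive.  A minimizing sequence is uniformly
   integrable, because H* grows superlinearly, hence converges weakly in L1; the
   quadratic term is weakly continuous and the conjugate term weakly lower
   semicontinuous, so a minimizer p exists.
   Varying p towards any admissible q shows that p minimizes
   q |-> int H*(t, q) - <q, Jv>.  By duality the infimum of this functional is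
   - min_c int H(t, Jv + c), the coercivity of int H(t, .) providing the optimal c;
   hence equality holds a.e. in the Fenchel-Young inequality between p(t) and
   u(t) = Jv(t) + c, that is, p(t) is a subgradient of H(t, .) at u(t), and
   u' = Jp a.e. *)

Set Implicit Arguments.
Unset Strict Implicit.
Unset Printing Implicit Defensive.

Import Order.TTheory GRing.Theory Num.Theory.
Import numFieldNormedType.Exports.

Local Open Scope classical_set_scope.
Local Open Scope ring_scope.

(** * Convex functions *)

(** Three points shape the details. The bounds on [H] hold for each [y] outside a null set depending
    on [y], and convexity holds only for almost every [t]. Testing at rational points and setting
    [H t] to [0] on a single null set yields an integrand with [- (a t * |y|) <= H t y <= g y + a t]
    everywhere on [[0, T]], where [g y = G (Lam *: y)] and [a] is one integrable function. The
    conjugate can be [+oo], so the action cannot be differentiated in arbitrary directions: the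
    minimizer is varied along segments towards fields with integrable conjugate. The dual infimum is
    only approached, by gradients of smoothed integrands, while the constant [c] is attained in
    finite dimension. The two terms of the maximum bounding [Lam] act separately: [Lam * T < 1]
    allows the conjugate of [G] at [T *: p] to be compared with the one at [Lam^-1 *: p], and
    [Lam * T * (C1 / 2) < 1] leaves a positive fraction of the conjugate term after the quadratic
    one is absorbed. Semi-symplecticity puts [u' = J p] in the Orlicz space of [G], through
    biconjugation. *)

Section dotp_theory.
Context {R : realType} {d : nat}.
Implicit Types x y z : 'cV[R]_d.

Lemma ler_coord_norm x i : `|x i 0| <= `|x|.
Proof.
rewrite [leRHS]/Num.norm /= mx_normrE.
by rewrite (le_bigmax _ (fun ij : 'I_d * 'I_1 => `|x ij.1 ij.2|) (i, 0)).
Qed.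

Lemma ler_norm_coord x r : 0 <= r -> (forall i, `|x i 0| <= r) -> `|x| <= r.
Proof.
move=> r0 xr; rewrite [leLHS]/Num.norm /= mx_normrE.
by apply/bigmax_leP; split => // -[i j] _ /=; rewrite (ord1 j).
Qed.

Lemma dotpC x y : dotp x y = dotp y x.
Proof. by apply: eq_bigr => i _; rewrite mulrC. Qed.

Lemma dotpDl x y z : dotp (x + y) z = dotp x z + dotp y z.
Proof. by rewrite -big_split; apply: eq_bigr => i _; rewrite !mxE mulrDl. Qed.

Lemma dotpDr x y z : dotp z (x + y) = dotp z x + dotp z y.
Proof. by rewrite dotpC dotpDl !(dotpC z). Qed.

Lemma dotpZl a x y : dotp (a *: x) y = a * dotp x y.
Proof. by rewrite /dotp mulr_sumr; apply: eq_bigr => i _; rewrite !mxE mulrA. Qed.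

Lemma dotpZr a x y : dotp x (a *: y) = a * dotp x y.
Proof. by rewrite dotpC dotpZl dotpC. Qed.

Lemma dotpNl x y : dotp (- x) y = - dotp x y.
Proof. by rewrite -scaleN1r dotpZl mulN1r. Qed.

Lemma dotpNr x y : dotp x (- y) = - dotp x y.
Proof. by rewrite dotpC dotpNl dotpC. Qed.

Lemma dotpBl x y z : dotp (x - y) z = dotp x z - dotp y z.
Proof. by rewrite dotpDl dotpNl. Qed.

Lemma dotpBr x y z : dotp z (x - y) = dotp z x - dotp z y.
Proof. by rewrite dotpDr dotpNr. Qed.

Lemma dotp0l x : dotp 0 x = 0.
Proof. by rewrite -(scale0r x) dotpZl mul0r. Qed.

Lemma dotp0r x : dotp x 0 = 0.
Proof. by rewrite dotpC dotp0l. Qed.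

Definition basis_vec (i : 'I_d) : 'cV[R]_d := delta_mx i 0.

Lemma dotp_basis x i : dotp x (basis_vec i) = x i 0.
Proof.
rewrite /dotp (bigD1 i)//= big1 ?addr0 ?mxE ?eqxx ?mulr1// => j ji.
by rewrite mxE (negbTE ji) mulr0.
Qed.

Lemma normr_dotp_le x y : `|dotp x y| <= d%:R * `|x| * `|y|.
Proof.
apply: le_trans (ler_norm_sum _ _ _) _.
apply: (@le_trans _ _ (\sum_(i < d) `|x| * `|y|)).
  by apply: ler_sum => i _; rewrite normrM ler_pM// ler_coord_norm.
by rewrite sumr_const card_ord -[leRHS]mulrA mulr_natl.
Qed.

Lemma dotp_ge0 x : 0 <= dotp x x.
Proof. by apply: sumr_ge0 => i _; rewrite -expr2 sqr_ge0. Qed.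

Lemma dotp_convex x y (t : R) : 0 <= t <= 1 ->
  dotp (t *: x + (1 - t) *: y) (t *: x + (1 - t) *: y) <=
  t * dotp x x + (1 - t) * dotp y y.
Proof.
case/andP=> t0 t1; have : 0 <= t * (1 - t) * dotp (x - y) (x - y).
  by rewrite !mulr_ge0 ?dotp_ge0// subr_ge0.
rewrite !dotpBl !dotpBr !dotpDl !dotpDr !dotpZl !dotpZr (dotpC y x).
by lra.
Qed.

Lemma sqr_norm_le_dotp x : `|x| ^+ 2 <= dotp x x.
Proof.
rewrite -ler_sqrt ?dotp_ge0// sqrtr_sqr normr_id.
apply: ler_norm_coord; first exact: sqrtr_ge0.
move=> i; rewrite -sqrtr_sqr ler_sqrt ?dotp_ge0//.
by rewrite /dotp (bigD1 i)//= -expr2 lerDl sumr_ge0// => j _; rewrite -expr2 sqr_ge0.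
Qed.

Lemma norm_le_enorm x : `|x| <= enorm x.
Proof.
by rewrite -(ger0_norm (normr_ge0 x)) -sqrtr_sqr ler_sqrt ?dotp_ge0// sqr_norm_le_dotp.
Qed.

Lemma enorm_le_norm x : enorm x <= d%:R * `|x|.
Proof.
rewrite /enorm -[leRHS]ger0_norm ?mulr_ge0// -sqrtr_sqr ler_sqrt ?sqr_ge0//.
apply: (le_trans (ler_norm _)); apply: (le_trans (normr_dotp_le _ _)).
rewrite -mulrA -expr2 exprMn ler_wpM2r ?sqr_ge0// expr2 -natrM ler_nat.
by case: (d) => // k; rewrite leq_pmulr.
Qed.

(** Transposition is an isometry for the sup norm, so compactness is carried over from row vectors,
    where bounded closed sets are compact. *)
Lemma closed_ball_compactV r : compact [set x : 'cV[R]_d | `|x| <= r].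
Proof.
have ctr : continuous (fun x : 'rV[R]_d => x^T : 'cV[R]_d).
  move=> x; have FF : Filter (nbhs (x : 'rV[R]_d)) by apply: nbhs_filter.
  apply/(@cvgrPdist_le _ 'cV[R]_d 'rV[R]_d _ FF) => e e0; near=> y.
  have yx : `|x - y| <= e by near: y; apply: cvgr_dist_le.
  apply: ler_norm_coord => [|i]; first exact: ltW.
  rewrite !mxE; apply: le_trans yx.
  rewrite [leRHS]/Num.norm /= mx_normrE.
  rewrite (le_trans _ (le_bigmax _ (fun ij : 'I_1 * 'I_d => `|(x - y) ij.1 ij.2|) (0, i)))//=.
  by rewrite !mxE.
have nT (x : 'cV[R]_d) : `|x^T| = `|x|.
  have le1 : `|x^T| <= `|x|.
    rewrite [leLHS]/Num.norm /= mx_normrE; apply/bigmax_leP; split => // -[i j] _ /=.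
    by rewrite mxE (ord1 i) ler_coord_norm.
  apply/eqP; rewrite eq_le le1 /=; apply: ler_norm_coord => // i.
  rewrite [leRHS]/Num.norm /= mx_normrE.
  rewrite (le_trans _ (le_bigmax _ (fun ij : 'I_1 * 'I_d => `|x^T ij.1 ij.2|) (0, i)))//=.
  by rewrite !mxE.
rewrite (_ : [set x | _] = @trmx R 1 d @` [set x : 'rV[R]_d | `|x| <= r]); last first.
  apply/seteqP; split=> [x /= xr|x /= [y yr <-]].
    by exists x^T; [rewrite nT|rewrite trmxK].
  by rewrite -nT trmxK.
apply: continuous_compact; first exact: continuous_subspaceT.
apply: bounded_closed_compact.
  by exists r; split; [exact: num_real|move=> M rM x /= /le_trans; apply; exact: ltW].
have -> : [set x : 'rV[R]_d | `|x| <= r] = Num.norm @^-1` [set s : R | s <= r] by [].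
by apply: closed_comp; [move=> x _; exact: norm_continuous|exact: closed_le].
Unshelve. all: by end_near. Qed.

End dotp_theory.

Section convex.
Context {R : realType} {d : nat}.
Implicit Types (f : 'cV[R]_d -> R) (x y z : 'cV[R]_d).

Definition convexf f := forall x y (t : R), 0 <= t <= 1 ->
  f (t *: x + (1 - t) *: y) <= t * f x + (1 - t) * f y.

Lemma convexf_half f x y : convexf f ->
  f (x + y) <= 2^-1 * f (2 *: x) + 2^-1 * f (2 *: y).
Proof.
move=> cf; have := cf (2 *: x) (2 *: y) 2^-1.
have -> : 1 - 2^-1 = 2^-1 :> R by field.
rewrite !scalerA mulVf ?pnatr_eq0// !scale1r; apply.
by apply/andP; split; lra.
Qed.

(** Induction on the number [k] of leading coordinates allowed to be nonzero: midpoint convexity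
    splits off the last of them, which moves on a segment, and leaves a vector of the previous kind
    in the ball of radius [2 * s]. *)
Lemma convexf_bounded_above f (r : R) : convexf f ->
  exists M, forall x, `|x| <= r -> f x <= M.
Proof.
move=> cf.
suff H k : (k <= d)%N -> forall s : R, exists M, forall x, `|x| <= s ->
    (forall i : 'I_d, (k <= i)%N -> x i 0 = 0) -> f x <= M.
  have [M HM] := H d (leqnn d) r; exists M => x xr; apply: HM => // i.
  by rewrite leqNgt ltn_ord.
elim: k => [_ s|k IH kd s].
  exists (f 0) => x _ x0; suff -> : x = 0 by [].
  by apply/matrixP => i j; rewrite (ord1 j) mxE x0.
have [M HM] := IH (ltnW kd) (2 * s).
pose i0 := Ordinal kd; pose e := basis_vec i0 : 'cV[R]_d.
(* The [+ 1] keeps the segment from [- b *: e] to [b *: e] nondegenerate when [s] is zero. *)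
pose b := 2 * `|s| + 1.
exists (2^-1 * Num.max (f (b *: e)) (f (- b *: e)) + 2^-1 * M) => x xs x0.
pose a := x i0 0 *: e.
rewrite (_ : x = a + (x - a)); last by rewrite addrC subrK.
apply: le_trans (convexf_half _ _ cf) _; apply: lerD.
  rewrite ler_pM2l ?invr_gt0// /a scalerA.
  have xb : `|2 * x i0 0| <= b.
    rewrite normrM ger0_norm// /b (le_trans (y := 2 * `|s|))// ?lerDl//.
    by rewrite ler_pM2l// (le_trans (ler_coord_norm _ _))// (le_trans xs)// ler_norm.
  have b0 : 0 < b by rewrite /b ltr_wpDl// mulr_ge0.
  pose t := (2 * x i0 0 + b) / (2 * b).
  have := cf (b *: e) (- b *: e) t.
  have -> : t *: (b *: e) + (1 - t) *: (- b *: e) = (2 * x i0 0) *: e.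
    by rewrite !scalerA -scalerDl; congr (_ *: _); rewrite /t; field; lra.
  move: xb; rewrite ler_norml => /andP[xb1 xb2].
  have t01 : 0 <= t <= 1.
    by rewrite /t divr_ge0 ?ler_pdivrMr ?mul1r; lra.
  move=> /(_ t01)/le_trans; apply.
  case/andP: t01 => t0 t1; set m := Num.max _ _.
  rewrite (_ : m = t * m + (1 - t) * m); last by ring.
  by apply: lerD; apply: ler_wpM2l; rewrite ?subr_ge0// le_max lexx ?orbT.
rewrite ler_pM2l ?invr_gt0//; apply: HM.
  apply: ler_norm_coord => [|i].
    by rewrite mulr_ge0// (le_trans _ xs).
  rewrite !mxE normrM ger0_norm// ler_pM2l//.
  have [->|ii0] := eqVneq i i0; last first.
    by rewrite mulr0 subr0 (le_trans (ler_coord_norm _ _)).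
  by rewrite eqxx mulr1 subrr normr0 (le_trans _ xs).
move=> i; rewrite leq_eqVlt => /orP[/eqP ki|ki]; rewrite !mxE.
  have -> : i = i0 by apply: val_inj.
  by rewrite eqxx mulr1 subrr mulr0.
rewrite (x0 i ki) (_ : (_ && _) = false) ?mulr0 ?subrr ?mulr0//.
by apply/negP => /andP[/eqP ii0 _]; move: ki; rewrite ii0 ltnn.
Qed.

(** The segment from [z] through [y] is prolonged by unit length to [w], where [f] is still bounded;
    convexity between [z] and [w] gives the bound. As [z] is arbitrary, a local bound on [f]
    produces a global cone below its graph. *)
Lemma convexf_lower f (r M : R) y z : convexf f ->
  (forall x, `|x| <= r + 1 -> `|f x| <= M) -> `|y| <= r ->
  f y - 2 * M * `|z - y| <= f z.
Proof.
move=> cf fM yr.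
have [->|zy] := eqVneq z y; first by rewrite subrr normr0 mulr0 subr0.
pose s := `|z - y|; have s0 : 0 < s by rewrite normr_gt0 subr_eq0.
pose w := y - s^-1 *: (z - y).
have wr : `|w| <= r + 1.
  apply: (le_trans (ler_normB _ _)); apply: lerD => //.
  by rewrite normrZ ger0_norm ?invr_ge0 ?(ltW s0)// -/s mulVf ?gt_eqF.
pose t := (1 + s)^-1.
have t01 : 0 <= t <= 1 by rewrite /t invr_ge0 invf_le1; lra.
have yE : y = t *: z + (1 - t) *: w.
  apply/matrixP => i j; rewrite !mxE /t; field.
  by apply/andP; split; lra.
have := cf z w t t01; rewrite -yE => H.
have {}fy : `|f y| <= M by apply: fM; rewrite (le_trans yr)// lerDl.
have fw : `|f w| <= M by exact: fM.
move: fy fw; rewrite !ler_norml => /andP[fy1 fy2] /andP[fw1 fw2].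
have H2 : (1 + s) * f y <= f z + s * f w.
  have -> : f z + s * f w = (1 + s) * (t * f z + (1 - t) * f w).
    by rewrite /t; field; lra.
  by rewrite ler_pM2l//; lra.
rewrite -/s; have : s * (f w - f y) <= s * (2 * M) by rewrite ler_pM2l//; lra.
by move=> H3; lra.
Qed.
Lemma convexf_lipschitz f (r M : R) y z : convexf f ->
  (forall x, `|x| <= r + 1 -> `|f x| <= M) -> `|y| <= r -> `|z| <= r ->
  `|f y - f z| <= 2 * M * `|y - z|.
Proof.
move=> cf fM yr zr; have H1 := @convexf_lower f r M y z cf fM yr.
have H2 := @convexf_lower f r M z y cf fM zr.
by rewrite (distrC z y) in H1; rewrite ler_norml; apply/andP; split; lra.
Qed.

(** The lower bound is the reflection of the upper one: [0] is the midpoint of [x] and [- x], so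
    [f x] is at least [2 * f 0 - f (- x)]. *)
Lemma convexf_bounded f (r : R) : convexf f ->
  exists2 M, 0 <= M & forall x, `|x| <= r -> `|f x| <= M.
Proof.
move=> cf; have [M HM] := convexf_bounded_above r cf.
exists (`|M| + 2 * `|f 0|) => [|x xr]; first by rewrite addr_ge0// mulr_ge0.
have H1 := HM _ xr; have H2 : f (- x) <= M by apply: HM; rewrite normrN.
have := convexf_half (2^-1 *: x) (2^-1 *: - x) cf.
rewrite scalerN subrr scalerN scalerA divff ?pnatr_eq0// scale1r => H3.
have := ler_norm M; have := ler_norm (f 0); have := ler_norm (- f 0).
by rewrite normrN ler_norml => *; apply/andP; split; have := normr_ge0 M; lra.
Qed.

Lemma convexf_continuous f : convexf f -> continuous f.
Proof.
move=> cf x.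
have [M M0 HM] := @convexf_bounded f (`|x| + 1 + 1) cf.
have FF : Filter (nbhs (x : 'cV[R]_d)) by apply: nbhs_filter.
apply/(@cvgrPdist_le _ R^o 'cV[R]_d _ FF) => e e0; near=> y.
have xy1 : `|x - y| <= 1 by near: y; apply: cvgr_dist_le.
have xye : `|x - y| <= e / (2 * M + 1).
  by near: y; apply: cvgr_dist_le => //; rewrite divr_gt0//; lra.
have yr : `|y| <= `|x| + 1.
  by rewrite -(subKr x y) (le_trans (ler_normB _ _))// lerD.
apply: le_trans (@convexf_lipschitz f (`|x| + 1) M x y cf HM _ _) _ => //.
  by rewrite lerDl.
apply: le_trans (ler_wpM2l _ xye) _; first by rewrite mulr_ge0.
by rewrite mulrA ler_pdivrMr ?mulrDr; nra.
Unshelve. all: by end_near. Qed.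

(* The lower bound comes from convexity and the upper one by reflection. *)
Lemma moreau_gradient f (k : R) (h : 'cV[R]_d -> R) y : convexf f -> 0 < k ->
  (forall y' z, h y' <= f z + k / 2 * dotp (z - y') (z - y')) ->
  (forall y', exists z, h y' = f z + k / 2 * dotp (z - y') (z - y')) ->
  exists p, forall e,
    h y + dotp p e <= h (y + e) <= h y + dotp p e + k / 2 * dotp e e.
Proof.
move=> cf k0 hle hE; have [z zE] := hE y; pose p := k *: (y - z); exists p => e.
(* The minimizer [z] found at [y] competes at [y + e']; expanding the square makes [k *: (y - z)]
   the gradient. *)
have up e' : h (y + e') <= h y + dotp p e' + k / 2 * dotp e' e'.
  apply: le_trans (hle (y + e') z) _; rewrite zE /p.
  rewrite dotpZl opprD addrA (dotpBr (z - y) e') !dotpBl !dotpBr.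
  by rewrite (dotpC e' z) (dotpC e' y) !(dotpC y z); lra.
clearbody p.
have ch : convexf h.
  move=> a b t t01; have [z1 z1E] := hE a; have [z2 z2E] := hE b.
  apply: le_trans (hle _ (t *: z1 + (1 - t) *: z2)) _; rewrite z1E z2E.
  have := cf z1 z2 t t01.
  have -> : t *: z1 + (1 - t) *: z2 - (t *: a + (1 - t) *: b) =
    t *: (z1 - a) + (1 - t) *: (z2 - b).
    by rewrite !scalerBr opprD addrACA.
  have H := dotp_convex (z1 - a) (z2 - b) t01.
  have : k / 2 * dotp (t *: (z1 - a) + (1 - t) *: (z2 - b))
      (t *: (z1 - a) + (1 - t) *: (z2 - b)) <=
    k / 2 * (t * dotp (z1 - a) (z1 - a) + (1 - t) * dotp (z2 - b) (z2 - b)).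
    by rewrite ler_pM2l//; lra.
  by lra.
apply/andP; split; last exact: up.
apply/ler_addgt0Pr => /= eps eps0.
(* The point [y] lies between [y + e] and [y - s *: e]. Convexity of [h], with the upper bound at
   the second point, gives the lower bound at the first up to the error
   [s * (k / 2 * dotp e e) <= eps]. *)
pose s := eps / (eps + k / 2 * dotp e e).
have D0 := dotp_ge0 e.
have kD : 0 <= k / 2 * dotp e e by rewrite mulr_ge0//; lra.
have s0 : 0 < s by rewrite /s divr_gt0//; lra.
have s1 : s <= 1 by rewrite /s ler_pdivrMr; lra.
have sk : s * (k / 2 * dotp e e) <= eps.
  rewrite /s mulrAC ler_pdivrMr; last lra.
  by rewrite ler_pM2l//; lra.
pose t := s / (1 + s).
have t01 : 0 <= t <= 1.
  by apply/andP; split; rewrite /t; [apply: divr_ge0|rewrite ler_pdivrMr]; lra.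
have := ch (y + e) (y - s *: e) t t01.
have -> : t *: (y + e) + (1 - t) *: (y - s *: e) = y.
  by apply/matrixP => i j; rewrite !mxE /t; field; lra.
have := up (- (s *: e)); rewrite !dotpNr !dotpNl opprK !dotpZr !dotpZl => H1 H2.
have H3 : h y * (1 + s) <= s * h (y + e) + h (y - s *: e).
  have -> : s * h (y + e) + h (y - s *: e) =
      (t * h (y + e) + (1 - t) * h (y - s *: e)) * (1 + s).
    by rewrite /t; field; lra.
  by rewrite ler_pM2r//; lra.
have H4 : s * (h y + dotp p e) <= s * (h (y + e) + eps).
  rewrite mulrC in H3.
  have : s * (s * (k / 2 * dotp e e)) <= s * eps by rewrite ler_pM2l.
  rewrite (_ : k / 2 * (s * (s * dotp e e)) = s * (s * (k / 2 * dotp e e))) in H1; last by ring.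
  by lra.
by rewrite ler_pM2l in H4.
Qed.

(** Outside the ball of radius [|y| + 4 * M / k] the quadratic term absorbs the linear decrease
    [2 * M * |z - y|] left by [convexf_lower], so a minimizer over that ball is global. *)
Lemma moreau_attained f (k : R) y : convexf f -> 0 < k ->
  exists z, forall z', f z + k / 2 * dotp (z - y) (z - y) <=
    f z' + k / 2 * dotp (z' - y) (z' - y).
Proof.
move=> cf k0; pose g z := f z + k / 2 * dotp (z - y) (z - y).
have [M M0 HM] := @convexf_bounded f (`|y| + 1) cf.
have low z : f y - 2 * M * `|z - y| <= f z.
  exact: (@convexf_lower f `|y| M y z cf HM).
pose r := 4 * M / k.
have cg : convexf g.
  move=> a b t t01; have := cf a b t t01; rewrite /g.
  have -> : t *: a + (1 - t) *: b - y = t *: (a - y) + (1 - t) *: (b - y).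
    by apply/matrixP => i j; rewrite !mxE; ring.
  have H := dotp_convex (a - y) (b - y) t01.
  have : k / 2 * dotp (t *: (a - y) + (1 - t) *: (b - y))
      (t *: (a - y) + (1 - t) *: (b - y)) <=
    k / 2 * (t * dotp (a - y) (a - y) + (1 - t) * dotp (b - y) (b - y)).
    by rewrite ler_pM2l//; lra.
  by lra.
have r0 : 0 <= r by rewrite /r divr_ge0 ?mulr_ge0// ltW.
have [|z zA zmin] := @compact_EVT_min _ R g [set x | `|x| <= `|y| + r] _
    (@closed_ball_compactV R d _) (continuous_subspaceT (convexf_continuous cg)).
  by exists 0 => /=; rewrite normr0 addr_ge0.
have gy : g z <= g y by apply: zmin; rewrite inE /= lerDl.
exists z => z'; rewrite -/(g z) -/(g z').
have [z'r|z'r] := leP `|z'| (`|y| + r); first by apply: zmin; rewrite inE.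
apply: le_trans gy _; rewrite {1}/g subrr dotp0l mulr0 addr0.
have s_r : r < `|z' - y|.
  by rewrite -(ltrD2l `|y|) (lt_le_trans z'r)// -{1}(subrK y z') addrC ler_normD.
rewrite /g; have := sqr_norm_le_dotp (z' - y); have := low z'.
set s := `|z' - y| in s_r *; rewrite expr2 => H1 H2.
have H3 : 4 * M <= k * s by rewrite [leRHS]mulrC -ler_pdivrMr// ltW.
have H4 : 4 * M * s <= k * s * s by apply: ler_wpM2r H3; exact: normr_ge0.
have H5 : k / 2 * (s * s) <= k / 2 * dotp (z' - y) (z' - y).
  by rewrite ler_pM2l//; lra.
by lra.
Qed.

End convex.

(** * Rational test points and Moreau regularization *)

Section rational_vectors.
Context {R : realType} {d : nat}.
Implicit Types (f : 'cV[R]_d -> R) (y : 'cV[R]_d).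

(** An enumeration of the rational vectors (with [0] at indices that encode nothing): suprema and
    infima over it are countable, hence measurable in a parameter. *)
Definition ratv (j : nat) : 'cV[R]_d :=
  if unpickle j is Some q then map_mx ratr (q : 'cV[rat]_d) else 0.

Lemma ratv_dense y (e : R) : 0 < e -> exists j, `|ratv j - y| <= e.
Proof.
move=> e0.
have /choice[q qP] : forall i : 'I_d, exists q : rat, ratr q \in `](y i 0 - e), (y i 0 + e)[.
  by move=> i; apply: rat_in_itvoo; lra.
exists (pickle (\col_i q i)); apply: ler_norm_coord => [|i]; first exact: ltW.
rewrite /ratv pickleK !mxE ler_distl.
by have := qP i; rewrite in_itv/= => /andP[/ltW -> /ltW ->].
Qed.

Lemma continuous_ratv f y (e : R) : continuous f -> 0 < e ->
  exists j, `|f (ratv j) - f y| <= e.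
Proof.
move=> cf e0.
have FF : Filter (nbhs (y : 'cV[R]_d)) by apply: nbhs_filter.
have /(@cvgrPdist_le _ R^o 'cV[R]_d _ FF) /(_ e e0) := cf y.
move=> /nbhs_normP[r /= r0 rP].
have [|j jr] := @ratv_dense y (r / 2); first by rewrite divr_gt0.
exists j; rewrite distrC; apply: rP; rewrite /ball_/= distrC.
by rewrite (le_lt_trans jr)// ltr_pdivrMr// ltr_pMr// ltr1n.
Qed.

Lemma conjugate_ratv f (p : 'cV[R]_d) : continuous f ->
  conjugate (EFin \o f) p =
  ereal_sup (range (fun j => (dotp p (ratv j) - f (ratv j))%:E)).
Proof.
move=> cf; apply/eqP; rewrite eq_le; apply/andP; split; last first.
  by apply: le_ereal_sup => _ [j _ <-]; exists (ratv j); rewrite //= EFinB.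
apply: ub_ereal_sup => _ [y _ <-] /=; rewrite -EFinB; apply/lee_addgt0Pr => e e0.
have cg : continuous (fun y => dotp p y - f y).
  move=> x; have FF : Filter (nbhs (x : 'cV[R]_d)) by apply: nbhs_filter.
  apply: (@cvgB _ R^o _ _ FF); last exact: cf.
  by apply: (@convexf_continuous _ _ (dotp p)) => a b t _; rewrite dotpDr !dotpZr.
have [j jP] := continuous_ratv y cg e0.
apply: (@le_trans _ _ ((dotp p (ratv j) - f (ratv j))%:E + e%:E)%E).
  by rewrite -EFinD lee_fin; move: jP; rewrite ler_distlC => /andP[]; lra.
by rewrite leeD2r//; apply: ereal_sup_ubound; exists j.
Qed.

(** The Moreau-Yosida regularization. Its infimum runs over rational points for the sake of
    measurability; by continuity it is the minimum over the whole space, see [moreau_min]. *)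
Definition moreau f (k : R) y : R :=
  inf (range (fun j => f (ratv j) + k / 2 * dotp (ratv j - y) (ratv j - y))).

Lemma convexf_moreau_term f (k : R) y : convexf f -> 0 < k ->
  convexf (fun z => f z + k / 2 * dotp (z - y) (z - y)).
Proof.
move=> cf k0 a b t t01; have := cf a b t t01.
have -> : t *: a + (1 - t) *: b - y = t *: (a - y) + (1 - t) *: (b - y).
  by apply/matrixP => i j; rewrite !mxE; ring.
have H := dotp_convex (a - y) (b - y) t01.
have : k / 2 * dotp (t *: (a - y) + (1 - t) *: (b - y))
    (t *: (a - y) + (1 - t) *: (b - y)) <=
  k / 2 * (t * dotp (a - y) (a - y) + (1 - t) * dotp (b - y) (b - y)).
  by rewrite ler_pM2l//; lra.
by lra.
Qed.

Lemma moreau_min f (k : R) y : convexf f -> 0 < k ->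
  exists2 z, moreau f k y = f z + k / 2 * dotp (z - y) (z - y) &
  forall z', moreau f k y <= f z' + k / 2 * dotp (z' - y) (z' - y).
Proof.
move=> cf k0; have [z zmin] := moreau_attained y cf k0.
suff E : moreau f k y = f z + k / 2 * dotp (z - y) (z - y).
  by exists z => // z'; rewrite E.
have lb : has_lbound (range (fun j => f (ratv j) + k / 2 * dotp (ratv j - y) (ratv j - y))).
  by exists (f z + k / 2 * dotp (z - y) (z - y)) => _ [j _ <-].
apply/eqP; rewrite eq_le; apply/andP; split; last first.
  apply: lb_le_inf; first by exists (f (ratv 0) + k / 2 * dotp (ratv 0 - y) (ratv 0 - y)), 0%N.
  by move=> _ [j _ <-].
apply/ler_addgt0Pr => e e0.
have [j] := continuous_ratv z (convexf_continuous (convexf_moreau_term y cf k0)) e0.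
rewrite ler_distlC => /andP[H1 H2].
apply: (@le_trans _ _ (f (ratv j) + k / 2 * dotp (ratv j - y) (ratv j - y))).
  by apply: ge_inf => //; exists j.
lra.
Qed.

Lemma moreau_le f (k : R) y : convexf f -> 0 < k -> moreau f k y <= f y.
Proof.
move=> cf k0; have [z _ /(_ y)] := moreau_min y cf k0.
by rewrite subrr dotp0l mulr0 addr0.
Qed.

(** Completing the square: [k / 2 * s ^+ 2 - L * s] is at least [- L ^+ 2 / (2 * k)]. *)
Lemma moreau_ge f (k L : R) y : convexf f -> 0 < k ->
  (forall z, f y - L * `|z - y| <= f z) ->
  f y - L ^+ 2 / (2 * k) <= moreau f k y.
Proof.
move=> cf k0 fL; have [z -> _] := moreau_min y cf k0.
have H1 := fL z; have H2 := sqr_norm_le_dotp (z - y).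
set s := `|z - y| in H1 H2.
have H3 : k / 2 * s ^+ 2 <= k / 2 * dotp (z - y) (z - y) by rewrite ler_pM2l//; lra.
have H4 : 0 <= k / 2 * (s - L / k) ^+ 2 by rewrite mulr_ge0 ?sqr_ge0//; lra.
have H5 : k / 2 * (s - L / k) ^+ 2 = k / 2 * s ^+ 2 - L * s + L ^+ 2 / (2 * k).
  by field; lra.
lra.
Qed.

Lemma moreau_diff f (k : R) y : convexf f -> 0 < k ->
  exists p, forall e, moreau f k y + dotp p e <= moreau f k (y + e)
    <= moreau f k y + dotp p e + k / 2 * dotp e e.
Proof.
move=> cf k0; apply: (moreau_gradient (f := f)) => // y'.
  by move=> z; have [_ _] := moreau_min y' cf k0; exact.
by have [z] := moreau_min y' cf k0; exists z.
Qed.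

(** A function with an affine minorant touching it at every point is convex; [moreau_diff] supplies
    the minorants. *)
Lemma moreau_convex f (k : R) : convexf f -> 0 < k -> convexf (moreau f k).
Proof.
move=> cf k0 a b t t01; pose c := t *: a + (1 - t) *: b.
have [p pP] := moreau_diff c cf k0; rewrite -/c.
have /andP[H1 _] := pP (a - c); have /andP[H2 _] := pP (b - c).
rewrite (addrC c) subrK in H1; rewrite (addrC c) subrK in H2.
have H3 : t * dotp p (a - c) + (1 - t) * dotp p (b - c) = 0.
  by rewrite -!dotpZr -dotpDr !scalerBr addrACA -opprD -scalerDl subrKC scale1r subrr dotp0r.
case/andP: t01 => t0 t1.
have H4 := ler_wpM2l t0 H1.
have t1' : 0 <= 1 - t by lra.
have H5 := ler_wpM2l t1' H2.
lra.
Qed.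

End rational_vectors.

(** * Measurability of convex integrands along measurable fields *)

Section measurability.
Context {R : realType} {d : nat} {dX : measure_display} {X : measurableType dX}.
Variable D : set X.
Implicit Types (H : X -> 'cV[R]_d -> R) (u p : X -> 'cV[R]_d).

Definition vmeasurable u := forall i, measurable_fun D (fun t => u t i 0).

Lemma measurable_dotp u p : vmeasurable u -> vmeasurable p ->
  measurable_fun D (fun t => dotp (u t) (p t)).
Proof. by move=> mu mp; apply: measurable_sum => i; apply: measurable_funM. Qed.

Lemma vmeasurable_cst (c : 'cV[R]_d) : vmeasurable (fun=> c).
Proof. by move=> i; exact: measurable_cst. Qed.

Lemma vmeasurableD u p : vmeasurable u -> vmeasurable p ->
  vmeasurable (fun t => u t + p t).
Proof.
move=> mu mp i; apply: (eq_measurable_fun (fun t => u t i 0 + p t i 0)).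
  by move=> t _; rewrite mxE.
exact: measurable_funD.
Qed.

Lemma vmeasurableZ (a : R) u : vmeasurable u -> vmeasurable (fun t => a *: u t).
Proof.
move=> mu i; apply: (eq_measurable_fun (fun t => a * u t i 0)).
  by move=> t _; rewrite mxE.
by apply: measurable_funM.
Qed.

Lemma vmeasurableN u : vmeasurable u -> vmeasurable (fun t => - u t).
Proof.
move=> mu i; apply: (eq_measurable_fun (fun t => - u t i 0)).
  by move=> t _; rewrite mxE.
exact: measurable_funN.
Qed.

Lemma vmeasurableB u p : vmeasurable u -> vmeasurable p ->
  vmeasurable (fun t => u t - p t).
Proof. by move=> mu mp; apply: vmeasurableD => //; exact: vmeasurableN. Qed.

Lemma measurable_conjugate H p :
  (forall t, D t -> continuous (H t)) ->
  (forall y, measurable_fun D (H ^~ y)) -> vmeasurable p ->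
  measurable_fun D (fun t => conjugate (EFin \o H t) (p t)).
Proof.
move=> cH mH mp.
pose F j t := (dotp (p t) (ratv j) - H t (ratv j))%:E.
apply: (eq_measurable_fun (fun t => esups (F ^~ t) 0)).
  move=> t; rewrite inE => Dt; rewrite (conjugate_ratv _ (cH _ Dt)).
  rewrite /esups /=; congr ereal_sup; apply/seteqP; split.
    by move=> _ [j _ <-]; exists j.
  by move=> _ [j _ <-]; exists j.
apply: measurable_fun_esups => j; apply/measurable_EFinP.
apply: measurable_funB => //; apply: measurable_dotp => //.
Qed.

Lemma measurable_moreau H (k : X -> R) u :
  (forall t, D t -> convexf (H t)) -> (forall t, D t -> 0 < k t) ->
  (forall y, measurable_fun D (H ^~ y)) ->
  measurable_fun D k -> vmeasurable u ->
  measurable_fun D (fun t => moreau (H t) (k t) (u t)).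
Proof.
move=> cH k0 mH mk mu.
pose F j t := H t (ratv j) + k t / 2 * dotp (ratv j - u t) (ratv j - u t).
apply: (eq_measurable_fun (fun t => infs (F ^~ t) 0)).
  move=> t _; rewrite /infs /moreau; congr inf; apply/seteqP; split.
    by move=> _ [j _ <-]; exists j.
  by move=> _ [j _ <-]; exists j.
apply: measurable_fun_infs => [t Dt|j].
  have [z _ zmin] := moreau_min (u t) (cH _ Dt) (k0 _ Dt).
  by exists (moreau (H t) (k t) (u t)) => _ [j _ <-]; exact: zmin.
apply: measurable_funD => //; apply: measurable_funM.
  by apply: measurable_funM => //; exact: measurable_cst.
by apply: measurable_dotp; apply: vmeasurableB => //; exact: vmeasurable_cst.
Qed.

(** The composition is the pointwise limit of Moreau regularizations with parameter [m.+1], which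
    are countable infima of measurable functions. *)
Lemma measurable_caratheodory_comp H u :
  (forall t, D t -> convexf (H t)) ->
  (forall y, measurable_fun D (H ^~ y)) -> vmeasurable u ->
  measurable_fun D (fun t => H t (u t)).
Proof.
move=> cH mH mu.
apply: (@measurable_fun_cvg _ _ _ _ (fun (m : nat) t => moreau (H t) m.+1%:R (u t))).
  by move=> m; apply: measurable_moreau => //.
move=> t Dt; have [M M0 HM] := convexf_bounded (`|u t| + 1) (cH _ Dt).
have low z := @convexf_lower _ _ _ `|u t| M (u t) z (cH _ Dt) HM (lexx _).
apply: (@squeeze_cvgr _ _ _ _ (fun m : nat => H t (u t) - (2 * M) ^+ 2 / (2 * m.+1%:R)) (fun=> H t (u t))).
- near=> m; rewrite moreau_le ?ltr0n//= ?andbT; last exact: cH.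
  by apply: moreau_ge => //; exact: cH.
- rewrite -[X in _ --> X]subr0; apply: cvgB; first exact: cvg_cst.
  rewrite (_ : (fun m : nat => _) = (fun m : nat => (2 * M) ^+ 2 / 2 * m.+1%:R^-1)); last first.
    by apply/funext => m; field; rewrite addrC natr1 pnatr_eq0.
  rewrite -(mulr0 ((2 * M) ^+ 2 / 2)); by apply: cvgM; [exact: cvg_cst|exact: cvg_harmonic].
- exact: cvg_cst.
Unshelve. all: by end_near. Qed.

End measurability.

(** * Weak compactness in L1 *)

(** On a compact interval the image of the ultrafilter has a cluster point, and a cluster point of
    an ultrafilter is a limit. *)
Lemma ultra_bounded_cvg {R : realType} {I : Type} (U : set_system I) {UU : UltraFilter U}
    (u : I -> R) (M : R) : (forall i, `|u i| <= M) -> exists l : R, u @ U --> l.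
Proof.
move=> uM; have := @segment_compact R (- M) M.
move=> /(_ (u @ U) _)[|l [lM clU]].
  by apply: (@filterE _ U) => i; rewrite /= in_itv/=; have := uM i; rewrite ler_norml.
exists l => V Vl; have [//|] := in_ultra_setVsetC (u @^-1` V) UU.
move=> UV; have [x [/= nVx Vx]] := clU (~` V) V UV Vl.
by [].
Qed.

(** * Densities of absolutely continuous set functions *)

Section set_functions.
Context {R : realType} {dX : measure_display} {X : measurableType dX}.
Variable mu : {sigma_finite_measure set X -> \bar R}.

(* The epsilon-delta form of absolute continuity upgrades finite additivity to
   sigma-additivity, so that the Radon-Nikodym theorem applies. *)
Lemma abs_continuous_density (D : set X) (nu : set X -> R) :
  measurable D -> (mu D < +oo)%E ->
  (forall A B, measurable A -> measurable B -> A `&` B = set0 ->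
    nu (A `|` B) = nu A + nu B) ->
  (forall e : R, 0 < e -> exists2 delta : R, 0 < delta & forall A, measurable A ->
    (mu (A `&` D) < delta%:E)%E -> `|nu A| <= e) ->
  exists2 f : X -> R, mu.-integrable setT (EFin \o f) &
    forall A, measurable A -> nu A = \int[mu]_(x in A) f x.
Proof.
move=> mD muD addnu acnu.
have nu0 : nu set0 = 0.
  have := addnu set0 set0 measurable0 measurable0 (set0I _).
  by rewrite setU0; lra.
pose nuE A := (nu A)%:E.
have nuE0 : nuE set0 = 0%E by rewrite /nuE nu0.
have nufin A : measurable A -> nuE A \is a fin_num by [].
have addn (F : (set X)^nat) n : (forall i, measurable (F i)) -> trivIset setT F ->
    nu (\big[setU/set0]_(i < n) F i) = \sum_(i < n) nu (F i).
  move=> mF tF; elim: n => [|n IH]; first by rewrite !big_ord0.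
  rewrite !big_ord_recr/= addnu ?IH//; first exact: bigsetU_measurable.
  apply/seteqP; split=> // x [+ Fnx]; rewrite -bigcup_mkord => -[k /= kn Fkx].
  have kE : k = n by apply: tF => //; exists x.
  by rewrite kE ltnn in kn.
have nusig : semi_sigma_additive nuE.
  move=> F mF tF mUF; set UF := \bigcup_k F k.
  have -> : (fun n : nat => \sum_(0 <= i < n) nuE (F i))%E =
      EFin \o (fun n => \sum_(i < n) nu (F i)).
    by apply/funext => n; rewrite /nuE sumEFin big_mkord.
  apply: cvg_EFin; first by near=> n.
  apply/cvgrPdist_le => e e0; have [del del0 delP] := acnu e e0.
  (* The remainders decrease to the empty set; since [D] has finite measure, their measure inside
     [D] tends to zero, and the hypothesis then makes [nu (tail n)] small. *)
  pose tail n := UF `\` \big[setU/set0]_(i < n) F i.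
  have mtail n : measurable (tail n).
    by apply: measurableD => //; exact: bigsetU_measurable.
  have tailP n : nu UF - \sum_(i < n) nu (F i) = nu (tail n).
    rewrite -addn// -[in LHS](@setDUK _ (\big[setU/set0]_(i < n) F i) UF); last first.
      by rewrite /UF -bigcup_mkord; exact: bigcup_subset.
    rewrite addnu//; first by rewrite addrC addKr.
    - exact: bigsetU_measurable.
    - exact: mtail.
    - by apply/seteqP; split=> // x [Fx [_ /(_ Fx)]].
  have mutail : (mu (tail n `&` D) @[n --> \oo] --> 0)%E.
    pose G n := tail n `&` D.
    have -> : 0%E = mu (\bigcap_n G n).
      rewrite (_ : \bigcap_n G n = set0) ?measure0//.
      apply/seteqP; split=> // x Gx; have [[[k _ Fkx] _] _] := Gx 0%N I.
      have [[_ +] _] := Gx k.+1 I; apply; rewrite -bigcup_mkord.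
      by exists k => //=.
    apply: nonincreasing_cvg_mu.
    - apply: le_lt_trans muD; apply: le_measure; rewrite ?inE//.
      by apply: measurableI => //; exact: mtail.
    - by move=> n; apply: measurableI => //; exact: mtail.
    - by apply: bigcapT_measurable => n; apply: measurableI => //; exact: mtail.
    - move=> m n mn; apply/subsetPset; apply: setSI; apply: setDS.
      by rewrite -!bigcup_mkord; apply: bigcup_sub => i /= im;
        apply: bigcup_sup => /=; exact: leq_trans im mn.
  have : \forall n \near \oo, (mu (tail n `&` D) < del%:E)%E.
    have /fine_cvgP[fn fc] := mutail.
    have : \forall n \near \oo, fine (mu (tail n `&` D)) < del.
      by apply: (cvgr_lt 0).
    apply: filterS2 fn => n fn; rewrite -lte_fin fineK//.
  apply: filterS => n /delP; rewrite distrC => /(_ (mtail n)).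
  by rewrite -tailP distrC.
pose nuC : {charge set X -> \bar R} :=
  HB.pack nuE (isCharge.Build _ _ _ nuE nuE0 nufin nusig).
have numu : nuC `<< mu.
  apply/null_content_dominatesP => A mA A0.
  congr EFin; apply/eqP; rewrite -normr_le0; apply/ler_addgt0Pr => e e0.
  have [del del0 delP] := acnu e e0; rewrite add0r; apply: delP => //.
  rewrite (@le_lt_trans _ _ 0%E) ?lte_fin// -A0 le_measure ?inE//.
  exact: measurableI.
exists (fun x => fine (Radon_Nikodym nuC mu x)).
  apply: eq_integrable (Radon_Nikodym_integrable numu) => // x _ /=.
  by rewrite fineK// Radon_Nikodym_fin_num.
move=> A mA; have := Radon_Nikodym_integral numu mA.
rewrite -[LHS]/((nu A)%:E) /Rintegral => H.
under eq_integral do rewrite fineK ?Radon_Nikodym_fin_num//.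
by rewrite -H.
Unshelve. all: by end_near. Qed.

End set_functions.

Section integrable_real.
Context {R : realType} {dX : measure_display} {X : measurableType dX}.
Variables (mu : {measure set X -> \bar R}) (D : set X).
Hypothesis mD : measurable D.
Implicit Types f g : X -> R.

Definition intg f := mu.-integrable D (EFin \o f).

Lemma intg_measurable f : intg f -> measurable_fun D f.
Proof. by move=> /integrableP[/measurable_EFinP]. Qed.

Lemma intg_le f g : measurable_fun D f -> (forall x, D x -> `|f x| <= g x) ->
  intg g -> intg f.
Proof.
move=> mf fg ig; apply: le_integrable ig => //; first exact/measurable_EFinP.
by move=> x Dx /=; rewrite lee_fin (le_trans (fg _ Dx))// ler_norm.
Qed.

Lemma intg_eq f g : (forall x, D x -> f x = g x) -> intg f -> intg g.
Proof.
by move=> fg; apply: eq_integrable => // x; rewrite inE => Dx /=; rewrite fg.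
Qed.

Lemma intgD f g : intg f -> intg g -> intg (fun x => f x + g x).
Proof. by move=> mf mg; have := integrableD mD mf mg; apply: eq_integrable. Qed.

Lemma intgN f : intg f -> intg (fun x => - f x).
Proof. by move=> mf; have := integrableN mf; apply: eq_integrable. Qed.

Lemma intgB f g : intg f -> intg g -> intg (fun x => f x - g x).
Proof. by move=> mf mg; apply: intgD => //; exact: intgN. Qed.

Lemma intgZ (k : R) f : intg f -> intg (fun x => k * f x).
Proof. by move=> mf; have := integrableZl mD k mf; apply: eq_integrable. Qed.

Lemma intg_norm f : intg f -> intg (fun x => `|f x|).
Proof. by move=> mf; have := integrable_abse mf; apply: eq_integrable. Qed.

Lemma intg_max f g : intg f -> intg g -> intg (fun x => Num.max (f x) (g x)).
Proof.
move=> mf mg; apply: (@intg_le _ (fun x => `|f x| + `|g x|)).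
- by apply: measurable_maxr; exact: intg_measurable.
- move=> x _; rewrite maxEle; case: ifP => _; first by rewrite lerDr.
  by rewrite lerDl.
- by apply: intgD; exact: intg_norm.
Qed.

Lemma intg_sum (I : Type) (s : seq I) (h : I -> X -> R) :
  (forall i, intg (h i)) -> intg (fun x => \sum_(i <- s) h i x).
Proof.
move=> ih; elim: s => [|i s IH].
  apply: (intg_eq (f := fun=> 0)); first by move=> x _; rewrite big_nil.
  exact: integrable0.
apply: (intg_eq (f := fun x => h i x + \sum_(j <- s) h j x)).
  by move=> x _; rewrite big_cons.
exact: intgD.
Qed.

Lemma intg_cst (k : R) : (mu D < +oo)%E -> intg (fun=> k).
Proof.
move=> muD; apply/integrableP; split; first by apply/measurable_EFinP.
rewrite (eq_integral (cst `|k|%:E))// integral_cst//.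
by rewrite lte_mul_pinfty// lee_fin.
Qed.

Lemma intg_mulbounded f g (M : R) : measurable_fun D g ->
  (forall x, D x -> `|g x| <= M) -> intg f -> intg (fun x => f x * g x).
Proof.
move=> mg gM iF; apply: (@intg_le _ (fun x => M * `|f x|)).
- by apply: measurable_funM => //; exact: intg_measurable.
- by move=> x Dx; rewrite normrM mulrC ler_wpM2r// gM.
- by apply: intgZ; exact: intg_norm.
Qed.

Lemma Rintegral_sum (I : Type) (s : seq I) (h : I -> X -> R) :
  (forall i, intg (h i)) ->
  \int[mu]_(x in D) (\sum_(i <- s) h i x) = \sum_(i <- s) \int[mu]_(x in D) h i x.
Proof.
move=> ih; elim: s => [|i s IH].
  under eq_Rintegral do rewrite big_nil.
  by rewrite big_nil Rintegral_cst// mul0r.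
under eq_Rintegral do rewrite big_cons.
by rewrite (RintegralD mD (ih i) (intg_sum s ih)) IH big_cons.
Qed.

Lemma RintegralN f : intg f ->
  \int[mu]_(x in D) (- f x) = - \int[mu]_(x in D) f x.
Proof.
move=> iF; under eq_Rintegral do rewrite -mulN1r.
by rewrite RintegralZl// mulN1r.
Qed.

End integrable_real.

Lemma intgS {R : realType} {dX : measure_display} {X : measurableType dX}
    (mu : {measure set X -> \bar R}) (D A : set X) (f : X -> R) :
  measurable D -> measurable A -> A `<=` D -> intg mu D f -> intg mu A f.
Proof. by move=> mD mA AD; exact: integrableS. Qed.

Lemma cvg_le_ultra {R : realType} {I : Type} (F : set_system I) {FF : ProperFilter F}
    (u : I -> R) (l M : R) : u @ F --> l -> (\forall i \near F, u i <= M) -> l <= M.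
Proof.
move=> ul uM; have <- := cvg_lim (@Rhausdorff R) ul.
by apply: limr_le => //; apply/cvg_ex; exists l.
Qed.

(** * Weak limits of equi-integrable sequences *)

Section weak_limit.
Context {R : realType} {dX : measure_display} {X : measurableType dX}.
Variable mu : {sigma_finite_measure set X -> \bar R}.
Variables (D : set X) (U : set_system nat).
Context {UU : UltraFilter U}.
Hypotheses (mD : measurable D) (muD : (mu D < +oo)%E).

(** Equi-integrability. The absolute value stands outside the integral because only the set
    functions matter; splitting [A] by the sign of [f k] recovers the usual form up to a factor
    2. *)
Definition unif_abs_cont (f : nat -> X -> R) := forall e : R, 0 < e ->
  exists2 delta : R, 0 < delta & forall k A, measurable A -> A `<=` D ->
    (mu A < delta%:E)%E -> `|\int[mu]_(x in A) f k x| <= e.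

(* Dunford-Pettis, with an ultrafilter limit in place of a subsequence. *)
Lemma ultra_weak_limit (f : nat -> X -> R) (M : R) :
  (forall k, intg mu D (f k)) ->
  (forall k A, measurable A -> A `<=` D -> `|\int[mu]_(x in A) f k x| <= M) ->
  unif_abs_cont f ->
  exists2 g : X -> R, intg mu D g &
    forall A, measurable A -> A `<=` D ->
      \int[mu]_(x in A) f k x @[k --> U] --> \int[mu]_(x in A) g x.
Proof.
move=> fi fM fac.
pose I A k := \int[mu]_(x in A `&` D) f k x.
have cI A : measurable A -> exists l : R, I A k @[k --> U] --> l.
  move=> mA; apply: (@ultra_bounded_cvg _ _ U _ _ M) => k.
  by apply: fM => //; exact: measurableI.
pose nu A := lim (I A k @[k --> U]).
have nuP A : measurable A -> I A k @[k --> U] --> nu A.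
  by move=> mA; have [l Il] := cI _ mA; rewrite /nu (cvg_lim (@Rhausdorff R) Il).
have [||g ig gE] := abs_continuous_density (nu := nu) mD muD.
- move=> A B mA mB AB; apply: (cvg_lim (@Rhausdorff R)).
  have -> : (fun k => I (A `|` B) k) = (fun k => I A k + I B k).
    apply/funext => k; rewrite /I setIUl Rintegral_setU//; try exact: measurableI.
      apply: intgS (fi k) => //; last by rewrite -setIUl; exact: subIsetr.
      by apply: measurableU; exact: measurableI.
    by rewrite /disj_set setIACA AB set0I eqxx.
  by apply: cvgD; exact: nuP.
- move=> e e0; have [del del0 delP] := fac e e0; exists del => // A mA Adel.
  apply: (cvg_le_ultra (cvg_norm (nuP _ mA))); apply: (@filterE _ U) => k.
  by apply: delP => //; exact: measurableI.
exists g; first by apply: intgS ig.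
move=> A mA AD; rewrite -gE//; have := nuP _ mA.
by under eq_fun do rewrite /I (setIidl AD).
Qed.

End weak_limit.

(** * Convex integrands and duality *)

Lemma cvg_rsum {R : realType} {I : Type} (F : set_system I) {FF : Filter F}
    (J : Type) (s : seq J) (u : J -> I -> R) (l : J -> R) :
  (forall j, u j @ F --> l j) ->
  \sum_(j <- s) u j i @[i --> F] --> \sum_(j <- s) l j.
Proof.
move=> ul; elim: s => [|j s IH].
  by under eq_fun do rewrite big_nil; rewrite big_nil; exact: cvg_cst.
by under eq_fun do rewrite big_cons; rewrite big_cons; apply: cvgD.
Qed.

Section integrand.
Context {R : realType} {d : nat} {dX : measure_display} {X : measurableType dX}.
Variables (mu : {sigma_finite_measure set X -> \bar R}) (D : set X).
Hypotheses (mD : measurable D) (muD : (mu D < +oo)%E).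
Variables (H : X -> 'cV[R]_d -> R) (g : 'cV[R]_d -> R) (a : X -> R).
Hypotheses (Hconv : forall t, D t -> convexf (H t))
  (Hmeas : forall y, measurable_fun D (H ^~ y))
  (gconv : convexf g) (ia : intg mu D a) (a_ge0 : forall t, D t -> 0 <= a t)
  (Hlb : forall t (y : 'cV[R]_d), D t -> - (a t * `|y|) <= H t y)
  (Hub : forall t y, D t -> H t y <= g y + a t).
Implicit Types (p u : X -> 'cV[R]_d) (y : 'cV[R]_d).

Definition conjH t (q : 'cV[R]_d) : \bar R := conjugate (EFin \o H t) q.

Definition vintg p := forall i, intg mu D (fun t => p t i 0).

Lemma young t q y : ((dotp q y - H t y)%:E <= conjH t q)%E.
Proof. by apply: ereal_sup_ubound; exists y => //=; rewrite EFinB. Qed.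

(** Test point [0]. The shift [g 0 + a t] is integrable and independent of [q]; adding it makes the
    conjugate nonnegative, as monotone convergence requires. *)
Lemma conjH_lb t q : D t -> (0 <= conjH t q + (g 0 + a t)%:E)%E.
Proof.
move=> Dt; apply: (@le_trans _ _ ((dotp q 0 - H t 0)%:E + (g 0 + a t)%:E)%E).
  rewrite -EFinD lee_fin dotp0r; have := @Hub t 0 Dt; lra.
by rewrite leeD2r//; exact: young.
Qed.

Lemma vintg_measurable p : vintg p -> vmeasurable D p.
Proof. by move=> ip i; exact: intg_measurable (ip i). Qed.

Lemma vintg_dotp p y : vintg p -> intg mu D (fun t => dotp (p t) y).
Proof.
move=> ip; apply: intg_sum => // i.
by apply: (@intg_eq _ _ _ _ _ mD (fun t => y i 0 * p t i 0)) => [t _|]; [rewrite mulrC|exact: intgZ].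
Qed.

Lemma intg_shift : intg mu D (fun t => g 0 + a t).
Proof. by apply: intgD => //; exact: intg_cst. Qed.

Lemma Hbound (r : R) : exists2 M, 0 <= M & forall t y, D t -> `|y| <= r ->
  `|H t y| <= M + (1 + `|r|) * a t.
Proof.
have [M M0 HM] := convexf_bounded r gconv.
exists M => // t y Dt yr; have gy := HM _ yr.
have H1 := Hlb y Dt; have H2 := Hub y Dt; have a0 := a_ge0 Dt.
have H3 : a t * `|y| <= a t * `|r|.
  by rewrite ler_wpM2l// (le_trans yr)// ler_norm.
have H4 : 0 <= `|r| * a t by rewrite mulr_ge0.
move: gy; rewrite !ler_norml => /andP[g1 g2].
by apply/andP; split; lra.
Qed.

Lemma intg_H u (b : R) : vmeasurable D u -> (forall t, D t -> `|u t| <= b) ->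
  intg mu D (fun t => H t (u t)).
Proof.
move=> mu_ ub; have [M M0 HM] := Hbound b.
apply: (@intg_le _ _ _ _ _ mD _ (fun t => M + (1 + `|b|) * a t)).
- exact: measurable_caratheodory_comp.
- by move=> t Dt; apply: HM => //; exact: ub.
- by apply: intgD => //; [exact: intg_cst|exact: intgZ].
Qed.

Lemma measurable_conjH p : vmeasurable D p ->
  measurable_fun D (fun t => conjH t (p t)).
Proof.
move=> mp; apply: measurable_conjugate => // t Dt.
exact/convexf_continuous/Hconv.
Qed.

(** The point [0] comes first, so that every [maxminor q N t] is at least [- H t 0], a bound
    independent of [q] and [N]. *)
Definition ratv0 (j : nat) : 'cV[R]_d := if j is k.+1 then ratv k else 0.

(** The conjugate is the increasing limit of these finite maxima of functions affine in [q]. Along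
    an integrable field each of them is integrable, which the conjugate need not be. *)
Fixpoint maxminor (q : 'cV[R]_d) (N : nat) (t : X) : R :=
  let phi := dotp q (ratv0 N) - H t (ratv0 N) in
  if N is M.+1 then Num.max (maxminor q M t) phi else phi.

Lemma maxminor_le_conjH q N t : ((maxminor q N t)%:E <= conjH t q)%E.
Proof.
elim: N => [|N IH] /=; first exact: young.
by rewrite EFin_max ge_max IH young.
Qed.

Lemma maxminor_homo q t : {homo (fun N => maxminor q N t) : m n / (m <= n)%N >-> m <= n}.
Proof. by apply: homo_leq => [x|y x z|m]; [|exact: le_trans|rewrite /= le_max lexx]. Qed.

Lemma maxminor_cvg q t : D t -> ((maxminor q N t)%:E @[N --> \oo] --> conjH t q)%E.
Proof.
move=> Dt; rewrite /conjH (conjugate_ratv _ (convexf_continuous (Hconv Dt))).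
rewrite (_ : ereal_sup _ = ereal_sup (range (fun N => (maxminor q N t)%:E))); last first.
  apply/eqP; rewrite eq_le; apply/andP; split.
    apply: ge_ereal_sup => _ [j _ <-]; apply: le_ereal_sup_tmp.
    exists (maxminor q j.+1 t)%:E; first by exists j.+1.
    by rewrite lee_fin /= le_max lexx orbT.
  rewrite -(conjugate_ratv _ (convexf_continuous (Hconv Dt))).
  by apply: ge_ereal_sup => _ [j _ <-]; exact: maxminor_le_conjH.
apply: ereal_nondecreasing_cvgn => m n mn; rewrite lee_fin.
exact: maxminor_homo.
Qed.

Lemma intg_minor p y : vintg p -> intg mu D (fun t => dotp (p t) y - H t y).
Proof.
move=> ip; apply: intgB => //; first exact: vintg_dotp.
by apply: (@intg_H (fun=> y) `|y|) => //; exact: vmeasurable_cst.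
Qed.

Lemma intg_maxminor p N : vintg p -> intg mu D (fun t => maxminor (p t) N t).
Proof.
move=> ip; elim: N => [|N IH] /=; first exact: intg_minor.
by apply: intg_max => //; exact: intg_minor.
Qed.

Lemma le_Rintegral_integral f (h : X -> \bar R) : intg mu D f -> measurable_fun D h ->
  (forall t, D t -> (0 <= h t + (g 0 + a t)%:E)%E) ->
  (forall t, D t -> ((f t)%:E <= h t)%E) ->
  mu.-integrable D h ->
  ((\int[mu]_(t in D) f t)%:E <= \int[mu]_(t in D) h t)%E.
Proof.
move=> iF mh h0 fh ih; rewrite /Rintegral fineK; last exact: integrable_fin_num.
by apply: le_integral => // t; rewrite inE => Dt; exact: fh.
Qed.

(** * Weak lower semicontinuity of the conjugate integral *)

Section lsc.
Variables (U : set_system nat) (p_ : nat -> X -> 'cV[R]_d) (p : X -> 'cV[R]_d).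
Context {UU : UltraFilter U}.
Hypotheses (ip_ : forall k, vintg (p_ k)) (ip : vintg p)
  (weak : forall i A, measurable A -> A `<=` D ->
    \int[mu]_(x in A) p_ k x i 0 @[k --> U] --> \int[mu]_(x in A) p x i 0).

Lemma weak_dotp y A : measurable A -> A `<=` D ->
  \int[mu]_(x in A) dotp (p_ k x) y @[k --> U] --> \int[mu]_(x in A) dotp (p x) y.
Proof.
move=> mA AD.
have E q : vintg q -> \int[mu]_(x in A) dotp (q x) y =
    \sum_(i < d) y i 0 * \int[mu]_(x in A) q x i 0.
  move=> iq; have iqA i : intg mu A (fun x => q x i 0).
    by apply: intgS (iq i).
  rewrite Rintegral_sum//.
    by apply: eq_bigr => i _; rewrite -(RintegralZl _ mA (iqA i)); apply: eq_Rintegral => x _; rewrite mulrC.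
  move=> i; apply: (@intg_eq _ _ _ _ _ mA (fun t => y i 0 * q t i 0)) => [t _|]; first by rewrite mulrC.
  exact: intgZ.
rewrite E//; under eq_fun do rewrite E//.
apply: cvg_rsum => i; apply: cvgM; first exact: cvg_cst.
exact: weak.
Qed.

(** Induction on [N]. The set [A] is split according to which term of the maximum is the larger
    along the limit [p]. On each piece that term alone passes to the limit, and along [p_ k] it
    stays below the maximum. *)
Lemma weak_maxminor N A (e : R) : measurable A -> A `<=` D -> 0 < e ->
  \forall k \near U, \int[mu]_(x in A) maxminor (p x) N x <=
    \int[mu]_(x in A) maxminor (p_ k x) N x + e.
Proof.
have minor y B (e' : R) : measurable B -> B `<=` D -> 0 < e' ->
  \forall k \near U, \int[mu]_(x in B) (dotp (p x) y - H x y) <=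
    \int[mu]_(x in B) (dotp (p_ k x) y - H x y) + e'.
  move=> mB BD e0.
  have iB q : vintg q -> \int[mu]_(x in B) (dotp (q x) y - H x y) =
     \int[mu]_(x in B) dotp (q x) y - \int[mu]_(x in B) H x y.
    move=> iq; rewrite RintegralB//; first by apply: intgS (vintg_dotp y iq).
    by apply: intgS (@intg_H (fun=> y) `|y| _ _).
  have /cvgrPdist_le/(_ e' e0) := @weak_dotp y _ mB BD.
  apply: filterS => k; rewrite !iB// ler_distl => /andP[H1 H2].
  lra.
elim: N A e => [|N IH] A e mA AD e0; first exact: minor.
pose phi q x := dotp (q x) (ratv0 N.+1) - H x (ratv0 N.+1).
pose A1 := A `&` [set x | phi p x <= maxminor (p x) N x].
pose A2 := A `\` A1.
have mA1 : measurable A1.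
  apply: measurable_fun_le => //.
  - by apply: measurable_funS (intg_measurable (intg_minor (ratv0 N.+1) ip)).
  - by apply: measurable_funS (intg_measurable (intg_maxminor N ip)).
have mA2 : measurable A2 by exact: measurableD.
have A1D : A1 `<=` D by move=> x [Ax _]; exact: AD.
have A2D : A2 `<=` D by move=> x [Ax _]; exact: AD.
have AE : A = A1 `|` A2 by rewrite /A2 setDUK// => x [].
have e20 : 0 < e / 2 by rewrite divr_gt0.
have split_int f : intg mu D f -> \int[mu]_(x in A) f x =
    \int[mu]_(x in A1) f x + \int[mu]_(x in A2) f x.
  move=> iF; rewrite [in LHS]AE Rintegral_setU//.
    by apply: intgS iF => //; [rewrite -AE|rewrite -AE].
  by apply/disj_setPS => x [? [_ /=]].
have H1 := IH A1 _ mA1 A1D e20; have H2 := minor (ratv0 N.+1) A2 _ mA2 A2D e20.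
apply: filterS2 H1 H2 => k H1 H2.
rewrite !split_int; [|exact: intg_maxminor..].
have -> : \int[mu]_(x in A1) maxminor (p x) N.+1 x = \int[mu]_(x in A1) maxminor (p x) N x.
  by apply: eq_Rintegral => x; rewrite inE => -[_ /= le1]; rewrite max_l.
have -> : \int[mu]_(x in A2) maxminor (p x) N.+1 x = \int[mu]_(x in A2) phi p x.
  apply: eq_Rintegral => x; rewrite inE => -[Ax nA1] /=; rewrite max_r//.
  by rewrite leNgt; apply/negP => lt1; apply: nA1; split => //=; exact: ltW.
have H3 : \int[mu]_(x in A1) maxminor (p_ k x) N x <=
    \int[mu]_(x in A1) maxminor (p_ k x) N.+1 x.
  apply: le_Rintegral => // [||x _]; last by rewrite /= le_max lexx.
    by apply: intgS (intg_maxminor N (ip_ k)).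
  by apply: intgS (intg_maxminor N.+1 (ip_ k)).
have H4 : \int[mu]_(x in A2) phi (p_ k) x <=
    \int[mu]_(x in A2) maxminor (p_ k x) N.+1 x.
  apply: le_Rintegral => // [||x _]; last by rewrite /= le_max lexx orbT.
    by apply: intgS (intg_minor _ (ip_ k)).
  by apply: intgS (intg_maxminor N.+1 (ip_ k)).
rewrite /phi in H4 *; lra.
Qed.

(** The bound holds for every [maxminor] and survives the increasing limit in [N] by monotone
    convergence, after the shift by [g 0 + a t]. The same bound yields the integrability of the
    conjugate along [p]. *)
Lemma conjH_lsc (B : R) :
  (forall k, mu.-integrable D (fun t => conjH t (p_ k t))) ->
  (forall e : R, 0 < e -> \forall k \near U,
    (\int[mu]_(t in D) conjH t (p_ k t) <= (B + e)%:E)%E) ->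
  mu.-integrable D (fun t => conjH t (p t)) /\
  (\int[mu]_(t in D) conjH t (p t) <= B%:E)%E.
Proof.
move=> iC CB.
have mxB N : \int[mu]_(t in D) maxminor (p t) N t <= B.
  apply/ler_addgt0Pr => e e0; have e20 : 0 < e / 2 by rewrite divr_gt0.
  have [k [H1 H2]] := filter_ex (filterI (CB _ e20) (weak_maxminor N mD (@subset_refl _ D) e20)).
  have := le_Rintegral_integral (intg_maxminor N (ip_ k))
    (measurable_conjH (vintg_measurable (ip_ k))) (fun t => @conjH_lb t _)
    (fun t _ => maxminor_le_conjH _ _ _) (iC k).
  move=> /le_trans/(_ H1); rewrite lee_fin; lra.
pose sh t := g 0 + a t; have ish := intg_shift.
pose h N t := (maxminor (p t) N t + sh t)%:E.
have h_ge0 N t : D t -> (0 <= h N t)%E.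
  move=> Dt; rewrite lee_fin; have : maxminor (p t) 0 t <= maxminor (p t) N t by exact: maxminor_homo.
  by rewrite /= dotp0r /sh; have := @Hub t 0 Dt; lra.
have hcvg t : D t -> (h N t @[N --> \oo] --> conjH t (p t) + (sh t)%:E)%E.
  move=> Dt; rewrite (_ : (h ^~ t) =
      (fun N => (maxminor (p t) N t)%:E + (sh t)%:E)%E); last first.
    by apply/funext => N; rewrite /h EFinD.
  apply: cvgeD; first by rewrite fin_num_adde_defl.
    exact: maxminor_cvg.
  exact: cvg_cst.
have mh N : measurable_fun D (h N).
  by apply/measurable_EFinP; apply: (intg_measurable (intgD mD (intg_maxminor N ip) ish)).
have mC : measurable_fun D (fun t => conjH t (p t) + (sh t)%:E)%E.
  apply: emeasurable_funD; first exact: measurable_conjH (vintg_measurable ip).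
  by apply/measurable_EFinP; exact: intg_measurable ish.
have IB : (\int[mu]_(t in D) (conjH t (p t) + (sh t)%:E) <=
    (B + \int[mu]_(t in D) sh t)%:E)%E.
  have -> : (\int[mu]_(t in D) (conjH t (p t) + (sh t)%:E) =
     \int[mu]_(t in D) limn (h ^~ t))%E.
    by apply: eq_integral => t; rewrite inE => Dt; rewrite (cvg_lim _ (hcvg t Dt)).
  rewrite monotone_convergence//; last first.
    by move=> t Dt m n mn; rewrite lee_fin lerD2r; exact: maxminor_homo.
  apply: lime_le.
    apply: ereal_nondecreasing_is_cvgn => m n mn; apply: ge0_le_integral => //.
    - by move=> t Dt; exact: h_ge0.
    - by move=> t Dt; rewrite lee_fin lerD2r; exact: maxminor_homo.
  apply: nearW => N; rewrite -[leLHS]fineK; last first.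
    by apply: integrable_fin_num => //; apply: intgD => //; exact: intg_maxminor.
  rewrite lee_fin -[leLHS]/(\int[mu]_(t in D) (maxminor (p t) N t + sh t)).
  by rewrite RintegralD// ?lerD2r//; exact: intg_maxminor.
have iCs : mu.-integrable D (fun t => conjH t (p t) + (sh t)%:E)%E.
  apply/integrableP; split => //.
  rewrite (eq_integral (fun t => conjH t (p t) + (sh t)%:E)%E); last first.
    by move=> t; rewrite inE => Dt; rewrite gee0_abs//; exact: conjH_lb.
  by apply: le_lt_trans IB _; rewrite ltry.
have iCp : mu.-integrable D (fun t => conjH t (p t)).
  by have := integrableB mD iCs ish; apply: eq_integrable => // t _ /=; rewrite addeK.
split=> //; move: IB; rewrite integralD//.
rewrite EFinD /Rintegral fineK; last exact: integrable_fin_num.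
by rewrite leeD2rE//; exact: integrable_fin_num.
Qed.

End lsc.


Lemma conjH_le_intg q (f : X -> R) : vmeasurable D q -> intg mu D f ->
  (forall t, D t -> (conjH t (q t) <= (f t)%:E)%E) ->
  mu.-integrable D (fun t => conjH t (q t)).
Proof.
move=> mq iF Cf; have iG : intg mu D (fun t => `|f t| + `|g 0 + a t|).
  by apply: intgD => //; apply: intg_norm => //; exact: intg_shift.
apply: le_integrable iG => //; first exact: measurable_conjH.
move=> t Dt /=; rewrite (ger0_norm (x := _ + _)) ?addr_ge0//.
have := conjH_lb (q t) Dt; have := Cf _ Dt.
case: (conjH t (q t)) => [x| |]//=; rewrite -EFinD !lee_fin => H1 H2.
have := ler_norm (f t); have := ler_norm (g 0 + a t).
by rewrite ler_norml => *; apply/andP; split; have := normr_ge0 (f t); have := normr_ge0 (g 0 + a t); lra.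
Qed.

Lemma Rintegral_dotp_cst q (c : 'cV[R]_d) : vintg q ->
  (forall i, \int[mu]_(t in D) q t i 0 = 0) ->
  \int[mu]_(t in D) dotp (q t) c = 0.
Proof.
move=> iq q0; rewrite Rintegral_sum//.
  by apply: big1 => i _; rewrite (RintegralZr _ mD (iq i)) q0 mul0r.
by move=> i; apply: (@intg_eq _ _ _ _ _ mD (fun t => c i 0 * q t i 0)) => [t _|]; [rewrite mulrC|exact: intgZ].
Qed.

(** * Minimization over constants and its dual *)

Section selection.
Variables (u0 : X -> 'cV[R]_d) (b : R).
Hypotheses (mu0 : vmeasurable D u0) (u0b : forall t, D t -> `|u0 t| <= b).
Hypothesis coercive : forall M : R, exists r : R, forall y : 'cV[R]_d,
  r < `|y| -> M <= \int[mu]_(t in D) H t y.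

Lemma shift_measurable c : vmeasurable D (fun t => u0 t + c).
Proof. by apply: vmeasurableD => //; exact: vmeasurable_cst. Qed.

Lemma shift_bounded (c : 'cV[R]_d) t : D t -> `|u0 t + c| <= b + `|c|.
Proof. by move=> Dt; rewrite (le_trans (ler_normD _ _))// lerD2r u0b. Qed.

Definition psi c := \int[mu]_(t in D) H t (u0 t + c).

Lemma intg_psi c : intg mu D (fun t => H t (u0 t + c)).
Proof. exact: intg_H (shift_measurable c) (shift_bounded c). Qed.

Lemma Rintegral_convex (h : X -> 'cV[R]_d -> R) :
  (forall t, D t -> convexf (h t)) ->
  (forall c : 'cV[R]_d, intg mu D (fun t => h t (u0 t + c))) ->
  convexf (fun c => \int[mu]_(t in D) h t (u0 t + c)).
Proof.
move=> ch ih x y s s01.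
have ix := intgZ mD s (ih x); have iy := intgZ mD (1 - s) (ih y).
rewrite -(RintegralZl s mD (ih x)) -(RintegralZl (1 - s) mD (ih y)) -RintegralD//.
apply: le_Rintegral => //; [exact: ih|exact: intgD|].
move=> t Dt; have := ch t Dt (u0 t + x) (u0 t + y) s s01.
by rewrite !scalerDr addrACA -scalerDl subrKC scale1r.
Qed.

(** The vector [2^-1 *: c] is the midpoint of [u0 t + c] and [- u0 t], so convexity transfers the
    growth of the integral at constant arguments to [psi]. The margin [1] leaves room for the
    smoothing error later on. *)
Lemma psi_coercive : exists2 r : R, 0 < r & forall c : 'cV[R]_d, r <= `|c| -> psi 0 + 1 <= psi c.
Proof.
have iN : intg mu D (fun t => H t (- u0 t)).
  apply: (@intg_H (fun t => - u0 t) b); first exact: vmeasurableN.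
  by move=> t Dt; rewrite normrN u0b.
have [r rP] := coercive ((psi 0 + 1 + \int[mu]_(t in D) H t (- u0 t)) / 2).
exists (2 * `|r| + 1); first by rewrite ltr_wpDl// mulr_ge0.
move=> c rc; have := rP (2^-1 *: c) _.
have -> : r < `|2^-1 *: c|.
  rewrite normrZ ger0_norm// ltr_pdivlMl// (lt_le_trans _ rc)//.
  by rewrite ltr_pwDr// ler_pM2l// ler_norm.
move=> /(_ isT).
have iC : intg mu D (fun t => H t (2^-1 *: c)).
  by apply: (@intg_H (fun=> 2^-1 *: c) `|2^-1 *: c|) => //; exact: vmeasurable_cst.
have : \int[mu]_(t in D) H t (2^-1 *: c) <=
    2^-1 * psi c + 2^-1 * \int[mu]_(t in D) H t (- u0 t).
  have i1 := intgZ mD 2^-1 (intg_psi c); have i2 := intgZ mD 2^-1 iN.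
  rewrite -(RintegralZl _ mD (intg_psi c)) -(RintegralZl _ mD iN) -RintegralD//.
  apply: le_Rintegral => //; first exact: intgD.
  move=> t Dt; have := @Hconv t Dt (u0 t + c) (- u0 t) 2^-1.
  have -> : 1 - 2^-1 = 2^-1 :> R by field.
  rewrite -scalerDr addrAC subrr add0r; apply.
  by apply/andP; split; lra.
lra.
Qed.

Lemma psi_min : exists c, forall c', psi c <= psi c'.
Proof.
have [r r0 rP] := psi_coercive.
have cpsi : convexf psi by apply: Rintegral_convex => //; exact: intg_psi.
have [|c cA cmin] := @compact_EVT_min _ R psi [set x | `|x| <= r] _
    (@closed_ball_compactV R d _) (continuous_subspaceT (convexf_continuous cpsi)).
  by exists 0 => /=; rewrite normr0 ltW.
exists c => c'; have [c'r|c'r] := leP `|c'| r; first by apply: cmin; rewrite inE.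
have c0 : psi c <= psi 0 by apply: cmin; rewrite inE /= normr0 ltW.
by have := rP _ (ltW c'r); lra.
Qed.

Section smoothing.
Variables (r eps : R).
Hypotheses (r0 : 0 < r) (eps0 : 0 < eps).

(** The Moreau regularization of [H t] with a parameter depending on [t]: the slope of [H t] on a
    ball grows with [a t], so no single parameter gives the same error [eps] for all [t]. *)
Lemma exists_smoothing : exists h : X -> 'cV[R]_d -> R,
  [/\ forall c : 'cV[R]_d, intg mu D (fun t => h t (u0 t + c)),
      forall t, D t -> convexf (h t) /\
        (forall y, exists (w : 'cV[R]_d) (k : R), forall e,
          h t y + dotp w e <= h t (y + e) <= h t y + dotp w e + k * dotp e e),
      forall t y, D t -> h t y <= H t y
    & forall t (c : 'cV[R]_d), D t -> `|c| <= r -> H t (u0 t + c) - eps <= h t (u0 t + c)].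
Proof.
have b_ge0 t : D t -> 0 <= b by move=> Dt; apply: le_trans (u0b Dt).
pose r1 := `|b| + r.
have r1_ge0 : 0 <= r1 by rewrite addr_ge0// ltW.
have [M M0 HM] := Hbound (r1 + 1).
(* The slope that [convexf_lower] gives on the ball of radius [r1]; it also dominates [a t], the
   slope in the global lower bound on [H t]. *)
pose L t := 2 * (M + (1 + `|r1 + 1|) * a t).
have La t : D t -> 0 <= a t <= L t.
  move=> Dt; have a0 := a_ge0 Dt; rewrite a0 /= /L.
  have : 0 <= `|r1 + 1| * a t by rewrite mulr_ge0.
  lra.
(* With this parameter a slope [x] between [0] and [L t] costs at most
   [x ^+ 2 / (2 * k t) <= eps]. *)
pose k t := (1 + L t ^+ 2) / eps.
have k0 t : 0 < k t by rewrite /k divr_gt0// ltr_pwDl// sqr_ge0.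
have sq_le x t : 0 <= x <= L t -> x ^+ 2 / (2 * k t) <= eps.
  move=> /andP[x0 xL]; have kt := k0 t.
  rewrite ler_pdivrMr; last lra.
  have -> : eps * (2 * k t) = 2 * (1 + L t ^+ 2) by rewrite /k mulrCA [eps * _]mulrC divfK ?gt_eqF.
  have : x ^+ 2 <= L t ^+ 2 by rewrite ler_sqr// nnegrE// (le_trans x0).
  by have := sqr_ge0 (L t); lra.
pose h t y := moreau (H t) (k t) y.
have h_le t y : D t -> h t y <= H t y by move=> Dt; apply: moreau_le => //; exact: Hconv.
have h_low t y : D t -> - (a t * `|y|) - eps <= h t y.
  move=> Dt; have [z hz _] := moreau_min y (Hconv Dt) (k0 t).
  rewrite /h hz; have Hz := Hlb z Dt; have at0 := a_ge0 Dt.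
  have H1 := sqr_norm_le_dotp (z - y); set s := `|z - y| in H1.
  have H2 : a t * `|z| <= a t * `|y| + a t * s.
    rewrite -mulrDr ler_wpM2l// -{1}(subrK y z) addrC.
    exact: ler_normD.
  have H3 : k t / 2 * s ^+ 2 <= k t / 2 * dotp (z - y) (z - y).
    by rewrite ler_pM2l// divr_gt0.
  have H4 : 0 <= k t / 2 * (s - a t / k t) ^+ 2.
    by rewrite mulr_ge0 ?sqr_ge0// divr_ge0// ltW.
  have kt := k0 t.
  have H5 : k t / 2 * (s - a t / k t) ^+ 2 = k t / 2 * s ^+ 2 - a t * s + a t ^+ 2 / (2 * k t).
    by field; lra.
  have H6 := sq_le _ _ (La _ Dt).
  lra.
have mk : measurable_fun D k.
  apply: measurable_funM => //; apply: measurable_funD => //; apply: measurable_funX.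
  apply: measurable_funM => //; apply: measurable_funD => //.
  by apply: measurable_funM => //; exact: intg_measurable ia.
exists h; split => //.
- move=> c; apply: (@intg_le _ _ _ _ _ mD _ (fun t => `|H t (u0 t + c)| + ((b + `|c|) * a t + eps))).
  + by apply: measurable_moreau => //; exact: shift_measurable.
  + move=> t Dt; have H1 := h_le t (u0 t + c) Dt; have H2 := h_low t (u0 t + c) Dt.
    have H3 := ler_norm (H t (u0 t + c)); have H4 := normr_ge0 (H t (u0 t + c)).
    have H5 : a t * `|u0 t + c| <= (b + `|c|) * a t.
      by rewrite mulrC ler_wpM2r ?a_ge0// shift_bounded.
    have H6 : 0 <= a t * `|u0 t + c| by rewrite mulr_ge0// a_ge0.
    have e_gt0 := eps0.
    by rewrite ler_norml; apply/andP; split; lra.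
  + apply: intgD => //; first by apply: intg_norm => //; exact: intg_psi.
    by apply: intgD => //; [exact: intgZ|exact: intg_cst].
- move=> t Dt; split; first exact: moreau_convex (Hconv Dt) (k0 t).
  move=> y; have [p pP] := moreau_diff y (Hconv Dt) (k0 t).
  by exists p, (k t / 2).
- move=> t c Dt cr; have yr : `|u0 t + c| <= r1.
    by apply: le_trans (ler_normD _ _) _; apply: lerD => //; exact: le_trans (u0b Dt) (ler_norm _).
  have low z : H t (u0 t + c) - L t * `|z - (u0 t + c)| <= H t z.
    by apply: (@convexf_lower _ _ _ r1 _ _ _ (Hconv Dt)) => // x xr; exact: HM.
  have := moreau_ge (Hconv Dt) (k0 t) low.
  have : 0 <= L t <= L t by have /andP[] := La _ Dt; lra.
  by move=> /sq_le; rewrite -/(h t _); lra.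
Qed.

End smoothing.

(** Differentiation under the integral at an interior minimizer. The difference quotients [Q e n]
    lie between [dotp (p t) e] and the full increment along [e]. They make [p] measurable as their
    limit, integrable by the bounds along [e] and [- e], and they converge dominatedly; minimality
    gives the integral of [dotp (p t) e] a sign for [e] and for [- e]. *)
Lemma gradient_zero_mean (h : X -> 'cV[R]_d -> R) (r : R) (c : 'cV[R]_d) p :
  (forall c : 'cV[R]_d, intg mu D (fun t => h t (u0 t + c))) ->
  (forall t, D t -> convexf (h t)) ->
  (forall t, D t -> exists k : R, forall e,
     h t (u0 t + c) + dotp (p t) e <= h t (u0 t + c + e)
       <= h t (u0 t + c) + dotp (p t) e + k * dotp e e) ->
  (forall c' : 'cV[R]_d, `|c'| <= r -> \int[mu]_(t in D) h t (u0 t + c) <=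
                           \int[mu]_(t in D) h t (u0 t + c')) ->
  `|c| < r ->
  vintg p /\ (forall i, \int[mu]_(t in D) p t i 0 = 0).
Proof.
move=> ih ch hp cmin cr.
pose y0 t := u0 t + c.
have ihe e : intg mu D (fun t => h t (y0 t + e)).
  by apply: (intg_eq mD _ (ih (c + e))) => t _; rewrite /y0 addrA.
have ih0 : intg mu D (fun t => h t (y0 t)) by exact: ih.
pose Q (e : 'cV[R]_d) (n : nat) t := n.+1%:R * (h t (y0 t + n.+1%:R^-1 *: e) - h t (y0 t)).
have iQ e n : intg mu D (Q e n) by apply: intgZ => //; apply: intgB.
have n0 (n : nat) : 0 < n.+1%:R :> R by rewrite ltr0n.
have Qlow e n t : D t -> dotp (p t) e <= Q e n t.
  move=> Dt; have [k /(_ (n.+1%:R^-1 *: e))/andP[]] := hp t Dt.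
  rewrite -/(y0 t) dotpZr /Q => H1 _.
  by rewrite -ler_pdivrMl// lerBrDl.
have Qup e n t : D t -> Q e n t <= h t (y0 t + e) - h t (y0 t).
  move=> Dt; rewrite /Q -ler_pdivlMl//.
  have := ch t Dt (y0 t + e) (y0 t) n.+1%:R^-1.
  rewrite invr_ge0 ltW//= invf_le1// ler1n => /(_ isT).
  have -> : n.+1%:R^-1 *: (y0 t + e) + (1 - n.+1%:R^-1) *: y0 t = y0 t + n.+1%:R^-1 *: e.
    by rewrite scalerDr addrAC -scalerDl subrKC scale1r.
  by move: (n.+1%:R^-1 : R) => s; lra.
have Qcvg e t : D t -> Q e n t @[n --> \oo] --> dotp (p t) e.
  move=> Dt; have [k kP] := hp t Dt.
  apply: (@squeeze_cvgr _ _ _ _ (fun=> dotp (p t) e)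
    (fun n : nat => dotp (p t) e + (k * dotp e e) * n.+1%:R^-1)).
  - apply: nearW => n; rewrite Qlow//= /Q.
    have /andP[_] := kP (n.+1%:R^-1 *: e); rewrite -/(y0 t) !dotpZr dotpZl => H1.
    rewrite -ler_pdivlMl//; have -> : n.+1%:R^-1 * (dotp (p t) e + k * dotp e e * n.+1%:R^-1) =
      n.+1%:R^-1 * dotp (p t) e + k * (n.+1%:R^-1 * (n.+1%:R^-1 * dotp e e)).
      by move: (n.+1%:R^-1 : R) => s; ring.
    by rewrite lerBlDl addrA.
  - exact: cvg_cst.
  - rewrite -[X in _ --> X]addr0; apply: cvgD; first exact: cvg_cst.
    rewrite -(mulr0 (k * dotp e e)).
    by apply: cvgM; [exact: cvg_cst|exact: cvg_harmonic].
have mdot e : measurable_fun D (fun t => dotp (p t) e).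
  apply: (@measurable_fun_cvg _ _ _ _ (Q e)) => [n|t Dt]; last exact: Qcvg.
  exact: intg_measurable (iQ e n).
have ip : vintg p.
  move=> i; apply: (@intg_le _ _ _ _ _ mD _ (fun t =>
      `|h t (y0 t + basis_vec i) - h t (y0 t)| + `|h t (y0 t + - basis_vec i) - h t (y0 t)|)).
  - by apply: (eq_measurable_fun (fun t => dotp (p t) (basis_vec i))) => [t _|//]; rewrite dotp_basis.
  - move=> t Dt; have H1 := Qlow (basis_vec i) 0%N t Dt; have H2 := Qlow (- basis_vec i) 0%N t Dt.
    have H3 := Qup (basis_vec i) 0%N t Dt; have H4 := Qup (- basis_vec i) 0%N t Dt.
    move: H1 H2; rewrite dotpNr dotp_basis => H1 H2.
    set A := h t (y0 t + basis_vec i) - _ in H3 *; set B := h t (y0 t + - _) - _ in H4 *.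
    have := ler_norm A; have := ler_norm B; have := normr_ge0 A; have := normr_ge0 B.
    by rewrite ler_norml => *; apply/andP; split; lra.
  - by apply: intgD => //; apply: intg_norm => //; exact: intgB.
split=> // i.
have ge0 e : 0 <= \int[mu]_(t in D) dotp (p t) e.
  have idot : intg mu D (fun t => dotp (p t) e) by exact: vintg_dotp.
  have Qint : \int[mu]_(t in D) Q e n t @[n --> \oo] --> \int[mu]_(t in D) dotp (p t) e.
    apply: fine_cvg; rewrite /Rintegral fineK; last exact: integrable_fin_num.
    pose B t := `|dotp (p t) e| + `|h t (y0 t + e) - h t (y0 t)|.
    apply: (@dominated_cvg _ _ _ mu D mD (fun n t => (Q e n t)%:E) _ (EFin \o B)).
    - by move=> n; apply/measurable_EFinP; exact: intg_measurable (iQ e n).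
    - by move=> t Dt; apply: cvg_EFin; [exact: nearW|exact: Qcvg].
    - by [].
    - by apply: intgD => //; apply: intg_norm => //; exact: intgB.
    - move=> n t Dt /=; rewrite lee_fin /B; have H1 := Qlow e n t Dt; have H2 := Qup e n t Dt.
      set A := dotp (p t) e in H1 *; set A' := h t (y0 t + e) - _ in H2 *.
      have := ler_norm A'; have := ler_norm (- A); have := normr_ge0 A; have := normr_ge0 A'.
      by rewrite normrN ler_norml => *; apply/andP; split; lra.
  rewrite -(cvg_lim (@Rhausdorff R) Qint); apply: limr_ge; first by apply/cvg_ex; eexists; exact: Qint.
  near=> n; rewrite RintegralZl//; last exact: intgB.
  rewrite pmulr_rge0// (RintegralB mD (ihe _) ih0) subr_ge0.
  have -> : \int[mu]_(x in D) h x (y0 x + n.+1%:R^-1 *: e) =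
      \int[mu]_(x in D) h x (u0 x + (c + n.+1%:R^-1 *: e)).
    by apply: eq_Rintegral => x _; rewrite /y0 addrA.
  apply: cmin; rewrite (le_trans (ler_normD _ _))// -lerBrDl normrZ ger0_norm ?invr_ge0//.
  rewrite ler_pdivrMl//.
  have : `|e| / (r - `|c|) <= n.+1%:R.
    apply: (@le_trans _ _ n%:R); last by rewrite ler_nat.
    by near: n; exact: nbhs_infty_ger.
  by rewrite ler_pdivrMr// subr_gt0.
have := ge0 (basis_vec i); have := ge0 (- basis_vec i).
under eq_Rintegral do rewrite dotpNr dotp_basis.
rewrite (RintegralN mD (ip i)); under [in X in _ -> 0 <= X -> _]eq_Rintegral do rewrite dotp_basis.
by move=> H1 H2; lra.
Unshelve. all: by end_near. Qed.

(* No measurable selection of subgradients of H(t, .) is needed: [q] is the gradient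
   field of a smoothing of H at a minimizer, where it has zero mean. *)
Lemma zero_mean_duality : exists2 c, (forall c', psi c <= psi c') &
  forall e : R, 0 < e -> exists q, [/\ vintg q,
    forall i, \int[mu]_(t in D) q t i 0 = 0,
    mu.-integrable D (fun t => conjH t (q t)) &
    (\int[mu]_(t in D) conjH t (q t) <=
      (\int[mu]_(t in D) dotp (q t) (u0 t) - psi c + e)%:E)%E].
Proof.
have [c cmin] := psi_min; exists c => // e e0.
have [r r0 rP] := psi_coercive.
pose m := fine (mu D); have m0 : 0 <= m by exact: fine_ge0.
(* The total smoothing error is [eps * m]. It is at most [e] for the final estimate and at most
   [2^-1], below the margin [1] of [psi_coercive], which keeps the minimizer [c1] of the smoothed
   functional off the sphere of radius [r]. The [1 +] covers the case [m = 0]. *)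
pose eps := Num.min e (2^-1) / (1 + m).
have m1 : 0 < 1 + m by lra.
have emin : 0 < Num.min e 2^-1 by rewrite lt_min e0 invr_gt0 ltr0n.
have eps0 : 0 < eps by rewrite divr_gt0.
have epsm : eps * m <= Num.min e 2^-1.
  by rewrite /eps mulrAC ler_pdivrMr// ler_pM2l//; lra.
have /andP[epse eps2] : (eps * m <= e) && (eps * m <= 2^-1) by rewrite -le_min.
have [h [ih hP hH Hh]] := exists_smoothing r0 eps0.
pose psih c := \int[mu]_(t in D) h t (u0 t + c).
have ch t : D t -> convexf (h t) by move=> /hP[].
have cpsih : convexf psih by exact: Rintegral_convex.
have [|c1 c1A c1min] := @compact_EVT_min _ R psih [set x | `|x| <= r] _
    (@closed_ball_compactV R d _) (continuous_subspaceT (convexf_continuous cpsih)).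
  by exists 0 => /=; rewrite normr0 ltW.
rewrite inE /= in c1A.
have psih_ge c' : `|c'| <= r -> psi c' - eps * m <= psih c'.
  move=> c'r; rewrite /psi /psih -Rintegral_cst// -RintegralB//; last 2 first.
    exact: intg_psi.
    exact: intg_cst.
  apply: le_Rintegral => //; last by move=> t Dt; exact: Hh.
    by apply: intgB => //; [exact: intg_psi|exact: intg_cst].
  exact: ih.
have c1r : `|c1| < r.
  rewrite lt_neqAle c1A andbT; apply/eqP => c1E.
  have H1 := rP c1; rewrite c1E lexx in H1; have {}H1 := H1 isT.
  have H2 := psih_ge _ c1A.
  have H3 : psih c1 <= psih 0 by apply: c1min; rewrite inE /= normr0 ltW.
  have H4 : psih 0 <= psi 0.
    by apply: le_Rintegral => //; [exact: ih|exact: intg_psi|move=> t Dt; exact: hH].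
  lra.
(* An arbitrary pointwise choice suffices, because [gradient_zero_mean] derives the measurability of
   [p] from the difference quotients. *)
have /choice[p pP] t : exists w : 'cV[R]_d, D t -> exists k : R, forall e,
     h t (u0 t + c1) + dotp w e <= h t (u0 t + c1 + e)
       <= h t (u0 t + c1) + dotp w e + k * dotp e e.
  have [Dt|nDt] := pselect (D t); last by exists 0.
  by have [_ /(_ (u0 t + c1))[p pk]] := hP t Dt; exists p.
have [|ip p0] := @gradient_zero_mean h r c1 p ih ch pP _ c1r.
  by move=> c' c'r; apply: c1min; rewrite inE.
(* As [h t] lies below [H t], the conjugate of [H t] at [p t] is at most that of [h t], where
   Fenchel-Young is an equality at [u0 t + c1]; going back from [h t] to [H t] at that point loses
   only [eps]. *)
pose f t := dotp (p t) (u0 t) + dotp (p t) c1 - H t (u0 t + c1) + eps.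
have Cf t : D t -> (conjH t (p t) <= (f t)%:E)%E.
  move=> Dt; apply: ge_ereal_sup => _ [z _ <-] /=; rewrite -EFinB lee_fin.
  have [k /(_ (z - (u0 t + c1)))/andP[+ _]] := pP t Dt.
  rewrite (addrC _ (z - _)) subrK dotpBr dotpDr /f.
  have := hH t z Dt; have := Hh t c1 Dt c1A; lra.
have idot : intg mu D (fun t => dotp (p t) (u0 t)).
  apply: intg_sum => // i; apply: (@intg_mulbounded _ _ _ _ _ mD _ _ b) => //.
  by move=> t Dt; rewrite (le_trans (ler_coord_norm _ _))// u0b.
have iF : intg mu D f.
  apply: intgD => //; last exact: intg_cst.
  apply: intgB => //; last exact: intg_psi.
  by apply: intgD => //; exact: vintg_dotp.
have iC := conjH_le_intg (vintg_measurable ip) iF Cf.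
exists p; split => //.
apply: (@le_trans _ _ (\int[mu]_(t in D) f t)%:E).
  rewrite /Rintegral fineK; last exact: integrable_fin_num.
  by apply: le_integral => // t; rewrite inE; exact: Cf.
rewrite lee_fin /f RintegralD//; last 2 first.
  by apply: intgB => //; [apply: intgD => //; exact: vintg_dotp|exact: intg_psi].
  exact: intg_cst.
rewrite RintegralB//; last 2 first.
  by apply: intgD => //; exact: vintg_dotp.
  exact: intg_psi.
rewrite RintegralD//; last exact: vintg_dotp.
rewrite Rintegral_dotp_cst// addr0 Rintegral_cst// -/(psi c1) -/m.
by have := cmin c1; lra.
Qed.

End selection.

End integrand.

(** * Absolutely continuous functions on an interval *)

Lemma Rintegral_null_diff {R : realType} {dX : measure_display} {X : measurableType dX}
    (mu : {measure set X -> \bar R}) (E A : set X) (f : X -> R) :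
  measurable E -> measurable A -> A `<=` E -> (mu (E `\` A) = 0)%E ->
  intg mu E f -> \int[mu]_(x in E) f x = \int[mu]_(x in A) f x.
Proof.
move=> mE mA AE EA0 iF; have mEA : measurable (E `\` A) by exact: measurableD.
rewrite -[in LHS](setDUK AE) Rintegral_setU//.
- rewrite [X in _ + X = _](_ : _ = 0) ?addr0//.
  rewrite /Rintegral null_set_integral//; apply/measurable_EFinP.
  by apply: measurable_funS (intg_measurable iF).
- by rewrite setDUK.
- by apply/disj_setPS => x [? []].
Qed.

(** * Lebesgue measurable sets and Borel sets of the line *)

Section lebesgue_sets.
Context {R : realType}.
Implicit Types (A : set R) (T : R).

Lemma measurable_lebR A : measurable (A : set (measurableTypeR R)) ->
  measurable (A : set (lebR R)).
Proof. exact: sub_caratheodory. Qed.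

Lemma lebE A : (leb (A : set (lebR R)) = lebesgue_measure A)%E.
Proof. by []. Qed.

Lemma measurable_itv_lebR (i : interval R) : measurable ([set` i] : set (lebR R)).
Proof. exact: measurable_lebR (measurable_itv i). Qed.

Lemma leb_itv_bounded (x y : bool) (a b : R) : a <= b ->
  (leb ([set` Interval (BSide x a) (BSide y b)] : set (lebR R)) = (b - a)%:E)%E.
Proof.
move=> ab; rewrite lebE lebesgue_measure_itv /= lte_fin; case: ltgtP ab => // -> _.
by rewrite subrr.
Qed.

Lemma leb_itv_lty T : (leb (`[0%R, T] : set (lebR R)) < +oo)%E.
Proof.
by rewrite lebE lebesgue_measure_itv /=; case: ifP; rewrite ?ltry.
Qed.

Lemma id_lebR_measurable : measurable_fun setT (id : lebR R -> measurableTypeR R).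
Proof. by move=> _ A mA; rewrite setTI; exact: measurable_lebR. Qed.

(** Reduces the comparison of integrals over Lebesgue measurable sets to Borel sets. *)
Lemma lebR_borel_decomp (E : set (lebR R)) : measurable E ->
  exists2 A : set R, measurable (A : set (measurableTypeR R)) &
    A `<=` E /\ (leb (E `\` A : set (lebR R)) = 0)%E.
Proof.
move=> mE; have : (completed_algebra_gen (@lebesgue_measure R)) E.
  by rewrite -g_sigma_completed_algebra_genE completed_caratheodory_measurable.
move=> [A mA [N negN <-]]; exists A => //; split; first exact: subsetUl.
case: negN => N' [mN' N'0 NN'].
have sub : (A `|` N) `\` A `<=` N' by move=> x [[//|Nx] _]; exact: NN'.
apply/eqP; rewrite eq_le measure_ge0 andbT.
by rewrite -N'0 le_outer_measure.
Qed.

Lemma ae_lebR (P : R -> Prop) : {ae (@lebesgue_measure R), forall t, P t} ->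
  \forall t \ae leb, P t.
Proof.
by move=> [N [mN N0 NP]]; exists N; split => //; exact: measurable_lebR.
Qed.

Lemma ae_leb1 (P Q : R -> Prop) : (forall t, P t -> Q t) ->
  (\forall t \ae leb, P t) -> \forall t \ae leb, Q t.
Proof. by move=> PQ; apply: (@filterS _ _ (ae_filter_ringOfSetsType leb)). Qed.

Lemma ae_leb2 (P Q S : R -> Prop) : (forall t, P t -> Q t -> S t) ->
  (\forall t \ae leb, P t) -> (\forall t \ae leb, Q t) -> \forall t \ae leb, S t.
Proof. by move=> PQ; apply: (@filterS2 _ _ (ae_filter_ringOfSetsType leb)). Qed.

Lemma ae_leb_neq (a : R) : \forall t \ae leb, t <> a.
Proof.
exists [set a]; split; first exact: measurable_lebR.
  by rewrite lebE; exact: lebesgue_measure_set1.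
by move=> t /= /contrapT.
Qed.

(** Borel Lebesgue measure is the image of the completed measure under the identity, which is
    measurable from Lebesgue to Borel sets. *)
Lemma integral_lebR_borel (A : set R) (f : R -> R) :
  measurable (A : set (measurableTypeR R)) ->
  (@lebesgue_measure R).-integrable setT (EFin \o f) ->
  intg leb setT (f : lebR R -> R) /\
  (\int[leb]_(x in (A : set (lebR R))) f x = \int[@lebesgue_measure R]_(x in A) f x)%R.
Proof.
move=> mA iF; have mf := measurable_int _ iF.
have mf' : measurable_fun (setT : set (lebR R)) (f : lebR R -> R).
  move=> _ B mB; rewrite setTI; apply: measurable_lebR.
  by rewrite -[X in measurable X]setTI; move/measurable_EFinP : mf; apply.
have iL : intg leb setT (f : lebR R -> R).
  apply/integrableP; split; first exact/measurable_EFinP.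
  have /integrableP[_] := iF; apply: le_lt_trans.
  have -> : (\int[@lebesgue_measure R]_x `|(EFin \o f) x| =
     \int[pushforward leb (id : lebR R -> measurableTypeR R)]_x `|(EFin \o f) x|)%E.
    by [].
  rewrite (@ge0_integral_pushforward _ _ _ _ _ _ id_lebR_measurable)//.
  by apply: measurableT_comp.
split=> //; rewrite /Rintegral; congr fine.
have -> : (\int[@lebesgue_measure R]_(x in A) (f x)%:E =
     \int[pushforward leb (id : lebR R -> measurableTypeR R)]_(x in A) (f x)%:E)%E.
  by [].
rewrite (@integral_pushforward _ _ _ _ _ _ id_lebR_measurable)//.
by apply: integrableS iL => //; exact: measurable_lebR.
Qed.

End lebesgue_sets.

Section small_sets.
Context {R : realType} {dX : measure_display} {X : measurableType dX}.
Variable mu : {measure set X -> \bar R}.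

Lemma Rintegral_bigsetU (D : set X) (f : X -> R) (m : nat) (F : 'I_m -> set X) :
  measurable D -> intg mu D f -> (forall x, D x -> 0 <= f x) ->
  (forall i, measurable (F i)) -> (forall i, F i `<=` D) -> trivIset setT F ->
  \int[mu]_(x in \big[setU/set0]_(i < m) F i) f x = \sum_(i < m) \int[mu]_(x in F i) f x.
Proof.
move=> mD iF f0 mF FD tF; rewrite /Rintegral.
have UD : \big[setU/set0]_(i < m) F i `<=` D.
  by elim/big_ind : _ => // A B AD BD; rewrite subUset; split.
have mU : measurable (\big[setU/set0]_(i < m) F i) by exact: bigsetU_measurable.
rewrite ge0_integral_bigsetU//.
- rewrite [RHS]sum_fine// => i _; apply: integrable_fin_num => //.
  exact: intgS (FD i) iF.
- exact: index_enum_uniq.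
- exact: sub_trivIset tF.
- by apply/measurable_EFinP; apply: measurable_funS (intg_measurable iF).
- by move=> x /UD Dx; rewrite lee_fin f0.
Qed.

Lemma intg_small (D : set X) (f : X -> R) (e : R) : measurable D -> intg mu D f -> 0 < e ->
  exists2 delta : R, 0 < delta & forall A, measurable A -> A `<=` D ->
    (mu A < delta%:E)%E -> \int[mu]_(x in A) `|f x| < e.
Proof.
move=> mD iF e0; have iF' : mu.-integrable setT (EFin \o (f \_ D)).
  by rewrite -restrict_EFin; apply/(integrable_mkcond _ mD).
have [del [del0 delP]] := integral_normr_continuous iF' e0.
exists del => // A mA AD /(delP _ mA); rewrite (@eq_Rintegral _ _ _ mu A (fun x => `|f x|))//.
by move=> x; rewrite inE => Ax; rewrite patchE mem_set//; exact: AD.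
Qed.

End small_sets.

(** * Primitives of integrable functions *)

Section primitive.
Context {R : realType} (T : R).
Hypothesis T0 : 0 < T.
Let D := (`[0, T]%classic : set (lebR R)).
Implicit Types (p : lebR R -> R) (F : R -> R).

(** The intersection with [[0, T]] keeps the integral meaningful at every real [t] under
    integrability on [D] alone; the primitive is constant beyond [T]. *)
Definition prim p (t : R) : R := \int[leb]_(s in (`[0, t]%classic : set (lebR R)) `&` D) p s.

Lemma mD0T : measurable D. Proof. exact: measurable_itv_lebR. Qed.


Lemma prim0 p : intg leb D p -> prim p 0 = 0.
Proof.
move=> ip; rewrite /prim.
have m0 : measurable ((`[0, 0]%classic : set (lebR R)) `&` D).
  by apply: measurableI; exact: measurable_itv_lebR.
rewrite (@Rintegral_null_diff _ _ _ leb _ set0)//; first by rewrite Rintegral_set0.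
  rewrite setD0; apply/eqP; rewrite eq_le measure_ge0 andbT.
  have <- : (leb (`[0%R, 0%R] : set (lebR R)) = 0)%E.
    by rewrite (@leb_itv_bounded _ true false 0 0)// subrr.
  by apply: le_measure; rewrite ?inE//; exact: measurable_itv_lebR.
by apply: intgS ip => //; exact: mD0T.
Qed.

Lemma prim_diff p (a b : R) : intg leb D p -> 0 <= a -> a <= b -> b <= T ->
  prim p b - prim p a = \int[leb]_(s in (`]a, b[%classic : set (lebR R))) p s.
Proof.
move=> ip a0 ab bT.
have mab : measurable (`]a, b]%classic : set (lebR R)) by exact: measurable_itv_lebR.
have mab' : measurable (`]a, b[%classic : set (lebR R)) by exact: measurable_itv_lebR.
have ma : measurable ((`[0, a]%classic : set (lebR R)) `&` D).
  by apply: measurableI; exact: measurable_itv_lebR.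
have abD : (`]a, b] : set (lebR R)) `<=` D.
  by move=> x; rewrite /D /= !in_itv /= => /andP[ax xb]; apply/andP; split; lra.
have bE : (`[0, b]%classic : set (lebR R)) `&` D =
    ((`[0, a]%classic : set (lebR R)) `&` D) `|` `]a, b]%classic.
  apply/seteqP; split=> x; rewrite /D /= !in_itv /=.
    move=> [/andP[x0 xb] xT]; have [xa|xa] := leP x a; first by left; split=> //; rewrite x0.
    by right; apply/andP.
  move=> [[/andP[x0 xa] ->]|/andP[ax xb]]; split=> //; apply/andP; split; lra.
have dab : [disjoint (`[0, a]%classic : set (lebR R)) `&` D & `]a, b]%classic].
  by apply/disj_setPS => x [[]]; rewrite /= !in_itv /= => /andP[_ xa] _ /andP[ax _]; lra.
rewrite /prim bE Rintegral_setU//; last first.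
  apply: intgS ip => //; first exact: mD0T.
    exact: measurableU.
  by rewrite subUset; split => //; exact: subIsetr.
rewrite addrC addrA (addrC (- _)) subrr add0r.
apply: Rintegral_null_diff => //.
- by apply: subset_itvl; rewrite bnd_simp.
- apply/eqP; rewrite eq_le measure_ge0 andbT.
  have <- : (leb (`[b, b] : set (lebR R)) = 0)%E.
    by rewrite (@leb_itv_bounded _ true false b b)// subrr.
  apply: le_measure; rewrite ?inE//; [exact: measurableD|exact: measurable_itv_lebR|].
  move=> x; rewrite /= !in_itv /= => -[/andP[ax xb]] /negP; rewrite ax /= -leNgt => bx.
  by rewrite bx xb.
- by apply: intgS ip => //; exact: mD0T.
Qed.

Definition ac1 F := forall e : R, 0 < e -> exists2 delta : R, 0 < delta &
  forall (m : nat) (a b : 'I_m -> R),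
    (forall i, [/\ 0 <= a i, a i <= b i & b i <= T]) ->
    trivIset setT (fun i => `]a i, b i[%classic) ->
    \sum_(i < m) (b i - a i) < delta ->
    \sum_(i < m) `|F (b i) - F (a i)| < e.

(** Absolute continuity of the integral of the absolute value of [p], applied to the union of the
    intervals. *)
Lemma ac1_prim p : intg leb D p -> ac1 (prim p).
Proof.
move=> ip e e0; have [del del0 delP] := intg_small mD0T ip e0.
exists del => // m a b ab tab sab.
pose I i := (`]a i, b i[%classic : set (lebR R)).
have mI i : measurable (I i) by exact: measurable_itv_lebR.
have ID i : I i `<=` D.
  move=> x; rewrite /I /D /= !in_itv /= => /andP[ax xb]; have [a0 _ bT] := ab i.
  by apply/andP; split; lra.
have inorm : intg leb D (fun x => `|p x|) by apply: intg_norm => //; exact: mD0T.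
apply: (@le_lt_trans _ _ (\sum_(i < m) \int[leb]_(x in I i) `|p x|)).
  apply: ler_sum => i _; have [a0 abi bT] := ab i.
  rewrite prim_diff//; apply: (le_normr_Rintegral (mI i)).
  exact: intgS mD0T (mI i) (ID i) ip.
rewrite -(@Rintegral_bigsetU _ _ _ leb D)//; last exact: mD0T.
apply: delP.
- exact: bigsetU_measurable.
- by elim/big_ind : _ => // A B AD BD; rewrite subUset; split.
- rewrite (@measure_bigsetU_ord _ _ _ leb m xpredT)//.
  rewrite (eq_bigr (fun i => (b i - a i)%:E)); first by rewrite sumEFin lte_fin.
  by move=> i _; have [_ abi _] := ab i; exact: (@leb_itv_bounded _ false true).
Qed.

(** The fundamental theorem of calculus is applied to Borel integrands, while [p] is only Lebesgue
    measurable. The representative [pb] is the density, on Borel sets, of the set function that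
    integrates [p] over [A] inside [D]; equality of integrals over all Lebesgue subsets of [D] then
    gives [pb = p] almost everywhere. *)
Lemma prim_borel p : intg leb D p -> exists pb : R -> R,
  [/\ (@lebesgue_measure R).-integrable setT (EFin \o pb),
      \forall t \ae leb, 0 <= t <= T -> pb t = p t &
      forall t, prim p t = \int[@lebesgue_measure R]_(s in `[0, t]) pb s].
Proof.
move=> ip.
have mDb : measurable (`[0, T]%classic : set (measurableTypeR R)) by exact: measurable_itv.
have Dfin : (@lebesgue_measure R `[0%R, T] < +oo)%E by exact: leb_itv_lty.
pose nu (A : set (measurableTypeR R)) : R := \int[leb]_(s in (A : set (lebR R)) `&` D) p s.
have mAD (A : set (measurableTypeR R)) : measurable A -> measurable ((A : set (lebR R)) `&` D).
  by move=> mA; apply: measurableI; [exact: measurable_lebR|exact: mD0T].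
have iAD (A : set (measurableTypeR R)) : measurable A -> intg leb ((A : set (lebR R)) `&` D) p.
  by move=> mA; apply: intgS ip => //; [exact: mD0T|exact: mAD].
have [||pb ipb pbE] := @abs_continuous_density R _ _ (@lebesgue_measure R) _ nu mDb Dfin.
- move=> A B mA mB AB; rewrite /nu setIUl Rintegral_setU//; try exact: mAD.
    by rewrite -setIUl; apply: iAD; exact: measurableU.
  by rewrite /disj_set setIACA AB set0I eqxx.
- move=> e e0; have [del del0 delP] := intg_small mD0T ip e0; exists del => // A mA Adel.
  apply: le_trans (le_normr_Rintegral (mAD _ mA) (iAD _ mA)) _.
  by apply/ltW/delP => //; exact: mAD.
exists pb; split=> //; last first.
  by move=> t; rewrite -pbE//; exact: measurable_itv.
have [ipbT _] := integral_lebR_borel mDb ipb.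
have ipbD : intg leb D pb by apply: intgS ipbT => //; exact: mD0T.
have := @integral_ae_eq _ _ _ leb D mD0T (EFin \o p) (EFin \o pb) ipbD (measurable_int _ ip).
move=> /(_ _)[|N [mN N0 NP]]; last first.
  exists N; split=> // t tP; apply: NP => /= tE; apply: tP => t0T.
  by apply: EFin_inj; apply: tE; rewrite /D /= in_itv.
(* [E] is replaced by a Borel subset that differs from it by a null set; there [pb] has the right
   integral by construction. *)
move=> E ED mE; have [A mA [AE EA0]] := lebR_borel_decomp mE.
have mA' := measurable_lebR mA.
have ipE : intg leb E p by apply: intgS ip => //; exact: mD0T.
have ipbE : intg leb E pb by apply: intgS ipbT.
suff : \int[leb]_(x in E) pb x = \int[leb]_(x in E) p x.
  move=> H; rewrite -(fineK (integrable_fin_num mE ipbE)) -(fineK (integrable_fin_num mE ipE)).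
  by congr EFin; exact: H.
rewrite (Rintegral_null_diff mE mA' AE EA0 ipbE) (Rintegral_null_diff mE mA' AE EA0 ipE).
have [_ ->] := integral_lebR_borel mA ipb.
rewrite -pbE// /nu setIidl//.
exact: subset_trans AE ED.
Qed.

Lemma prim_derivable p : intg leb D p -> \forall t \ae leb, 0 <= t <= T ->
  derivable (prim p) t 1 /\ derive1 (prim p) t = p t.
Proof.
move=> ip; have [pb [ipb pbp pbE]] := prim_borel ip.
have -> : prim p = (fun t => \int[@lebesgue_measure R]_(s in `[0, t]) pb s).
  by apply/funext => t; exact: pbE.
have ipby (y : R) : (@lebesgue_measure R).-integrable `[0, y] (EFin \o pb).
  by apply: integrableS ipb => //; exact: measurable_itv.
have ipbl : locally_integrable setT pb.
  by have := integrable_locally measurableT ipb; rewrite patch_setT.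
have H' := ae_lebR (@FTC1 R pb (BLeft 0) ipby ipbl).
have H2 := ae_leb2 (fun t A B => conj A B) (ae_leb_neq 0) H'.
apply: (ae_leb2 _ pbp H2) => t Hp [t0 +] t0T; rewrite -(Hp t0T); apply.
by change (0 < t); rewrite lt_neqAle eq_sym; case/andP: t0T => -> _; rewrite andbT; apply/eqP.
Qed.

End primitive.

(** * Absolutely continuous functions are primitives *)

Section step_functions.
Context {R : realType} (T : R) (F : R -> R).
Hypotheses (T0 : 0 < T) (acF : ac1 T F).
Let D := (`[0, T]%classic : set (lebR R)).

Lemma ac1_continuous (e : R) : 0 < e -> exists2 delta : R, 0 < delta &
  forall x y, 0 <= x <= T -> 0 <= y <= T -> `|x - y| < delta -> `|F x - F y| < e.
Proof.
move=> e0; have [del del0 delP] := acF e0; exists del => //.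
have le_case x y : 0 <= x -> x <= y -> y <= T -> `|x - y| < del -> `|F y - F x| < e.
  move=> x0 xy yT xydel; have := delP 1%N (fun=> x) (fun=> y) (fun=> And3 x0 xy yT).
  rewrite !big_ord1; apply.
    by move=> i j _ _ _; rewrite (ord1 i) (ord1 j).
  by rewrite -(ger0_norm (_ : 0 <= y - x)) ?subr_ge0// distrC.
move=> x y /andP[x0 xT] /andP[y0 yT] xy; have [le_xy|/ltW le_yx] := leP x y.
  by rewrite distrC; exact: le_case.
by apply: le_case => //; rewrite distrC.
Qed.

Section partition.
Variables (N : nat) (h : R).
Hypotheses (h0 : 0 < h) (Nh : N%:R * h = T).

Definition incr i := F (i.+1%:R * h) - F (i%:R * h).

Lemma node_le i j : (i <= j)%N -> i%:R * h <= j%:R * h.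
Proof. by move=> ij; rewrite ler_pM2r// ler_nat. Qed.

Lemma nodeS (i : nat) : i.+1%:R * h = i%:R * h + h.
Proof. by rewrite -natr1 mulrDl mul1r. Qed.

Lemma node_in i : (i <= N)%N -> 0 <= i%:R * h <= T.
Proof. by move=> iN; rewrite mulr_ge0 ?ler0n ?(ltW h0)//= -Nh node_le. Qed.

(** Absolute continuity for the cells selected by [P]. All [N] indices are kept and the other
    intervals are made empty, which avoids a reindexing. *)
Lemma incr_sum_small (e delta : R) (P : pred nat) :
  (forall (m : nat) (a b : 'I_m -> R),
    (forall i, [/\ 0 <= a i, a i <= b i & b i <= T]) ->
    trivIset setT (fun i => `]a i, b i[%classic) ->
    \sum_(i < m) (b i - a i) < delta ->
    \sum_(i < m) `|F (b i) - F (a i)| < e) ->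
  \sum_(i < N | P i) h < delta -> \sum_(i < N | P i) `|incr i| < e.
Proof.
move=> delP sP; pose a (i : 'I_N) := i%:R * h.
pose b (i : 'I_N) := if P i then i.+1%:R * h else i%:R * h.
have bh i : b i <= i.+1%:R * h by rewrite /b; case: ifP => // _; exact: node_le.
have -> : \sum_(i < N | P i) `|incr i| = \sum_(i < N) `|F (b i) - F (a i)|.
  rewrite big_mkcond/=; apply: eq_bigr => i _; rewrite /b /a /incr.
  by case: ifP => _ //; rewrite subrr normr0.
apply: delP.
- move=> i; have /andP[i0 iT] := node_in (ltnW (ltn_ord i)).
  have /andP[_ iT'] := node_in (ltn_ord i).
  split=> //; last exact: le_trans (bh i) iT'.
  by rewrite /a /b; case: ifP => // _; exact: node_le.
- move=> i j _ _ [x [/=]]; rewrite !in_itv /= => /andP[ax xb] /andP[ay yb].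
  apply: val_inj; apply/eqP; rewrite /= eqn_leq.
  have := lt_le_trans (lt_trans ax yb) (bh j); have := lt_le_trans (lt_trans ay xb) (bh i).
  by rewrite /a !ltr_pM2r// !ltr_nat !ltnS => -> ->.
- rewrite (_ : \sum_(i < N) _ = \sum_(i < N | P i) h)// [RHS]big_mkcond/=.
  apply: eq_bigr => i _; rewrite /b /a; case: ifP => _; last by rewrite subrr.
  by rewrite nodeS addrC addKr.
Qed.

(** Half-open, so that the cells are disjoint and the first [N] of them cover [[0, T[]. *)
Definition cell (i : nat) : set (lebR R) := `[i%:R * h, i.+1%:R * h[%classic.

Definition step (t : lebR R) : R := \sum_(i < N) (incr i / h * \1_(cell i) t).

Lemma measurable_cell i : measurable (cell i).
Proof. exact: measurable_itv_lebR. Qed.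

Lemma leb_cell i : leb (cell i) = h%:E.
Proof.
have -> : h = i.+1%:R * h - i%:R * h by rewrite nodeS addrC addKr.
by apply: (@leb_itv_bounded _ true true); exact: node_le.
Qed.

Lemma intg_step : intg leb D step.
Proof.
apply: intg_sum => [|i]; first exact: mD0T.
apply: intgZ; first exact: mD0T.
apply: (@intg_le _ _ _ _ _ (mD0T T) _ (fun=> 1)).
- by apply: measurable_indic; exact: measurable_cell.
- by move=> t _; rewrite indicE; case: (_ \in _); rewrite ?normr0 ?normr1.
- by apply: intg_cst; [exact: mD0T|exact: leb_itv_lty].
Qed.

Definition weight (E : set (lebR R)) i : R := fine (leb (cell i `&` E)).

Lemma weight_fin (E : set (lebR R)) i : measurable E -> leb (cell i `&` E) \is a fin_num.
Proof.
move=> mE; rewrite ge0_fin_numE//; apply: (@le_lt_trans _ _ (leb (cell i))).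
  apply: le_measure; rewrite ?inE//; last exact: measurable_cell.
  by apply: measurableI => //; exact: measurable_cell.
by rewrite leb_cell ltry.
Qed.

Lemma weight_bounds (E : set (lebR R)) i : measurable E -> 0 <= weight E i <= h.
Proof.
move=> mE; rewrite /weight fine_ge0//= -lee_fin fineK ?weight_fin//.
rewrite -(leb_cell i); apply: le_measure; rewrite ?inE//; last exact: measurable_cell.
by apply: measurableI => //; exact: measurable_cell.
Qed.

Lemma Rintegral_step (E : set (lebR R)) : measurable E -> E `<=` D ->
  \int[leb]_(t in E) step t = \sum_(i < N) incr i / h * weight E i.
Proof.
move=> mE ED.
have i1 i : intg leb E (\1_(cell i) : lebR R -> R).
  apply: (intgS (mD0T T) mE ED); apply: (@intg_le _ _ _ _ _ (mD0T T) _ (fun=> 1)).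
  - by apply: measurable_indic; exact: measurable_cell.
  - by move=> t _; rewrite indicE; case: (_ \in _); rewrite ?normr0 ?normr1.
  - by apply: intg_cst; [exact: mD0T|exact: leb_itv_lty].
rewrite Rintegral_sum//; last by move=> i; exact: intgZ.
apply: eq_bigr => i _; rewrite (RintegralZl _ mE (i1 i)); congr (_ * _).
by rewrite /Rintegral integral_indic//; exact: measurable_cell.
Qed.

Lemma sum_weight (E : set (lebR R)) (r : R) : measurable E -> (leb E <= r%:E)%E ->
  \sum_(i < N) weight E i <= r.
Proof.
move=> mE Er.
pose G (i : 'I_N) := cell i `&` E.
have mG i : measurable (G i) by apply: measurableI => //; exact: measurable_cell.
have tG : trivIset setT G.
  move=> i j _ _ [x [[+ _] [+ _]]]; rewrite /cell /= !in_itv /= => /andP[ix xi] /andP[jx xj].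
  apply: val_inj; apply/eqP; rewrite /= eqn_leq.
  have := le_lt_trans ix xj; have := le_lt_trans jx xi.
  by rewrite !ltr_pM2r// !ltr_nat !ltnS => -> ->.
rewrite -lee_fin -sumEFin; apply: le_trans Er.
rewrite (eq_bigr (fun i => leb (G i))); last first.
  by move=> i _; rewrite /weight fineK// weight_fin.
rewrite -(@measure_bigsetU_ord _ _ _ leb N xpredT)//.
apply: le_measure; rewrite ?inE//; first exact: bigsetU_measurable.
elim/big_ind : _ => [//|A B AE BE|i _]; first by rewrite subUset; split.
exact: subIsetr.
Qed.

Lemma incr_over_h i (E : set (lebR R)) : measurable E ->
  `|incr i / h * weight E i| <= `|incr i|.
Proof.
move=> mE; have /andP[w0 wh] := weight_bounds i mE.
rewrite !normrM normfV (ger0_norm w0) (gtr0_norm h0) -mulrA ler_piMr//.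
by rewrite ler_pdivrMl// mulr1.
Qed.

End partition.

(* Uniform integrability of the difference quotients: the cells carrying a large
   quotient have small total length because the variation is bounded. *)
Lemma step_uniform (q : nat) (del1 : R) :
  0 < T / q%:R < del1 -> (0 < q)%N ->
  (forall (m : nat) (a b : 'I_m -> R),
    (forall i, [/\ 0 <= a i, a i <= b i & b i <= T]) ->
    trivIset setT (fun i => `]a i, b i[%classic) ->
    \sum_(i < m) (b i - a i) < del1 ->
    \sum_(i < m) `|F (b i) - F (a i)| < 1) ->
  let N k := (q * k.+1)%N in let h k := T / (N k)%:R in
  (forall k A, measurable A -> A `<=` D ->
     `|\int[leb]_(t in A) step (N k) (h k) t| <= q%:R) /\
  unif_abs_cont leb D (fun k => step (N k) (h k)).
Proof.
move=> /andP[Tq Tqd] q0 del1P N h.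
have N0 k : (0 < N k)%N by rewrite muln_gt0 q0.
have h0 k : 0 < h k by rewrite divr_gt0// ltr0n.
have Nh k : (N k)%:R * h k = T by rewrite mulrC divfK// pnatr_eq0 -lt0n.
(* Each of the [q] blocks of [k.+1] consecutive cells has length [T / q < del1], hence variation at
   most [1]. This bounds the total variation by [q], independently of [k]. *)
have var k : \sum_(i < N k) `|incr (h k) i| <= q%:R.
  rewrite -(big_mkord xpredT (fun i => `|incr (h k) i|)).
  suff H j : (j <= q)%N -> \sum_(0 <= i < j * k.+1) `|incr (h k) i| <= j%:R by exact: H.
  elim: j => [|j IH] jq; first by rewrite mul0n big_nil.
  have le1 : (j * k.+1 <= j.+1 * k.+1)%N by rewrite leq_mul2r leqnSn orbT.
  have le2 : (j.+1 * k.+1 <= N k)%N by rewrite leq_mul2r jq orbT.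
  rewrite (big_cat_nat (leq0n _) le1)/=.
  rewrite -natr1; apply: lerD; first exact: IH (ltnW jq).
  have ordE (f : nat -> R) : \sum_(j * k.+1 <= i < j.+1 * k.+1) f i =
      \sum_(i < N k | (j * k.+1 <= i < j.+1 * k.+1)%N) f i.
    rewrite (big_nat_widen _ _ (N k))//= (big_nat_widenl _ 0%N)//= big_mkord.
    by apply: eq_bigl => i; rewrite andbC.
  rewrite ordE; apply/ltW.
  apply: (@incr_sum_small (N k) (h k) (h0 k) (Nh k) 1 del1
    (fun i => (j * k.+1 <= i < j.+1 * k.+1)%N) del1P).
  rewrite -(ordE (fun=> h k)) sumr_const_nat mulSn addnK.
  suff -> : h k *+ k.+1 = T / q%:R by [].
  rewrite -mulr_natr /h /N natrM invfM mulrA -mulrA mulVf ?mulr1// pnatr_eq0.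
have absint k A : measurable A -> A `<=` D ->
    `|\int[leb]_(t in A) step (N k) (h k) t| <=
    \sum_(i < N k) `|incr (h k) i / h k * weight (h k) A i|.
  by move=> mA AD; rewrite Rintegral_step//; exact: ler_norm_sum.
split=> [k A mA AD|e e0].
  apply: le_trans (absint k A mA AD) _; apply: le_trans (var k).
  by apply: ler_sum => i _; exact: incr_over_h.
have e20 : 0 < e / 2 by rewrite divr_gt0.
have [del2 del20 del2P] := acF e20.
(* Chebyshev: the cells whose increment exceeds [K * h k] have total length at most [q / K < del2],
   so their increments sum to less than [e / 2]. The [+ 1] makes the inequality strict. *)
pose K := (q%:R + 1) / del2.
have qq : 0 <= q%:R :> R by rewrite ler0n.
have K0 : 0 < K by rewrite divr_gt0//; lra.
exists (e / 2 / K); first by rewrite divr_gt0.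
move=> k A mA AD Adel; apply: le_trans (absint k A mA AD) _.
pose P i := K * h k < `|incr (h k) i|.
rewrite (bigID (fun i : 'I_(N k) => P i))/=.
have -> : e = e / 2 + e / 2 by field.
apply: lerD.
  apply: (@le_trans _ _ (\sum_(i < N k | P i) `|incr (h k) i|)).
    by apply: ler_sum => i _; exact: incr_over_h.
  apply/ltW; apply: (@incr_sum_small (N k) (h k) (h0 k) (Nh k) _ del2) => //.
  apply: (@le_lt_trans _ _ (\sum_(i < N k | P i) `|incr (h k) i| / K)).
    by apply: ler_sum => i Pi; rewrite ler_pdivlMr// mulrC ltW.
  rewrite -mulr_suml ltr_pdivrMr//.
  apply: (@le_lt_trans _ _ q%:R).
    apply: le_trans (var k); rewrite [leRHS](bigID (fun i : 'I_(N k) => P i))/= lerDl.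
    exact: sumr_ge0.
  by rewrite /K mulrC divfK ?gt_eqF//; lra.
apply: (@le_trans _ _ (\sum_(i < N k | ~~ P i) K * weight (h k) A i)).
  apply: ler_sum => i; rewrite /P -leNgt => Pi; have /andP[w0 wh] := weight_bounds (h0 k) i mA.
  rewrite normrM (ger0_norm w0) ler_wpM2r//.
  by rewrite normrM normfV (gtr0_norm (h0 k)) ler_pdivrMr.
rewrite -mulr_sumr -ler_pdivlMl// mulrC.
apply: (@le_trans _ _ (\sum_(i < N k) weight (h k) A i)).
  rewrite [leRHS](bigID (fun i : 'I_(N k) => P i))/= lerDr.
  by apply: sumr_ge0 => i _; have /andP[] := weight_bounds (h0 k) i mA.
by apply: sum_weight => //; exact: ltW.
Qed.

(** The cells to the left of [t] telescope to [F (j * h) - F 0]. Only the cell containing [t] is met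
    partially; its contribution and [F t - F (j * h)] are small by uniform continuity. *)
Lemma step_cvg (N : nat -> nat) (h : nat -> R) t :
  (forall k, 0 < h k) -> (forall k, (N k)%:R * h k = T) -> h @ \oo --> 0 ->
  0 <= t <= T ->
  \int[leb]_(s in (`[0, t] : set (lebR R))) step (N k) (h k) s @[k --> \oo] --> F t - F 0.
Proof.
move=> h0 Nh hcvg /andP[t0 tT]; apply/cvgrPdist_lt => e e0.
have e20 : 0 < e / 2 by rewrite divr_gt0.
have [del del0 delP] := ac1_continuous e20.
near=> k.
have hdel : h k < del.
  by near: k; move/cvgrPdist_lt : hcvg => /(_ _ del0); apply: filterS => k; rewrite sub0r normrN => /(le_lt_trans (ler_norm _)).
have hk0 := h0 k; have Nhk := Nh k.
have mt : measurable (`[0, t] : set (lebR R)) by exact: measurable_itv_lebR.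
have tD : (`[0, t] : set (lebR R)) `<=` D by apply: subset_itvl; rewrite bnd_simp.
rewrite Rintegral_step//.
have th0 : 0 <= t / h k by rewrite divr_ge0// ltW.
pose j := Num.truncn (t / h k).
have /andP[jt tj] : j%:R * h k <= t < j.+1%:R * h k.
  by have := truncn_itv th0; rewrite ler_pdivlMr// ltr_pdivrMr.
have jN : (j <= N k)%N.
  by rewrite -(ler_nat R) -(ler_pM2r hk0) Nhk (le_trans jt).
have wlt i : (i < j)%N -> weight (h k) (`[0, t] : set (lebR R)) i = h k.
  move=> ij; rewrite /weight setIidl ?leb_cell// => x.
  rewrite /cell /= !in_itv /= => /andP[ix xi]; rewrite (le_trans _ ix) ?mulr_ge0 ?(ltW hk0)//=.
  by rewrite (le_trans (ltW xi))// (le_trans _ jt)// ler_pM2r// ler_nat.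
have wgt i : (j < i)%N -> weight (h k) (`[0, t] : set (lebR R)) i = 0.
  move=> ji; rewrite /weight (_ : _ `&` _ = set0) ?measure0//.
  apply/seteqP; split=> // x []; rewrite /cell /= !in_itv /= => /andP[ix _] /andP[_ xt].
  have : j.+1%:R * h k <= i%:R * h k by rewrite ler_pM2r// ler_nat.
  by move=> /(lt_le_trans tj)/lt_le_trans/(_ ix)/lt_le_trans/(_ xt); rewrite ltxx.
pose u i := incr (h k) i / h k * weight (h k) (`[0, t] : set (lebR R)) i.
rewrite -(big_mkord xpredT u) (big_cat_nat (leq0n _) jN)/=.
have -> : \sum_(0 <= i < j) u i = F (j%:R * h k) - F 0.
  rewrite (eq_big_nat _ _ (F2 := fun i => F (i.+1%:R * h k) - F (i%:R * h k))).
    by rewrite (telescope_sumr (fun i => F (i%:R * h k)))// mul0r.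
  by move=> i /andP[_ ij]; rewrite /u wlt// divfK// gt_eqF.
have jD : 0 <= j%:R * h k <= T by exact: (node_in hk0 Nhk).
have F1 : `|F t - F (j%:R * h k)| < e / 2.
  apply: delP => //; first by rewrite t0.
  rewrite ger0_norm ?subr_ge0// (lt_trans _ hdel)//.
  by move: tj; rewrite nodeS; lra.
have rest : `|\sum_(j <= i < N k) u i| < e / 2.
  (* The case [j = N k] is [t = T]: no partial cell remains. *)
  move: jN; rewrite leq_eqVlt => /orP[/eqP ->|jN]; first by rewrite big_geq// normr0.
  rewrite big_ltn// big_nat_cond big1 ?addr0; last first.
    by move=> i /andP[/andP[ji _] _]; rewrite /u wgt// mulr0.
  apply: le_lt_trans (incr_over_h hk0 j mt) _.
  rewrite /incr; apply: delP => //; first exact: (node_in hk0 Nhk).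
  by rewrite nodeS addrC addKr gtr0_norm.
set S := \sum_(j <= i < N k) u i in rest *.
rewrite (_ : _ - _ = (F t - F (j%:R * h k)) - S); last by ring.
by rewrite (le_lt_trans (ler_normB _ _))// (splitr e) ltrD.
Unshelve. all: by end_near. Qed.

(* The density is a weak limit of difference quotients along uniform partitions. *)
Lemma ac1_primitive : exists2 p : lebR R -> R, intg leb D p &
  forall t, 0 <= t <= T -> F t = F 0 + prim T p t.
Proof.
have [del1 del10 del1P] := acF ltr01.
pose q := (Num.truncn (T / del1)).+1.
have q0 : 0 < q%:R :> R by rewrite ltr0n.
have Tq : 0 < T / q%:R < del1.
  rewrite divr_gt0//= ltr_pdivrMr// mulrC -ltr_pdivrMr//.
  by have /andP[] := truncn_itv (ltW (divr_gt0 T0 del10)).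
pose N k := (q * k.+1)%N; pose h k := T / (N k)%:R.
have h0 k : 0 < h k by rewrite divr_gt0// ltr0n muln_gt0.
have Nh k : (N k)%:R * h k = T by rewrite mulrC divfK// pnatr_eq0.
have [bnd unif] := step_uniform Tq (ltn0Sn _) del1P.
have [U [UU UF]] := @ultraFilterLemma nat (nbhs \oo) _.
have [p ip pP] := @ultra_weak_limit R _ _ leb D U UU (mD0T T) (leb_itv_lty T) _ q%:R
  (fun k => intg_step (N k) (h k)) bnd unif.
exists p => // t t0T; rewrite -[F t](subrK (F 0)) addrC; congr (_ + _).
have mt : measurable (`[0, t] : set (lebR R)) by exact: measurable_itv_lebR.
have tD : (`[0, t] : set (lebR R)) `<=` D.
  by apply: subset_itvl; rewrite bnd_simp; case/andP: t0T.
have hcvg : h @ \oo --> 0.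
  have -> : h = (fun k => T / q%:R * k.+1%:R^-1).
    by apply/funext => k; rewrite /h /N natrM invfM mulrA.
  rewrite -(mulr0 (T / q%:R)); apply: cvgM; [exact: cvg_cst|exact: cvg_harmonic].
have c1 := pP _ mt tD; have c2 := step_cvg h0 Nh hcvg t0T.
(* [U] refines the neighbourhoods of infinity, so the limit along integers is also the limit along
   [U] and must agree with the weak limit. *)
have c3 : \int[leb]_(s in (`[0, t] : set (lebR R))) step (N k) (h k) s @[k --> U] --> F t - F 0.
  by apply: cvg_trans c2; exact: cvg_app.
have := cvg_unique (@Rhausdorff R) c3 c1; rewrite /prim => ->.
by rewrite setIidl.
Qed.

End step_functions.

Section ae_real.
Context {R : realType} {dX : measure_display} {X : measurableType dX}.
Variables (mu : {measure set X -> \bar R}) (D : set X).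
Hypothesis mD : measurable D.
Implicit Types f g : X -> R.

Definition aeD (P : X -> Prop) := \forall t \ae mu, D t -> P t.

Lemma aeD_ae_eq f g : aeD (fun t => f t = g t) -> ae_eq mu D (EFin \o f) (EFin \o g).
Proof. by apply: (@filterS _ _ (ae_filter_ringOfSetsType mu)) => t /= + Dt => ->. Qed.

Lemma intg_ae_eq f g : measurable_fun D g -> aeD (fun t => f t = g t) ->
  intg mu D f -> intg mu D g.
Proof.
move=> mg fg iF; apply/integrableP; split; first exact/measurable_EFinP.
have /integrableP[mf] := iF; apply: le_lt_trans.
rewrite (@ae_eq_integral _ _ _ mu D (fun t => `|(EFin \o f) t|)%E)//.
- by apply: measurableT_comp => //; exact/measurable_EFinP.
- exact: measurableT_comp.
- apply: (@filterS _ _ (ae_filter_ringOfSetsType mu)) fg => t /= fg Dt.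
  by rewrite fg.
Qed.

Lemma Rintegral_ae_eq f g : measurable_fun D f -> measurable_fun D g ->
  aeD (fun t => f t = g t) -> \int[mu]_(t in D) f t = \int[mu]_(t in D) g t.
Proof.
move=> mf mg fg; rewrite /Rintegral; congr fine.
apply: (@ae_eq_integral _ _ _ mu D (EFin \o g)) => //; last exact: aeD_ae_eq.
  exact/measurable_EFinP.
exact/measurable_EFinP.
Qed.

End ae_real.

(** * Calculus for absolutely continuous functions *)

Section calculus.
Context {R : realType} (T : R).
Hypothesis T0 : 0 < T.
Notation D := (`[0, T]%classic : set (lebR R)).
Implicit Types (f g p q : lebR R -> R) (F G : R -> R).

Let mD := mD0T T.

(** Completeness of Lebesgue measure. It makes [derive1] of an absolutely continuous function
    measurable, whatever its values where the derivative fails to exist. *)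
Lemma ae_leb_measurable f g : measurable_fun D f ->
  (\forall t \ae leb, 0 <= t <= T -> f t = g t) -> measurable_fun D g.
Proof.
move=> mf fg; apply/measurable_EFinP.
apply: (ae_measurable_fun (@completed_lebesgue_measure_is_complete R) (f := EFin \o f)).
  by apply: aeD_ae_eq; apply: ae_leb1 fg => t; rewrite /= in_itv.
exact/measurable_EFinP.
Qed.

(** The retraction onto [[0, T]]: composing with it turns an absolutely continuous function into a
    continuous function on the line, hence measurable and bounded on the interval. *)
Definition clamp (t : R) : R := Num.max 0 (Num.min t T).

Lemma clamp_in t : 0 <= clamp t <= T.
Proof. by rewrite /clamp le_max lexx /= ge_max (ltW T0) ge_min lexx orbT. Qed.

Lemma clamp_id t : 0 <= t <= T -> clamp t = t.
Proof. by move=> /andP[t0 tT]; rewrite /clamp min_l// max_r. Qed.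

Lemma clamp_lip s t : `|clamp s - clamp t| <= `|s - t|.
Proof.
have lip (u v : R) : clamp u - clamp v <= `|u - v|.
  have T0' := T0; have := ler_norm (u - v); have := normr_ge0 (u - v).
  rewrite /clamp !maxEle !minEle.
  case: (leP u T) => ?; case: (leP v T) => ?; case: (leP 0 u) => ?; case: (leP 0 v) => ?;
    rewrite ?(ltW T0'); lra.
by rewrite ler_norml lip andbT lerNl opprB distrC lip.
Qed.

Lemma ac1_clamp_continuous F : ac1 T F -> continuous (F \o clamp : R -> R^o).
Proof.
move=> acF x; apply/cvgrPdist_lt => e e0.
have [del del0 delP] := ac1_continuous acF e0.
near=> y; apply: delP; [exact: clamp_in|exact: clamp_in|].
apply: le_lt_trans (clamp_lip _ _) _; near: y; exact: cvgr_dist_lt.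
Unshelve. all: by end_near. Qed.

Lemma ac1_measurable F : ac1 T F -> measurable_fun D (F : lebR R -> R).
Proof.
move=> acF; have cF := ac1_clamp_continuous acF.
have mF : measurable_fun setT (F \o clamp : measurableTypeR R -> R).
  by apply: continuous_measurable_fun.
apply: (@eq_measurable_fun _ _ (lebR R) R D (F \o clamp : lebR R -> R)).
  by move=> t; rewrite inE /= in_itv /= => /clamp_id ->.
apply: measurable_funTS => _ B mB; rewrite setTI; apply: measurable_lebR.
by rewrite -[X in measurable X]setTI; exact: mF.
Qed.

Lemma ac1_bounded F : ac1 T F -> exists2 M : R, 0 <= M &
  forall t, 0 <= t <= T -> `|F t| <= M.
Proof.
move=> acF; have cF := ac1_clamp_continuous acF.
have cN : continuous (fun t => `|F (clamp t)| : R^o).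
  by move=> x; apply: (continuous_comp (cF x)); exact: norm_continuous.
have [c _ cmax] := EVT_max (ltW T0) (continuous_subspaceT cN).
exists `|F (clamp c)| => // t t0T.
by rewrite -[in leLHS](clamp_id t0T); apply: cmax; rewrite in_itv.
Qed.

Lemma ac1M F G : ac1 T F -> ac1 T G -> ac1 T (fun t => F t * G t).
Proof.
move=> acF acG e e0.
have [M M0 FM] := ac1_bounded acF; have [N N0 GN] := ac1_bounded acG.
have M1 : 0 < 2 * (M + 1) by lra.
have N1 : 0 < 2 * (N + 1) by lra.
have [d1 d10 d1P] := acF _ (divr_gt0 e0 N1); have [d2 d20 d2P] := acG _ (divr_gt0 e0 M1).
exists (Num.min d1 d2); first by rewrite lt_min d10.
move=> m a b ab tab; rewrite lt_min => /andP[s1 s2].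
have {}d1P := d1P _ _ _ ab tab s1; have {}d2P := d2P _ _ _ ab tab s2.
apply: (@le_lt_trans _ _ (\sum_(i < m) (M * `|G (b i) - G (a i)| + N * `|F (b i) - F (a i)|))).
  apply: ler_sum => i _; have [a0 abi bT] := ab i.
  rewrite (_ : _ - _ = F (b i) * (G (b i) - G (a i)) + G (a i) * (F (b i) - F (a i))); last by ring.
  apply: le_trans (ler_normD _ _) _; rewrite !normrM; apply: lerD; apply: ler_wpM2r => //.
    by apply: FM; rewrite (le_trans a0 abi).
  by apply: GN; rewrite a0 (le_trans abi).
rewrite big_split /= -!mulr_sumr.
have h1 := ler_wpM2l M0 (ltW d2P); have h2 := ler_wpM2l N0 (ltW d1P).
have h3 : M * (e / (2 * (M + 1))) < e / 2.
  by rewrite mulrA ltr_pdivrMr// (_ : e / 2 * _ = e * (M + 1)); [rewrite mulrC ltr_pM2l//; lra|field].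
have h4 : N * (e / (2 * (N + 1))) < e / 2.
  by rewrite mulrA ltr_pdivrMr// (_ : e / 2 * _ = e * (N + 1)); [rewrite mulrC ltr_pM2l//; lra|field].
lra.
Qed.

Lemma primT p : prim T p T = \int[leb]_(t in D) p t.
Proof. by rewrite /prim setIid. Qed.

Lemma ae_interior : \forall t \ae leb, 0 <= t <= T -> 0 < t < T.
Proof.
apply: ae_leb2 (ae_leb_neq 0) (ae_leb_neq T) => t t0 tT /andP[H1 H2].
by rewrite !lt_neqAle H1 H2 !andbT; apply/andP; split; apply/eqP => // /esym.
Qed.

(** The derivative is two-sided while the functions agree on [[0, T]] only, whence the restriction
    to interior points; [ae_interior] disposes of the endpoints. *)
Lemma derive1_near_eq (V : normedModType R) (F G : R -> V) (t : R) : 0 < t < T -> (forall s, 0 <= s <= T -> F s = G s) ->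
  derivable G t 1 -> derivable F t 1 /\ derive1 F t = derive1 G t.
Proof.
move=> /andP[t0 tT] FG dG.
have nFG : {near t, G =1 F}.
  near=> s; apply/esym/FG; apply/andP; split; apply/ltW.
    by near: s; exact: lt_nbhsr.
  by near: s; exact: lt_nbhsl.
have nFG' : {near t, F =1 G} by apply: filterS nFG => s ->.
split; first exact: near_eq_derivable nFG dG.
by rewrite !derive1E; exact: near_eq_derive nFG'.
Unshelve. all: by end_near. Qed.

(** The product of the primitives is absolutely continuous, hence itself the primitive of some [r].
    The product rule identifies [r] almost everywhere, and the value at [T] is the claim. *)
Lemma integration_by_parts_ac p q : intg leb D p -> intg leb D q ->
  \int[leb]_(t in D) (p t * prim T q t) + \int[leb]_(t in D) (q t * prim T p t) =
  (\int[leb]_(t in D) p t) * (\int[leb]_(t in D) q t).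
Proof.
move=> ip iq; have acP := ac1_prim ip; have acQ := ac1_prim iq.
have acPQ := ac1M acP acQ.
have [r ir rE] := ac1_primitive T0 acPQ.
have int_mul u v : intg leb D u -> intg leb D v -> intg leb D (fun t => u t * prim T v t).
  move=> iu iv; have acV := ac1_prim iv; have [M M0 HM] := ac1_bounded acV.
  apply: (@intg_mulbounded _ _ _ _ _ mD _ _ M) => //; exact: ac1_measurable.
have H : \forall t \ae leb, 0 <= t <= T ->
    r t = p t * prim T q t + q t * prim T p t.
  have := ae_leb2 (fun t a b => conj a b) (prim_derivable ip) (prim_derivable iq).
  apply: ae_leb2 (ae_leb2 (fun t a b => conj a b) ae_interior (prim_derivable ir)).
  move=> t [tI dr] [dp dq] t0T; have {}tI := tI t0T.
  have [{}dr drE] := dr t0T; have [{}dp dpE] := dp t0T; have [{}dq dqE] := dq t0T.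
  have E s : 0 <= s <= T -> prim T r s = prim T p s * prim T q s.
    move=> s0T; rewrite (rE s s0T) (prim0 ip) mul0r add0r//.
  have [_] := @derive1_near_eq R^o _ _ _ tI E (derivableM dp dq).
  rewrite drE => ->; rewrite derive1E; apply: etrans (deriveM dp dq) _.
  move: dpE dqE; rewrite !derive1E => -> ->.
  by rewrite addrC /GRing.scale /= mulrC [X in _ + X]mulrC.
rewrite -RintegralD//; try exact: int_mul.
transitivity (\int[leb]_(t in D) r t).
  apply/esym; apply: (Rintegral_ae_eq mD (intg_measurable ir)); last exact: H.
  by apply: measurable_funD; apply: intg_measurable; exact: int_mul.
have := rE T; rewrite lexx (ltW T0) => /(_ isT); rewrite (prim0 ip) mul0r add0r.
by rewrite !primT.
Qed.

End calculus.

Lemma ler_dist3 {R : realFieldType} (x y s t e : R) :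
  `|x - s| <= e / 3 -> `|y - t| <= e / 3 -> `|s - t| <= e / 3 -> `|x - y| <= e.
Proof.
move=> xs yt st; rewrite (_ : x - y = (x - s) - (y - t) + (s - t)); last by ring.
have := ler_normD ((x - s) - (y - t)) (s - t).
have := ler_normB (x - s) (y - t).
lra.
Qed.

(** * Weak continuity of a density integrated against a primitive *)

Section bilinear.
Context {R : realType} (T : R).
Hypothesis T0 : 0 < T.
Notation D := (`[0, T]%classic : set (lebR R)).
Implicit Types (f g p q : lebR R -> R).

Let mD := mD0T T.

Lemma intg_mul_prim f g : intg leb D f -> intg leb D g ->
  intg leb D (fun t => f t * prim T g t).
Proof.
move=> jf jg; have acg := ac1_prim jg; have [M M0 HM] := ac1_bounded T0 acg.
by apply: (@intg_mulbounded _ _ _ _ _ mD _ _ M) => //; exact: ac1_measurable.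
Qed.

(** Freezing [prim T g] at the left node of each cell costs at most its oscillation [e], and leaves
    a finite sum of products of integrals over fixed sets. There are [N.+1] cells because the last
    one, starting at [T], catches the endpoint. *)
Lemma prim_cell_approx f g (N : nat) (h e : R) : intg leb D f -> intg leb D g ->
  0 < h -> N%:R * h = T ->
  (forall s t, 0 <= s -> s <= t -> t <= T -> t - s <= h -> `|prim T g t - prim T g s| <= e) ->
  `|\int[leb]_(t in D) (f t * prim T g t) -
    \sum_(i < N.+1) prim T g (i%:R * h) * \int[leb]_(t in D `&` cell h i) f t| <=
  e * \int[leb]_(t in D) `|f t|.
Proof.
move=> jf jg h0 Nh osc.
pose u (i : nat) (t : lebR R) := prim T g (i%:R * h) * (f t * \1_(cell h i) t).
have ji i : intg leb D (fun t => f t * \1_(cell h i) t).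
  apply: (@intg_mulbounded _ _ _ _ _ mD _ _ 1) => //.
    by apply: measurable_indic; exact: measurable_cell.
  by move=> t _; rewrite indicE; case: (_ \in _); rewrite ?normr0 ?normr1.
have iu i : intg leb D (u i) by apply: intgZ => //; exact: mD.
rewrite (_ : \sum_(i < N.+1) _ = \int[leb]_(t in D) \sum_(i < N.+1) u i t); last first.
  rewrite Rintegral_sum//.
  apply: eq_bigr => i _; rewrite (RintegralZl _ mD (ji i)); congr (_ * _).
  by rewrite Rintegral_mkcondr; apply: eq_Rintegral => t _; rewrite patchE indicE; case: ifP; rewrite ?mulr1 ?mulr0.
have isum := @intg_sum _ _ _ leb D mD _ (index_enum ('I_N.+1 : finType)) (fun i => u i) (fun i => iu i).
have ip := intg_mul_prim jf jg.
rewrite -(RintegralB mD ip isum).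
apply: le_trans (le_normr_Rintegral mD (intgB mD ip isum)) _.
have nf := intg_norm mD jf.
rewrite -(RintegralZl e mD nf); apply: le_Rintegral => //.
- exact: (intg_norm mD (intgB mD ip isum)).
- exact: (intgZ mD e nf).
move=> t; rewrite /= in_itv /= => /andP[t0 tT].
have th0 : 0 <= t / h by rewrite divr_ge0// ltW.
pose j := Num.truncn (t / h).
have /andP[jt tj] : j%:R * h <= t < j.+1%:R * h.
  by have := truncn_itv th0; rewrite ler_pdivlMr// ltr_pdivrMr.
have jN : (j < N.+1)%N.
  by rewrite ltnS -(ler_nat R) -(ler_pM2r h0) Nh (le_trans jt).
rewrite (bigD1 (Ordinal jN))//= big1 ?addr0; last first.
  move=> i ij; rewrite /u indicE memNset ?mulr0// /cell /= in_itv /= => /andP[it ti].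
  move/eqP: ij; apply; apply: val_inj; apply/eqP; rewrite /= eqn_leq.
  have := le_lt_trans it tj; have := le_lt_trans jt ti.
  by rewrite !ltr_pM2r// !ltr_nat !ltnS => -> ->.
rewrite /u indicE mem_set /= ?mulr1; last by rewrite /cell /= in_itv /= jt.
rewrite [X in _ - X]mulrC -mulrBr normrM mulrC ler_wpM2r//.
apply: osc => //; first by rewrite mulr_ge0// ltW.
by rewrite lerBlDl -nodeS ltW.
Qed.

Variables (U : set_system nat).
Context {UU : UltraFilter U}.

(** Weak convergence of both factors would not suffice for a plain product. Here equi-integrability
    of [g_ k] makes the primitives equicontinuous, so one partition serves for all [k], and the
    finite sums of [prim_cell_approx] converge. *)
Lemma bilinear_cvg (f_ g_ : nat -> lebR R -> R) f g (M : R) :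
  (forall k, intg leb D (f_ k)) -> (forall k, intg leb D (g_ k)) ->
  intg leb D f -> intg leb D g ->
  (forall A, measurable A -> A `<=` D ->
    \int[leb]_(x in A) f_ k x @[k --> U] --> \int[leb]_(x in A) f x) ->
  (forall A, measurable A -> A `<=` D ->
    \int[leb]_(x in A) g_ k x @[k --> U] --> \int[leb]_(x in A) g x) ->
  unif_abs_cont leb D g_ ->
  (forall k, \int[leb]_(x in D) `|f_ k x| <= M) ->
  \int[leb]_(t in D) (f_ k t * prim T (g_ k) t) @[k --> U] -->
  \int[leb]_(t in D) (f t * prim T g t).
Proof.
move=> if_ ig_ jf jg wf wg uac fM.
apply/cvgrPdist_le => e e0.
pose K := `|M| + \int[leb]_(x in D) `|f x| + 1.
have nf0 : 0 <= \int[leb]_(x in D) `|f x| by apply: Rintegral_ge0.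
have K0 : 0 < K by rewrite /K ltr_pwDr// addr_ge0.
(* [K] exceeds the L1 norms of [f] and of all [f_ k], so each cell approximation errs by at most
   [e1 * K = e / 3]. *)
pose e1 := e / (3 * K).
have e10 : 0 < e1 by rewrite divr_gt0// mulr_gt0.
have [del del0 delP] := uac _ e10.
have [del' del0' delP'] := intg_small mD jg e10.
pose m := Num.min del del'.
have m0 : 0 < m by rewrite lt_min del0.
pose N := (Num.truncn (T / m)).+1.
have N0 : 0 < N%:R :> R by rewrite ltr0n.
pose h := T / N%:R.
have h0 : 0 < h by rewrite divr_gt0.
have Nh : N%:R * h = T by rewrite /h mulrC divfK// gt_eqF.
have hm : h < m.
  rewrite /h ltr_pdivrMr// mulrC -ltr_pdivrMr//.
  by have /andP[] := truncn_itv (ltW (divr_gt0 T0 m0)).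
have mab (a b : R) : measurable (`]a, b[%classic : set (lebR R)) by exact: measurable_itv_lebR.
have abD (a b : R) : 0 <= a -> b <= T -> (`]a, b[ : set (lebR R)) `<=` D.
  by move=> a0 bT x; rewrite /= !in_itv /= => /andP[ax xb]; rewrite (ltW (le_lt_trans a0 ax)) (ltW (lt_le_trans xb bT)).
have small (s t : R) : s <= t -> t - s <= h -> (leb (`]s, t[%classic : set (lebR R)) < m%:E)%E.
  by move=> st sth; rewrite (@leb_itv_bounded _ false true)// lte_fin (le_lt_trans sth).
have osc_ k s t : 0 <= s -> s <= t -> t <= T -> t - s <= h ->
    `|prim T (g_ k) t - prim T (g_ k) s| <= e1.
  move=> s0 st tT sth; rewrite (prim_diff (ig_ k))//; apply: delP => //.
    exact: abD.
  by apply: lt_le_trans (small _ _ st sth) _; rewrite lee_fin ge_min lexx.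
have osc s t : 0 <= s -> s <= t -> t <= T -> t - s <= h -> `|prim T g t - prim T g s| <= e1.
  move=> s0 st tT sth; rewrite (prim_diff jg)//.
  apply: le_trans (le_normr_Rintegral (mab s t) _) _; first exact: (intgS mD (mab s t) (abD _ _ s0 tT) jg).
  apply/ltW/delP' => //; first exact: abD.
  by apply: lt_le_trans (small _ _ st sth) _; rewrite lee_fin ge_min lexx orbT.
pose S k := \sum_(i < N.+1) prim T (g_ k) (i%:R * h) * \int[leb]_(t in D `&` cell h i) f_ k t.
pose S' := \sum_(i < N.+1) prim T g (i%:R * h) * \int[leb]_(t in D `&` cell h i) f t.
have SS : S k @[k --> U] --> S'.
  apply: cvg_rsum => i; apply: cvgM.
    apply: wg; last exact: subIsetr.
    by apply: measurableI; exact: measurable_itv_lebR.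
  apply: wf; last exact: subIsetl.
  by apply: measurableI; [exact: mD|exact: measurable_cell].
move/cvgrPdist_le : SS => /(_ (e / 3)); rewrite divr_gt0// => /(_ isT).
apply: filterS => k Sk.
have A1 := prim_cell_approx jf jg h0 Nh osc.
have A2 := prim_cell_approx (if_ k) (ig_ k) h0 Nh (osc_ k).
have B1 : e1 * \int[leb]_(t in D) `|f t| <= e1 * K.
  by rewrite ler_pM2l// /K -addrA addrC -addrA lerDl addr_ge0.
have B2 : e1 * \int[leb]_(t in D) `|f_ k t| <= e1 * K.
  by rewrite ler_pM2l// (le_trans (fM k))// (le_trans (ler_norm M))// /K -addrA lerDl addr_ge0.
have E1 : e1 * K = e / 3 by rewrite /e1; field; rewrite gt_eqF.
move: (le_trans A1 B1) (le_trans A2 B2); rewrite E1 -/S' -/(S k).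
by move=> X1 X2; exact: ler_dist3 X1 X2 Sk.
Qed.

End bilinear.

Section vector_integrals.
Context {R : realType} {d : nat} {dX : measure_display} {X : measurableType dX}.
Variables (mu : {sigma_finite_measure set X -> \bar R}) (D : set X).
Hypothesis mD : measurable D.
Implicit Types p u : X -> 'cV[R]_d.

Lemma vintg_mulmx (A : 'M[R]_d) p : vintg mu D p -> vintg mu D (fun t => A *m p t).
Proof.
move=> ip i; apply: (intg_eq mD (f := fun t => \sum_j A i j * p t j 0)).
  by move=> t _; rewrite mxE.
by apply: intg_sum => // j; apply: intgZ.
Qed.

Lemma vintgD p u : vintg mu D p -> vintg mu D u -> vintg mu D (fun t => p t + u t).
Proof.
move=> ip iu i; apply: (intg_eq mD (f := fun t => p t i 0 + u t i 0)).
  by move=> t _; rewrite mxE.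
exact: intgD.
Qed.

Lemma vintgZ (k : R) p : vintg mu D p -> vintg mu D (fun t => k *: p t).
Proof.
move=> ip i; apply: (intg_eq mD (f := fun t => k * p t i 0)).
  by move=> t _; rewrite mxE.
exact: intgZ.
Qed.

Lemma intg_dotp_bounded p u (M : R) : vintg mu D p -> vmeasurable D u ->
  (forall t, D t -> `|u t| <= M) -> intg mu D (fun t => dotp (p t) (u t)).
Proof.
move=> ip mu' uM; apply: intg_sum => // i.
apply: (intg_mulbounded mD (M := M)) => // t Dt.
exact: le_trans (ler_coord_norm _ _) (uM _ Dt).
Qed.

Lemma vmeasurable_mulmx (A : 'M[R]_d) u : vmeasurable D u ->
  vmeasurable D (fun t => A *m u t).
Proof.
move=> mu' i; rewrite (_ : (fun t => _) = (fun t => \sum_j A i j * u t j 0)).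
  by apply: measurable_sum => j; apply: measurable_funM.
by apply/funext => t; rewrite mxE.
Qed.

End vector_integrals.

Section Jmatrix.
Context {R : realType} {n : nat}.
Implicit Types x y : 'cV[R]_(n + n).
Local Notation J := (@Jmx R n).

Lemma JmxK x : J *m (J *m x) = - x.
Proof.
rewrite mulmxA mulmx_block !(mul0mx, mulmx0, mul1mx, mulmx1, add0r, addr0, mulmxN, mulNmx).
rewrite (_ : block_mx _ _ _ _ = - 1%:M) ?mulNmx ?mul1mx//.
by rewrite scalar_mx_block opp_block_mx !oppr0.
Qed.

Lemma Jmx_tr : J^T = - J.
Proof. by rewrite tr_block_mx opp_block_mx !raddfN /= !trmx1 !trmx0 opprK oppr0. Qed.

Lemma dotpE d (x y : 'cV[R]_d) : dotp x y = (x^T *m y) 0 0.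
Proof. by rewrite mxE; apply: eq_bigr => i _; rewrite mxE. Qed.

Lemma dotp_mulmx d (A : 'M[R]_d) (x y : 'cV[R]_d) : dotp (A *m x) y = dotp x (A^T *m y).
Proof. by rewrite !dotpE trmx_mul mulmxA. Qed.

Lemma dotp_Jl x y : dotp (J *m x) y = - dotp x (J *m y).
Proof. by rewrite dotp_mulmx Jmx_tr mulNmx dotpNr. Qed.

Lemma dotp_J x y : dotp (J *m x) (J *m y) = dotp x y.
Proof. by rewrite dotp_Jl JmxK dotpNr opprK. Qed.

End Jmatrix.

(** * Vector-valued primitives and the quadratic form of the action *)

Section vector_primitive.
Context {R : realType} {d : nat} (T : R).
Hypothesis T0 : 0 < T.
Notation D := (`[0, T]%classic : set (lebR R)).
Implicit Types (p h : lebR R -> 'cV[R]_d) (u w : R -> 'cV[R]_d).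

Let mD := mD0T T.

Definition vprim p (t : R) : 'cV[R]_d := \col_i prim T (fun s => p s i 0) t.

Lemma ac1_component u i : abs_continuous T u -> ac1 T (fun t => u t i 0).
Proof.
move=> acu e e0; have [del del0 delP] := acu e e0; exists del => // m a b ab tab s.
apply: le_lt_trans (delP m a b ab tab s); apply: ler_sum => j _.
apply: le_trans (norm_le_enorm _).
by apply: le_trans (ler_coord_norm _ i); rewrite !mxE.
Qed.

Lemma abs_continuous_components u : (forall i, ac1 T (fun t => u t i 0)) -> abs_continuous T u.
Proof.
move=> acu e e0.
(* One factor [d] compares the Euclidean norm with the sup norm, the other counts the components;
   the [+ 1] makes the final inequality strict. *)
pose e' := e / (d%:R * d%:R + 1).
have dd0 : 0 < d%:R * d%:R + 1 :> R by rewrite ltr_wpDl// mulr_ge0.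
have e'0 : 0 < e' by rewrite divr_gt0.
have /choice[del delP] : forall i : 'I_d, exists del : R, 0 < del /\
    forall (m : nat) (a b : 'I_m -> R),
      (forall i, [/\ 0 <= a i, a i <= b i & b i <= T]) ->
      trivIset setT (fun i => `]a i, b i[%classic) ->
      \sum_(i < m) (b i - a i) < del ->
      \sum_(j < m) `|u (b j) i 0 - u (a j) i 0| < e'.
  by move=> i; have [del del0 H] := acu i e' e'0; exists del.
pose D0 := \big[Num.min/1]_(i < d) del i.
exists D0.
  by rewrite /D0; apply/bigmin_gtP; split => // i _; exact: (delP i).1.
move=> m a b ab tab s.
have sd i : \sum_(j < m) `|u (b j) i 0 - u (a j) i 0| < e'.
  by apply: (delP i).2 => //; apply: lt_le_trans s _; exact: bigmin_le_cond.
apply: (@le_lt_trans _ _ (\sum_(j < m) \sum_(i < d) d%:R * `|u (b j) i 0 - u (a j) i 0|)).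
  apply: ler_sum => j _; apply: le_trans (enorm_le_norm _) _.
  rewrite -mulr_sumr ler_wpM2l//; apply: ler_norm_coord; first by apply: sumr_ge0.
  by move=> i; rewrite !mxE (bigD1 i)//= lerDl sumr_ge0.
rewrite exchange_big /=; apply: (@le_lt_trans _ _ (\sum_(i < d) d%:R * e')).
  by apply: ler_sum => i _; rewrite -mulr_sumr ler_wpM2l// ltW.
rewrite sumr_const card_ord (_ : d%:R * e' *+ d = e * (d%:R * d%:R / (d%:R * d%:R + 1))); last first.
  by rewrite -mulr_natl /e'; ring.
rewrite -[ltRHS]mulr1 ltr_pM2l//.
by rewrite ltr_pdivrMr// mul1r ltrDl.
Qed.

Lemma abs_continuous_vprim p : vintg leb D p -> abs_continuous T (vprim p).
Proof.
move=> ip; apply: abs_continuous_components => i.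
rewrite (_ : (fun t => _) = prim T (fun s => p s i 0)); first exact: ac1_prim.
by apply/funext => t; rewrite mxE.
Qed.

Lemma vprim0 p : vintg leb D p -> vprim p 0 = 0.
Proof. by move=> ip; apply/colP => i; rewrite !mxE prim0. Qed.

Lemma vprimT p : (forall i, \int[leb]_(t in D) p t i 0 = 0) -> vprim p T = 0.
Proof. by move=> p0; apply/colP => i; rewrite !mxE primT p0. Qed.

Lemma vprimDZ p h (s : R) t : vintg leb D p -> vintg leb D h ->
  vprim (fun t => p t + s *: h t) t = vprim p t + s *: vprim h t.
Proof.
move=> ip ih; apply/colP => i; rewrite !mxE /prim.
set A := (_ `&` _ : set (lebR R)).
have mA : measurable A by apply: measurableI; exact: measurable_itv_lebR.
have AD : A `<=` D by exact: subIsetr.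
have iA q : intg leb D q -> intg leb A q by exact: intgS.
under eq_Rintegral do rewrite !mxE.
by rewrite (RintegralD mA (iA _ (ip i)) (intgZ mA s (iA _ (ih i)))) (RintegralZl s mA (iA _ (ih i))).
Qed.

Lemma vprim_derive p : vintg leb D p -> \forall t \ae leb, 0 <= t <= T ->
  derivable (vprim p) t 1 /\ derive1 (vprim p) t = p t.
Proof.
move=> ip.
have : \forall t \ae leb, forall i : 'I_d, 0 <= t <= T ->
    derivable (prim T (fun s => p s i 0)) t 1 /\ derive1 (prim T (fun s => p s i 0)) t = p t i 0.
  by apply: filter_forall => i; exact: prim_derivable.
apply: ae_leb1 => t H t0T.
have E i : (fun t => vprim p t i 0) = prim T (fun s => p s i 0).
  by apply/funext => s; rewrite mxE.
have dv : derivable (vprim p) t 1.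
  apply/derivable_mxP => i j; rewrite (ord1 j) E; exact: (H i t0T).1.
split => //; rewrite derive1E derive_mx//; apply/matrixP => i j; rewrite !mxE (ord1 j).
by rewrite E -derive1E (H i t0T).2.
Qed.

Lemma derive_shift_vprim p w (k : 'cV[R]_d) : vintg leb D p ->
  (forall t, 0 <= t <= T -> w t = k + vprim p t) ->
  \forall t \ae leb, 0 <= t <= T -> derivable w t 1 /\ derive1 w t = p t.
Proof.
move=> ip wE; apply: ae_leb2 (ae_interior T) (vprim_derive ip) => t tI dp t0T.
have [dv dvE] := dp t0T.
have dcv : derivable (fun s => k + vprim p s) t 1.
  exact: (derivableD (derivable_cst k t 1) dv).
have [dw ->] := derive1_near_eq (tI t0T) wE dcv; split=> //.
rewrite derive1E; apply: etrans (deriveD (derivable_cst k t 1) dv) _.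
by rewrite derive_cst add0r -derive1E.
Qed.

(** The densities found componentwise agree almost everywhere with [derive1 w], which can therefore
    be taken as the density itself. *)
Lemma abs_continuous_primitive w : abs_continuous T w ->
  vintg leb D (derive1 w) /\
  forall t, 0 <= t <= T -> w t = w 0 + vprim (derive1 w) t.
Proof.
move=> acw.
have /choice[q qP] : forall i : 'I_d, exists q : lebR R -> R, intg leb D q /\
    forall t, 0 <= t <= T -> w t i 0 = w 0 i 0 + prim T q t.
  by move=> i; have [q iq qE] := ac1_primitive T0 (ac1_component i acw); exists q.
pose p (t : lebR R) : 'cV[R]_d := \col_i q i t.
have pE i : (fun t => p t i 0) = q i by apply/funext => t; rewrite mxE.
have ip : vintg leb D p by move=> i; rewrite pE; exact: (qP i).1.
have wE t : 0 <= t <= T -> w t = w 0 + vprim p t.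
  by move=> t0T; apply/colP => i; rewrite !mxE pE (qP i).2.
have dw := derive_shift_vprim ip wE.
have pw i : \forall t \ae leb, 0 <= t <= T -> p t i 0 = derive1 w t i 0.
  by apply: ae_leb1 dw => t H t0T; rewrite (H t0T).2.
have mdw i : measurable_fun D (fun t : lebR R => derive1 w t i 0).
  exact: ae_leb_measurable (intg_measurable (ip i)) (pw i).
have idw : vintg leb D (derive1 w).
  by move=> i; apply: (intg_ae_eq mD (mdw i) (pw i)); exact: ip.
split=> // t t0T; rewrite wE//; congr (_ + _); apply/colP => i; rewrite !mxE /prim.
set A := (_ `&` _ : set (lebR R)).
have mA : measurable A by apply: measurableI; exact: measurable_itv_lebR.
have AD : A `<=` D by exact: subIsetr.
apply: (Rintegral_ae_eq mA).
- exact: measurable_funS AD (intg_measurable (ip i)).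
- exact: measurable_funS AD (mdw i).
- by apply: ae_leb1 (pw i) => s H /AD; rewrite /= in_itv; exact: H.
Qed.

Lemma abs_continuous_bounded u : abs_continuous T u ->
  exists2 M : R, 0 <= M & forall t, 0 <= t <= T -> `|u t| <= M.
Proof.
move=> acu.
have /choice[M MP] : forall i : 'I_d, exists M : R, 0 <= M /\
    forall t, 0 <= t <= T -> `|u t i 0| <= M.
  by move=> i; have [M M0 H] := ac1_bounded T0 (ac1_component i acu); exists M.
have M0 i : 0 <= M i := (MP i).1.
exists (\sum_i M i); first by apply: sumr_ge0.
move=> t t0T; apply: ler_norm_coord; first by apply: sumr_ge0.
by move=> i; rewrite (bigD1 i)//= (le_trans ((MP i).2 _ t0T))// lerDl sumr_ge0.
Qed.

Lemma abs_continuous_vmeasurable u : abs_continuous T u -> vmeasurable D (u : lebR R -> _).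
Proof. by move=> acu i; apply: ac1_measurable => //; exact: ac1_component. Qed.

Lemma intg_dotp_ac p u : vintg leb D p -> abs_continuous T u ->
  intg leb D (fun t => dotp (p t) (u t)).
Proof.
move=> ip acu; have [M _ uM] := abs_continuous_bounded acu.
apply: (intg_dotp_bounded mD ip (abs_continuous_vmeasurable acu)).
by move=> t; rewrite /= in_itv; exact: uM.
Qed.

(** For [A = Jmx n] and [h = p] this is the integral of [dotp (J v') v] with [v' = p]; the two
    arguments are kept apart for polarization. *)
Definition bform (A : 'M[R]_d) p h : R :=
  \int[leb]_(t in D) dotp (A *m p t) (vprim h t).

Lemma intg_bform A p h : vintg leb D p -> vintg leb D h ->
  intg leb D (fun t => dotp (A *m p t) (vprim h t)).
Proof.
move=> ip ih; apply: intg_dotp_ac; last exact: abs_continuous_vprim.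
exact: vintg_mulmx.
Qed.

Lemma bformE A p h : vintg leb D p -> vintg leb D h ->
  bform A p h = \sum_i \sum_j A i j *
    \int[leb]_(t in D) (p t j 0 * prim T (fun s => h s i 0) t).
Proof.
move=> ip ih.
have im i j : intg leb D (fun t => p t j 0 * prim T (fun s => h s i 0) t).
  exact: intg_mul_prim.
transitivity (\int[leb]_(t in D)
    \sum_i \sum_j A i j * (p t j 0 * prim T (fun s => h s i 0) t)).
  apply: eq_Rintegral => t _; apply: eq_bigr => i _; rewrite !mxE mulr_suml.
  by apply: eq_bigr => j _; rewrite mulrA.
rewrite Rintegral_sum; last 2 first.
- exact: mD.
- by move=> i; apply: intg_sum => [|j]; [exact: mD|exact: intgZ].
apply: eq_bigr => i _; rewrite Rintegral_sum; last 2 first.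
- exact: mD.
- by move=> j; exact: intgZ.
by apply: eq_bigr => j _; rewrite (RintegralZl _ mD (im i j)).
Qed.

(** Two sign changes cancel: the antisymmetry of [A] and an integration by parts, whose boundary
    term vanishes because [p] has zero mean. *)
Lemma bform_sym A p h : A^T = - A -> vintg leb D p -> vintg leb D h ->
  (forall i, \int[leb]_(t in D) p t i 0 = 0) -> bform A p h = bform A h p.
Proof.
move=> AT ip ih p0.
apply: etrans (bformE A ip ih) _.
apply: etrans _ (esym (bformE A ih ip)).
apply: etrans (exchange_big _ _ _ _ _ _) _.
apply: eq_bigr => i _; apply: eq_bigr => j _.
have -> : A j i = - A i j by rewrite -[A j i](mxE trmx_key (fun i j => A j i)) -/(A^T) AT mxE.
rewrite mulNr -mulrN; congr (_ * _).
have := integration_by_parts_ac T0 (ip i) (ih j); rewrite p0 mul0r => /eqP.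
by rewrite addr_eq0 => /eqP ->; rewrite opprK.
Qed.

Lemma bformDZ A p h (s : R) : A^T = - A -> vintg leb D p -> vintg leb D h ->
  (forall i, \int[leb]_(t in D) p t i 0 = 0) ->
  bform A (fun t => p t + s *: h t) (fun t => p t + s *: h t) =
  bform A p p + s * (2 * bform A h p) + s ^+ 2 * bform A h h.
Proof.
move=> AT ip ih p0.
have -> : 2 * bform A h p = bform A h p + bform A p h.
  by rewrite (bform_sym AT ip ih p0) mulr2n mulrDl mul1r.
have I1 := intg_bform A ip ip; have I2 := intg_bform A ih ip.
have I3 := intg_bform A ip ih; have I4 := intg_bform A ih ih.
have I23 := intgD mD I2 I3.
rewrite /bform -(RintegralD mD I2 I3) -(RintegralZl s mD I23).
rewrite -(RintegralD mD I1 (intgZ mD s I23)) -(RintegralZl (s ^+ 2) mD I4).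
rewrite -(RintegralD mD (intgD mD I1 (intgZ mD s I23)) (intgZ mD (s ^+ 2) I4)).
apply: eq_Rintegral => t _; rewrite vprimDZ// mulmxDr -scalemxAr.
by rewrite !(dotpDl, dotpDr, dotpZl, dotpZr); ring.
Qed.

Lemma bform_cvg (U : set_system nat) {UU : UltraFilter U} (A : 'M[R]_d)
    (p_ : nat -> lebR R -> 'cV[R]_d) p (M : R) :
  (forall k, vintg leb D (p_ k)) -> vintg leb D p ->
  (forall i B, measurable B -> B `<=` D ->
    \int[leb]_(t in B) p_ k t i 0 @[k --> U] --> \int[leb]_(t in B) p t i 0) ->
  (forall i, unif_abs_cont leb D (fun k t => p_ k t i 0)) ->
  (forall i k, \int[leb]_(t in D) `|p_ k t i 0| <= M) ->
  bform A (p_ k) (p_ k) @[k --> U] --> bform A p p.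
Proof.
move=> ip_ ip wp uac pM.
have -> : (fun k => bform A (p_ k) (p_ k)) = (fun k => \sum_i \sum_j A i j *
    \int[leb]_(t in D) (p_ k t j 0 * prim T (fun s => p_ k s i 0) t)).
  by apply/funext => k; rewrite (bformE A (ip_ k) (ip_ k)).
rewrite (bformE A ip ip); apply: cvg_rsum => i; apply: cvg_rsum => j.
apply: cvgM; first exact: cvg_cst.
by apply: (bilinear_cvg T0 (M := M)) => //; [move=> k; exact: ip_..|exact: wp|exact: wp].
Qed.

End vector_primitive.

(** * The dual problem *)

Lemma intgE {R : realType} {dX : measure_display} {X : measurableType dX}
    (mu : {measure set X -> \bar R}) (D : set X) (f : X -> R) : measurable D -> intg mu D f ->
  (\int[mu]_(t in D) (f t)%:E = (\int[mu]_(t in D) f t)%:E)%E.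
Proof. by move=> mD jf; rewrite /Rintegral fineK//; exact: integrable_fin_num. Qed.

Section dual_integrand.
Context {R : realType} {d : nat} {dX : measure_display} {X : measurableType dX}.
Variables (mu : {sigma_finite_measure set X -> \bar R}) (D : set X).
Hypotheses (mD : measurable D) (muD : (mu D < +oo)%E).
Variables (H : X -> 'cV[R]_d -> R) (g : 'cV[R]_d -> R) (a : X -> R).
Hypotheses (Hconv : forall t, D t -> convexf (H t))
  (Hmeas : forall y, measurable_fun D (H ^~ y))
  (gconv : convexf g) (ia : intg mu D a) (a_ge0 : forall t, D t -> 0 <= a t)
  (Hlb : forall t (y : 'cV[R]_d), D t -> - (a t * `|y|) <= H t y)
  (Hub : forall t y, D t -> H t y <= g y + a t).
Implicit Types p q u : X -> 'cV[R]_d.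

Definition iconj p : R := fine (\int[mu]_(t in D) conjH H t (p t)).

Definition fconj p := mu.-integrable D (fun t => conjH H t (p t)).

Lemma iconjE p : fconj p -> (\int[mu]_(t in D) conjH H t (p t) = (iconj p)%:E)%E.
Proof. by move=> cp; rewrite /iconj fineK//; exact: integrable_fin_num. Qed.

Lemma le_iconj p (f : X -> R) : fconj p -> intg mu D f ->
  (forall t, D t -> ((f t)%:E <= conjH H t (p t))%E) -> \int[mu]_(t in D) f t <= iconj p.
Proof.
move=> cp jf fC; rewrite -lee_fin -(iconjE cp) /Rintegral fineK; last exact: integrable_fin_num.
by apply: le_integral => // t; rewrite inE => Dt; exact: fC.
Qed.

(* Testing the conjugate at the points [r e_i] and [- r e_i] bounds the size of
   [p] on small sets. *)
Lemma conj_uniform_integrability (r : R) : 0 <= r -> exists2 M : R, 0 <= M &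
  forall p, vintg mu D p -> fconj p -> forall A, measurable A -> A `<=` D -> forall i : 'I_d,
    r * \int[mu]_(t in A) `|p t i 0| <=
    iconj p + \int[mu]_(t in D) (g 0 + a t) + M * fine (mu A).
Proof.
move=> r0.
pose e i : 'cV[R]_d := r *: basis_vec i.
pose N i := `|g (e i)| + `|g (- e i)|.
have N0 i : 0 <= N i by apply: addr_ge0.
(* The term in [g 0] compensates the shift [g 0 + a t], which is subtracted on [A] as well as
   outside it. *)
exists (\sum_i N i + `|g 0|); first by apply: addr_ge0 => //; apply: sumr_ge0.
set M := _ + `|g 0| => p ip cp A mA AD i.
have NM : N i <= M - `|g 0| by rewrite /M addrK (bigD1 i)//= lerDl sumr_ge0.
have jA : intg mu D (\1_A : X -> R).
  apply: (intg_le mD (g := fun=> 1)); last exact: intg_cst.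
    exact: measurable_indic.
  by move=> t _; rewrite indicE; case: (_ \in _); rewrite ?normr0 ?normr1.
have iP : intg mu D (fun t => `|p t i 0|) by exact: (intg_norm mD (ip i)).
have jp : intg mu D (fun t => `|p t i 0| * \1_A t).
  apply: (intg_mulbounded mD (M := 1) _ _ iP); first exact: measurable_indic.
  by move=> t _; rewrite indicE; case: (_ \in _); rewrite ?normr0 ?normr1.
have ig := intg_shift mD muD g ia.
have j1 := intgZ mD r jp; have j2 := intgZ mD M jA.
have j12 := intgB mD j1 j2.
have EA : \int[mu]_(t in D) (`|p t i 0| * \1_A t) = \int[mu]_(t in A) `|p t i 0|.
  rewrite -[in RHS](setIidr AD) Rintegral_mkcondr; apply: eq_Rintegral => t _.
  by rewrite patchE indicE; case: ifP => _; rewrite ?mulr1 ?mulr0.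
have EM : \int[mu]_(t in D) \1_A t = fine (mu A).
  by rewrite /Rintegral integral_indic// setIidl.
have := le_iconj cp (intgB mD j12 ig).
rewrite (RintegralB mD j12 ig) (RintegralB mD j1 j2) (RintegralZl r mD jp) (RintegralZl M mD jA) EA EM.
(* The minorant of the conjugate is checked pointwise: outside [A] the test point is [0], on [A] it
   is [e i] or [- e i] according to the sign of [p t i 0]. *)
move=> H1; rewrite -lerBlDr -lerBlDr; apply: H1 => t Dt; rewrite indicE; have [tA|tA] := boolP (t \in A); last first.
  rewrite !mulr0 subrr sub0r; have := conjH_lb Hub (p t) Dt.
  by rewrite addeC -leeBlDl// sub0e -EFinN.
rewrite !mulr1; have K1 := young H t (p t) (e i); have K2 := young H t (p t) (- e i).
have U1 := Hub (e i) Dt; have U2 := Hub (- e i) Dt.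
have L0 := ler_norm (- g 0); have L1 := ler_norm (g (e i)); have L2 := ler_norm (g (- e i)).
have P1 := normr_ge0 (g (e i)); have P2 := normr_ge0 (g (- e i)).
rewrite normrN in L0; rewrite /N in NM.
have d1 : dotp (p t) (e i) = r * p t i 0 by rewrite /e dotpZr dotp_basis.
rewrite dotpNr d1 in K2; rewrite d1 in K1.
have [p0|p0] := leP 0 (p t i 0).
  by apply: le_trans K1; rewrite lee_fin (ger0_norm p0); lra.
by apply: le_trans K2; rewrite lee_fin (ltr0_norm p0) mulrN; lra.
Qed.

Lemma conjH_convex t (x y : 'cV[R]_d) (s : R) : 0 < s < 1 ->
  (conjH H t (x + s *: (y - x)) <= (1 - s)%:E * conjH H t x + s%:E * conjH H t y)%E.
Proof.
move=> /andP[s0 s1]; apply: ge_ereal_sup => _ [z _ <-] /=.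
rewrite -EFinB (_ : _ - _ = (1 - s) * (dotp x z - H t z) + s * (dotp y z - H t z)); last first.
  by rewrite dotpDl dotpZl dotpBl; ring.
by rewrite EFinD !EFinM leeD// lee_wpmul2l// ?lee_fin ?subr_ge0 ?(ltW s0) ?(ltW s1)//; exact: young.
Qed.

Lemma iconj_convex p q (s : R) : 0 < s < 1 -> vintg mu D p -> vintg mu D q ->
  fconj p -> fconj q ->
  fconj (fun t => p t + s *: (q t - p t)) /\
  iconj (fun t => p t + s *: (q t - p t)) <= (1 - s) * iconj p + s * iconj q.
Proof.
move=> s01 ip iq cp cq; set h := fun t => _.
have ih : vintg mu D h.
  apply: (vintgD mD ip); apply: (vintgZ mD); apply: (vintgD mD iq) => i.
  by apply: (intg_eq mD (f := fun t => - p t i 0)) => [t _|]; [rewrite mxE|exact: intgN].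
have mh : measurable_fun D (fun t => conjH H t (h t)).
  exact: (measurable_conjH Hconv Hmeas (vintg_measurable ih)).
have c1 := integrableZl mD (1 - s) cp; have c2 := integrableZl mD s cq.
have c12 := integrableD mD c1 c2.
have ig := intg_shift mD muD g ia.
have hC t : (conjH H t (h t) <= (1 - s)%:E * conjH H t (p t) + s%:E * conjH H t (q t))%E.
  exact: conjH_convex.
have ch : fconj h.
  have cs := integrableD mD (integrable_abse c12) (integrable_abse ig).
  apply: (le_integrable mD mh _ cs) => t Dt /=.
  rewrite [leRHS]gee0_abs ?adde_ge0//.
  have lb := conjH_lb Hub (h t) Dt.
  have [C0|C0] := leP 0%E (conjH H t (h t)).
    rewrite gee0_abs//; apply: le_trans (hC t) _; apply: le_trans (lee_abs _) _.
    by rewrite leeDl.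
  rewrite lte0_abs// leeNl.
  have L : (- conjH H t (h t) <= (g 0 + a t)%:E)%E by rewrite leeNl -sub0e leeBlDr.
  rewrite -leeNl; apply: le_trans L _; apply: le_trans (lee_abs _) _.
  by rewrite leeDr.
split=> //; rewrite -lee_fin -(iconjE ch) EFinD !EFinM -(iconjE cp) -(iconjE cq).
rewrite -(integralZl mD cp) -(integralZl mD cq) -(integralD mD c1 c2).
by apply: le_integral => // t _; exact: hC.
Qed.

(** The Fenchel-Young gap [k] is nonnegative with integral at most zero, hence zero almost
    everywhere; a zero gap is the subgradient inequality. *)
Lemma young_equality p u (b : R) : vintg mu D p -> fconj p -> vmeasurable D u ->
  (forall t, D t -> `|u t| <= b) ->
  iconj p - \int[mu]_(t in D) dotp (p t) (u t) + \int[mu]_(t in D) H t (u t) <= 0 ->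
  aeD mu D (fun t => subdifferential (H t) (u t) (p t)).
Proof.
move=> ip cp mu' ub le0.
have iH := intg_H mD muD Hconv Hmeas gconv ia a_ge0 Hlb Hub mu' ub.
have id := intg_dotp_bounded mD ip mu' ub.
have iHd := intgB mD iH id.
pose k t := (conjH H t (p t) + (H t (u t) - dotp (p t) (u t))%:E)%E.
have k0 t : (0 <= k t)%E.
  have := young H t (p t) (u t).
  rewrite /k; case: (conjH H t (p t)) => [c| |]; last by rewrite leeNy_eq.
    by rewrite -EFinD !lee_fin; lra.
  by rewrite addye.
have ik : mu.-integrable D k := integrableD mD cp iHd.
have mk : measurable_fun D k by have /integrableP[] := ik.
have kI : (\int[mu]_(t in D) k t = 0)%E.
  apply/eqP; rewrite eq_le integral_ge0// andbT.
  rewrite (integralD mD cp iHd) (iconjE cp).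
  rewrite (intgE mD iHd).
  by rewrite (RintegralB mD iH id) -EFinD lee_fin addrA addrAC.
have /(ae_eq_integral_abs mu mD mk) : (\int[mu]_(t in D) `|k t| = 0)%E.
  by rewrite -kI; apply: eq_integral => t _; rewrite gee0_abs.
apply: (@filterS _ _ (ae_filter_ringOfSetsType mu)) => t kt Dt y.
have := young H t (p t) y; have /eqP := kt Dt; rewrite /k.
case E : (conjH H t (p t)) => [c| |]//=.
rewrite -EFinD eqe lee_fin dotpBr => /eqP.
set A := dotp _ _; set B := dotp _ _; lra.
Qed.

End dual_integrand.

Lemma value_bound {R : realFieldType} (m s x y z e : R) : s < e / 2 -> `|x - y| <= e ->
  2^-1 * y + z < m + s -> z <= m - 2^-1 * x + e.
Proof. by move=> se /(le_trans (ler_norm _)); lra. Qed.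

Lemma first_variation {R : realFieldType} (s b b1 b2 x y z : R) :
  2^-1 * b + x <= 2^-1 * (b + s * (2 * b1) + s ^+ 2 * b2) + z ->
  z <= (1 - s) * x + s * y -> 0 <= s * (b1 + y - x + s * (2^-1 * b2)).
Proof.
move=> le1 le2; rewrite [leRHS](_ : _ = 2^-1 * (b + s * (2 * b1) + s ^+ 2 * b2) + z -
  (2^-1 * b + x) + ((1 - s) * x + s * y - z)); last by field.
by rewrite addr_ge0// subr_ge0.
Qed.

Lemma duality_gap {R : realFieldType} (x1 x2 y1 y2 z e : R) :
  x1 + y1 <= x2 + y2 -> x2 <= - y2 - z + e -> x1 + y1 + z <= e.
Proof. lra. Qed.

(** * Existence of a minimizer and the Euler-Lagrange inclusion *)

Section dual_problem.
Context {R : realType} {d : nat} (T : R).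
Hypothesis T0 : 0 < T.
Notation D := (`[0, T]%classic : set (lebR R)).
Variables (H : lebR R -> 'cV[R]_d -> R) (g : 'cV[R]_d -> R) (a : lebR R -> R).
Hypotheses (Hconv : forall t, D t -> convexf (H t))
  (Hmeas : forall y, measurable_fun D (H ^~ y))
  (gconv : convexf g) (ia : intg leb D a) (a_ge0 : forall t, D t -> 0 <= a t)
  (Hlb : forall t (y : 'cV[R]_d), D t -> - (a t * `|y|) <= H t y)
  (Hub : forall t y, D t -> H t y <= g y + a t).
Hypothesis coercive : forall M : R, exists r : R, forall y : 'cV[R]_d,
  r < `|y| -> M <= \int[leb]_(t in D) H t y.
Variable A : 'M[R]_d.
Hypothesis AT : A^T = - A.
Implicit Types p q : lebR R -> 'cV[R]_d.

Let mD := mD0T T.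
Let muD := leb_itv_lty T.

(** The derivatives of closed curves with finite conjugate integral; zero mean expresses
    [v 0 = v T]. *)
Definition admissible p := [/\ vintg leb D p,
  forall i, \int[leb]_(t in D) p t i 0 = 0 & fconj leb D H p].

Definition action p : R := 2^-1 * bform T A p p + iconj leb D H p.

(** Even the zero field may have a conjugate that is not integrable. The duality for [u0 = 0], which
    rests on coercivity, supplies a zero-mean field with integrable conjugate. *)
Lemma exists_admissible : exists p, admissible p.
Proof.
have [||c _ /(_ 1 ltr01)[q [iq q0 cq _]]] := @zero_mean_duality _ _ _ _ _ D mD muD _ _ _ Hconv
   Hmeas gconv ia a_ge0 Hlb Hub (fun=> 0) 0 _ _ coercive; last by exists q.
- exact: vmeasurable_cst.
- by move=> t _; rewrite normr0.
Qed.

Section minimizing_sequence.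
Variables (p_ : nat -> lebR R -> 'cV[R]_d) (B : R).
Hypotheses (adm : forall k, admissible (p_ k)) (pB : forall k, iconj leb D H (p_ k) <= B).

Lemma sequence_small (r : R) : 0 < r -> exists2 M : R, 0 <= M &
  forall k E, measurable E -> E `<=` D -> forall i : 'I_d,
    \int[leb]_(t in E) `|p_ k t i 0| <=
    (B + \int[leb]_(t in D) (g 0 + a t) + M * fine (leb E)) / r.
Proof.
move=> r0.
have [M M0 HM] := conj_uniform_integrability mD muD ia Hub (ltW r0).
exists M => // k E mE ED i; have [ip _ cp] := adm k.
rewrite ler_pdivlMr// mulrC (le_trans (HM _ ip cp E mE ED i))//.
by rewrite lerD2r lerD2r.
Qed.

Lemma sequence_bounded : exists M : R, forall k E, measurable E -> E `<=` D ->
  forall i : 'I_d, \int[leb]_(t in E) `|p_ k t i 0| <= M.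
Proof.
have [M M0 HM] := sequence_small ltr01.
exists ((B + \int[leb]_(t in D) (g 0 + a t) + M * T) / 1) => k E mE ED i.
apply: le_trans (HM k E mE ED i) _; rewrite ler_pM2r// lerD2l ler_wpM2l//.
have leD : (leb (D : set (lebR R)) = T%:E)%E.
  by rewrite (@leb_itv_bounded _ true false _ _ (ltW T0)) subr0.
have leE : (leb E <= T%:E)%E by rewrite -leD le_measure// inE.
rewrite -lee_fin fineK// ge0_fin_numE//.
exact: le_lt_trans leE (ltry _).
Qed.

Lemma sequence_unif_abs_cont i : unif_abs_cont leb D (fun k t => p_ k t i 0).
Proof.
move=> e e0.
pose K := `|B + \int[leb]_(t in D) (g 0 + a t)| + 1.
have K0 : 0 < K by rewrite /K ltr_wpDl.
(* With [r = 2 * K / e] the bounded part contributes at most [e / 2]; the smallness of [E] keeps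
   [M * fine (leb E)] below [K], which is the other half. *)
have r0 : 0 < 2 * K / e by rewrite divr_gt0// mulr_gt0.
have [M M0 HM] := sequence_small r0.
have M10 : 0 < M + 1 by rewrite ltr_wpDl.
exists (K / (M + 1)); first by rewrite divr_gt0.
move=> k E mE ED Ed; have [ip _ _] := adm k.
apply: le_trans (le_normr_Rintegral mE (intgS mD mE ED (ip i))) _.
apply: le_trans (HM k E mE ED i) _.
have fE : leb E \is a fin_num by rewrite ge0_fin_numE// (lt_trans Ed)// ltry.
have M1 : M * fine (leb E) <= K.
  have Ed' : fine (leb E) < K / (M + 1) by rewrite -lte_fin fineK.
  rewrite mulrC; apply: (@le_trans _ _ (fine (leb E) * (M + 1))).
    by rewrite ler_wpM2l ?fine_ge0// lerDl.
  by rewrite -ler_pdivlMr// ltW.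
rewrite ler_pdivrMr// mulrCA divff ?gt_eqF// mulr1 mulr2n mulrDl mul1r lerD//.
by rewrite (le_trans (ler_norm _))// /K lerDl.
Qed.

End minimizing_sequence.

Variables (theta c1 : R).
Hypotheses (theta0 : 0 < theta)
  (action_lb : forall p, admissible p -> theta * iconj leb D H p - c1 <= action p).

Lemma exists_minimizer : exists2 p, admissible p & forall q, admissible q -> action p <= action q.
Proof.
pose S := [set action p | p in admissible].
have [p0 ap0] := exists_admissible.
have ig := intg_shift mD muD g ia.
pose k0 := \int[leb]_(t in D) (g 0 + a t).
have iconj_lb p : admissible p -> - k0 <= iconj leb D H p.
  move=> [ip _ cp]; rewrite -(RintegralN mD ig); apply: (le_iconj mD cp (intgN mD ig)) => t Dt.
  by have := conjH_lb Hub (p t) Dt; rewrite addeC -leeBlDl// sub0e -EFinN.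
have Slb : has_lbound S.
  exists (theta * - k0 - c1) => _ [p ap <-]; apply: le_trans (action_lb ap).
  by rewrite lerD2r ler_pM2l// iconj_lb.
have S0 : S !=set0 by exists (action p0), p0.
pose m := inf S.
have mS p : admissible p -> m <= action p.
  by move=> ap; apply: ge_inf => //; exists p.
have /choice[p_ pP] : forall k : nat, exists p, admissible p /\ action p < m + k.+1%:R^-1.
  move=> k; have [|_ [p ap <-] H1] := @inf_adherent R S k.+1%:R^-1 _ (conj S0 Slb).
    by rewrite invr_gt0.
  by exists p.
have adm k := (pP k).1.
(* Read off from [theta * iconj - c1 <= action <= m + 1] along the sequence. *)
pose B := (m + 1 + c1) / theta.
have pB k : iconj leb D H (p_ k) <= B.
  rewrite ler_pdivlMr// mulrC -lerBlDr; apply: le_trans (action_lb (adm k)) _.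
  apply: le_trans (ltW (pP k).2) _; rewrite lerD2l.
  by rewrite invf_le1// ler1n.
have [U [UU UF]] := @ultraFilterLemma nat (nbhs \oo) _.
have [M HM] := sequence_bounded adm pB.
have uac := sequence_unif_abs_cont adm pB.
have ip_ k : vintg leb D (p_ k) by have [] := adm k.
have z_ k i : \int[leb]_(t in D) p_ k t i 0 = 0 by have [] := adm k.
have c_ k : fconj leb D H (p_ k) by have [] := adm k.
have /choice[q qP] : forall i : 'I_d, exists f : lebR R -> R, intg leb D f /\
    forall E, measurable E -> E `<=` D ->
      \int[leb]_(x in E) p_ k x i 0 @[k --> U] --> \int[leb]_(x in E) f x.
  move=> i; have [||f jf fP] := @ultra_weak_limit _ _ _ leb D U UU mD muD
    (fun k t => p_ k t i 0) M _ _ (uac i).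
  - by move=> k; exact: ip_.
  - move=> k E mE ED; apply: le_trans (HM k E mE ED i).
    exact: (le_normr_Rintegral mE (intgS mD mE ED (ip_ k i))).
  - by exists f.
pose p (t : lebR R) : 'cV[R]_d := \col_i q i t.
have pE i : (fun t => p t i 0) = q i by apply/funext => t; rewrite mxE.
have ip : vintg leb D p by move=> i; rewrite pE; exact: (qP i).1.
have wp i E : measurable E -> E `<=` D ->
    \int[leb]_(t in E) p_ k t i 0 @[k --> U] --> \int[leb]_(t in E) p t i 0.
  by move=> mE ED; rewrite pE; exact: (qP i).2.
have p0' i : \int[leb]_(t in D) p t i 0 = 0.
  have := wp i D mD (@subset_refl _ D).
  rewrite (_ : (fun k => _) = cst 0); last by apply/funext => k; exact: z_.
  by move=> /(cvg_lim (@Rhausdorff R)) <-; exact: lim_cst.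
have bcvg := @bform_cvg R d T T0 U UU A p_ p M ip_ ip wp uac (fun i k => HM k D mD (@subset_refl _ D) i).
(* Since the quadratic parts converge to that of [p], the conjugate parts are eventually at most
   [B1 + e]; lower semicontinuity then gives [action p <= m]. *)
pose B1 := m - 2^-1 * bform T A p p.
have near_le (e : R) : 0 < e -> \forall k \near U,
    (\int[leb]_(t in D) conjH H t (p_ k t) <= (B1 + e)%:E)%E.
  move=> e0; have e20 : 0 < e / 2 by rewrite divr_gt0.
  have N1 : \forall k \near U, k.+1%:R^-1 < e / 2.
    by apply: UF; exact: (near_infty_natSinv_lt (PosNum e20)).
  have N2 : \forall k \near U, `|bform T A p p - bform T A (p_ k) (p_ k)| <= e.
    by move/cvgrPdist_le : bcvg => /(_ e e0).
  apply: filterS2 N1 N2 => k N1 N2.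
  rewrite (iconjE mD (c_ k)) lee_fin /B1.
  exact: value_bound N1 N2 (pP k).2.
have [cp ple] := conjH_lsc mD muD Hconv Hmeas gconv ia a_ge0 Hlb Hub ip_ ip wp c_ near_le.
exists p; first by split.
move=> h ah; apply: le_trans (mS _ ah); rewrite /action.
by move: ple; rewrite (iconjE mD cp) lee_fin /B1 lerBrDr addrC.
Qed.

Lemma admissible_segment p q (s : R) : 0 < s < 1 -> admissible p -> admissible q ->
  admissible (fun t => p t + s *: (q t - p t)).
Proof.
move=> s01 [ip p0 cp] [iq q0 cq].
have iN i : intg leb D (fun t => q t i 0 - p t i 0) by apply: (intgB mD).
split.
- move=> i; apply: (intg_eq mD (f := fun t => p t i 0 + s * (q t i 0 - p t i 0))).
    by move=> t _; rewrite !mxE.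
  exact: (intgD mD (ip i) (intgZ mD s (iN i))).
- move=> i; under eq_Rintegral do rewrite !mxE.
  rewrite (RintegralD mD (ip i) (intgZ mD s (iN i))) (RintegralZl s mD (iN i)).
  by rewrite (RintegralB mD (iq i) (ip i)) p0 q0 subrr mulr0 addr0.
- by have [] := iconj_convex mD muD Hconv Hmeas ia Hub s01 ip iq cp cq.
Qed.

(** First-order condition along the segment from [p] to [q]. By the symmetry of [bform] the
    quadratic part has slope [bform A h p]; for the conjugate part convexity replaces a derivative
    by the increment from [p] to [q]. *)
Lemma minimizer_variation p q : admissible p -> admissible q ->
  (forall h, admissible h -> action p <= action h) ->
  iconj leb D H p + \int[leb]_(t in D) dotp (A *m p t) (vprim T p t) <=
  iconj leb D H q + \int[leb]_(t in D) dotp (A *m q t) (vprim T p t).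
Proof.
move=> ap aq pmin; have [ip p0 cp] := ap; have [iq q0 cq] := aq.
pose h t := q t - p t.
have ih : vintg leb D h.
  move=> i; apply: (intg_eq mD (f := fun t => q t i 0 - p t i 0)); last exact: (intgB mD).
  by move=> t _; rewrite !mxE.
have Bh : bform T A h p = bform T A q p - bform T A p p.
  rewrite /bform -(RintegralB mD (intg_bform T0 A iq ip) (intg_bform T0 A ip ip)).
  by apply: eq_Rintegral => t _; rewrite /h mulmxBr dotpBl.
rewrite -/(bform T A p p) -/(bform T A q p).
pose L := bform T A h p + iconj leb D H q - iconj leb D H p.
suff L0 : 0 <= L.
  rewrite -subr_ge0 (_ : _ - _ = L)//; rewrite /L Bh; ring.
have key (s : R) : 0 < s < 1 -> 0 <= L + s * (2^-1 * bform T A h h).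
  move=> s01; have /andP[s0 s1] := s01.
  have [_ Cs] := iconj_convex mD muD Hconv Hmeas ia Hub s01 ip iq cp cq.
  have := pmin _ (admissible_segment s01 ap aq).
  rewrite /action (bformDZ T0 s AT ip ih p0) => M1.
  rewrite -(pmulr_rge0 _ s0) /L.
  exact: first_variation M1 Cs.
rewrite leNgt; apply/negP => L0.
pose K := `|2^-1 * bform T A h h| + 1.
have K0 : 0 < K by rewrite ltr_wpDl.
(* Small enough that the second-order term, at most [s * K <= - L / 2], cannot compensate a negative
   [L]; the bound [2^-1] keeps [s] below [1]. *)
pose s := Num.min 2^-1 (- L / (2 * K)).
have s0 : 0 < s by rewrite lt_min invr_gt0 ltr0n divr_gt0 ?oppr_gt0// mulr_gt0.
have s1 : s < 1.
  by apply: (@le_lt_trans _ _ 2^-1); [rewrite ge_min lexx|rewrite invf_lt1 ?ltr1n].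
have := key s; rewrite s0 s1 => /(_ isT).
have sK : s * K <= - L / 2.
  apply: (@le_trans _ _ (- L / (2 * K) * K)).
    by rewrite ler_pM2r// ge_min lexx orbT.
  by rewrite invfM mulrA divfK// gt_eqF.
have sB : s * (2^-1 * bform T A h h) <= s * K.
  by rewrite ler_pM2l// (le_trans (ler_norm _))// lerDl.
move=> /le_trans/(_ (lerD (lexx L) (le_trans sB sK))); apply/negP; rewrite -ltNge.
by rewrite mulNr -{1}(mulr1 L) -mulrBr nmulr_rlt0// subr_gt0 invf_lt1// ltr1n.
Qed.

(** The near-optimal fields [q] of [zero_mean_duality] compete with [p], and the constant [c]
    integrates to zero against [p]; so the integral of the Fenchel-Young gap between [p] and
    [u0 + c] is at most every positive [e]. *)
Lemma euler_lagrange p : admissible p -> (forall h, admissible h -> action p <= action h) ->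
  exists c : 'cV[R]_d, \forall t \ae leb, 0 <= t <= T ->
    subdifferential (H t) (- (A^T *m vprim T p t) + c) (p t).
Proof.
move=> ap pmin; have [ip p0 cp] := ap.
have acv := abs_continuous_vprim ip.
(* Chosen so that [dotp (q t) (u0 t)] is minus the linear term of [minimizer_variation]; as [A] is
   antisymmetric it equals [A *m vprim T p t]. *)
pose u0 (t : lebR R) := - (A^T *m vprim T p t).
have mu0 : vmeasurable D u0.
  apply: vmeasurableN; apply: vmeasurable_mulmx.
  exact: (abs_continuous_vmeasurable T0 acv).
have u0E t : u0 t = A *m vprim T p t by rewrite /u0 AT mulNmx opprK.
have du0 (q : lebR R -> 'cV[R]_d) t : dotp (q t) (u0 t) = - dotp (A *m q t) (vprim T p t).
  by rewrite /u0 dotpNr -dotp_mulmx.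
have [M M0 vM] := abs_continuous_bounded T0 acv.
pose b := \sum_i \sum_j `|A i j| * M.
have u0b t : D t -> `|u0 t| <= b.
  rewrite /= in_itv => /= tD; rewrite u0E; apply: ler_norm_coord.
    by apply: sumr_ge0 => i _; apply: sumr_ge0 => j _; apply: mulr_ge0.
  move=> i; rewrite mxE; apply: le_trans (ler_norm_sum _ _ _) _.
  apply: (@le_trans _ _ (\sum_j `|A i j| * M)).
    apply: ler_sum => j _; rewrite normrM ler_wpM2l//.
    exact: le_trans (ler_coord_norm _ _) (vM _ tD).
  by rewrite /b [leRHS](bigD1 i)//= lerDl; apply: sumr_ge0 => k _; apply: sumr_ge0 => j _; apply: mulr_ge0.
have [c _ dual] := zero_mean_duality mD muD Hconv Hmeas gconv ia a_ge0 Hlb Hub mu0 u0b coercive.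
exists c.
pose u t := u0 t + c.
have mu1 : vmeasurable D u by exact: shift_measurable.
have ub t : D t -> `|u t| <= b + `|c|.
  by move=> Dt; apply: le_trans (ler_normD _ _) _; rewrite lerD2r u0b.
have idot (q : lebR R -> 'cV[R]_d) : vintg leb D q -> intg leb D (fun t => dotp (q t) (u0 t)).
  by move=> iq; apply: (intg_dotp_bounded mD iq mu0 u0b).
have Rdot (q : lebR R -> 'cV[R]_d) : vintg leb D q -> \int[leb]_(t in D) dotp (q t) (u0 t) =
    - \int[leb]_(t in D) dotp (A *m q t) (vprim T p t).
  move=> iq; rewrite -(RintegralN mD (intg_bform T0 A iq ip)).
  by apply: eq_Rintegral => t _; rewrite du0.
have le0 : iconj leb D H p - \int[leb]_(t in D) dotp (p t) (u t) +
    \int[leb]_(t in D) H t (u t) <= 0.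
  rewrite (_ : \int[leb]_(t in D) dotp (p t) (u t) = \int[leb]_(t in D) dotp (p t) (u0 t)).
    apply/ler_addgt0Pr => e e0; have [q [iq q0 cq]] := dual e e0.
    rewrite (iconjE mD cq) lee_fin (Rdot _ iq) (Rdot _ ip) /psi.
    have := minimizer_variation ap (And3 iq q0 cq) pmin.
    move=> h1 h2; rewrite -/(u _); move: h1 h2.
    set x1 := iconj _ _ _ p; set x2 := iconj _ _ _ q.
    set y1 := Rintegral _ _ (fun t => dotp (A *m p t) _).
    set y2 := Rintegral _ _ (fun t => dotp (A *m q t) _).
    set z := Rintegral _ _ (fun t => H t _) => h1 h2.
    by rewrite opprK add0r; exact: duality_gap h1 h2.
  have := RintegralD mD (idot _ ip) (vintg_dotp mD c ip).
  rewrite (Rintegral_dotp_cst mD c ip p0) addr0 => <-.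
  by apply: eq_Rintegral => t _; rewrite dotpDr.
have := young_equality mD muD Hconv Hmeas gconv ia a_ge0 Hlb Hub ip cp mu1 ub le0.
by apply: ae_leb1 => t; rewrite /= in_itv.
Qed.

End dual_problem.

(** * Hamiltonian systems *)

Section convex_functions.
Context {R : realType} {d : nat}.
Implicit Types (f G : 'cV[R]_d -> R) (x y : 'cV[R]_d).

Lemma convex_function_convexf f : convex_function [set: 'cV[R]_d] f -> convexf f.
Proof.
move=> cf x y t /andP[t0 t1].
have := cf (Itv01 t0 t1) x y; rewrite !inE => /(_ I I).
by rewrite convRE.
Qed.

Lemma convex_efun_convexf f : convex_efun (EFin \o f) -> convexf f.
Proof. by move=> cf x y t t01; have := cf x y t t01; rewrite /= -!EFinM -EFinD lee_fin. Qed.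

Lemma convexf_scale f (k : R) : convexf f -> convexf (fun x => f (k *: x)).
Proof.
move=> cf x y t t01; rewrite scalerDr !scalerA (mulrC k) (mulrC k) -!scalerA.
exact: cf.
Qed.

Lemma convexf_gradient f x : convexf f -> differentiable f x ->
  exists w : 'cV[R]_d, forall y, f x + dotp w (y - x) <= f y.
Proof.
move=> cf df.
exists (\col_i 'd f x (basis_vec i)) => y.
have -> : dotp (\col_i 'd f x (basis_vec i)) (y - x) = 'd f x (y - x).
  have {2}-> : y - x = \sum_i (y - x) i 0 *: basis_vec i.
    apply/colP => i; rewrite summxE (bigD1 i)//= big1 ?addr0; last first.
      by move=> j ji; rewrite !mxE eq_sym (negbTE ji) mulr0.
    by rewrite !mxE !eqxx mulr1.
  by rewrite linear_sum; apply: eq_bigr => i _; rewrite linearZ mxE mulrC.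
rewrite -deriveE// -lerBrDl.
have /cvg_ex[l Dl] : derivable f x (y - x) by exact: diff_derivable.
rewrite /derive (cvg_lim _ Dl)//.
apply: (cvgr_to_le (cvg_dnbhs_at_right Dl)); near=> h.
have h0 : 0 < h by near: h; exact: nbhs_right_gt.
have h1 : h < 1 by near: h; exact: nbhs_right_lt.
rewrite /= /GRing.scale /= mulrC ler_pdivrMr// lerBlDr.
have -> : h *: (y - x) + x = h *: y + (1 - h) *: x.
  by rewrite scalerBr scalerBl scale1r addrAC -addrA.
apply: le_trans (cf y x h _) _; first by rewrite (ltW h0) (ltW h1).
by rewrite mulrBl mul1r mulrBl (mulrC h) addrA addrAC (mulrC h).
Unshelve. all: by end_near. Qed.

(** The gradient of [G] at [x] gives equality in Fenchel-Young and serves as test point in the outer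
    conjugate. Through this inequality the semi-symplectic bound becomes a bound on [G] itself. *)
Lemma le_biconjugate G x : convexf G -> differentiable G x ->
  ((G x)%:E <= conjugate (conjugate (EFin \o G)) x)%E.
Proof.
move=> cG dG; have [w Gw] := convexf_gradient cG dG.
apply: le_trans (ereal_sup_ubound _); last by exists w.
have Gsw : (conjugate (EFin \o G) w <= (dotp w x - G x)%:E)%E.
  apply: ge_ereal_sup => _ [y _ <-] /=; rewrite -EFinB lee_fin.
  by have := Gw y; rewrite dotpBr; lra.
apply: (@le_trans _ _ ((dotp x w)%:E - (dotp w x - G x)%:E)%E).
  by rewrite -EFinB lee_fin dotpC; lra.
by rewrite leeB.
Qed.

End convex_functions.

Lemma integrable_lb_lty {R : realType} {dX : measure_display} {X : measurableType dX}
    (mu : {measure set X -> \bar R}) (D : set X) (h : X -> \bar R) (f : X -> R) :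
  measurable D -> measurable_fun D h -> intg mu D f -> (forall t, D t -> ((f t)%:E <= h t)%E) ->
  (\int[mu]_(t in D) h t < +oo)%E -> mu.-integrable D h.
Proof.
move=> mD mh jf fh hoo.
have mp := measurable_funepos mh; have mn := measurable_funeneg mh.
have nf : (\int[mu]_(t in D) (h^\- t) < +oo)%E.
  have /integrableP[mf] := jf; apply: le_lt_trans; apply: ge0_le_integral => //.
  - exact: measurableT_comp.
  - move=> t Dt; rewrite funenegE ge_max abse_ge0 andbT leeNl.
    by apply: le_trans (fh t Dt); rewrite leeNl -abseN lee_abs.
have pf : (\int[mu]_(t in D) (h^\+ t) < +oo)%E.
  move: hoo; rewrite integralE; case E : (\int[mu]_(t in D) h^\+ t)%E => [r| |]//.
    by rewrite ltry.
  by move: nf; case: (\int[mu]_(t in D) h^\- t)%E.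
apply/integrableP; split=> //.
rewrite (eq_integral (fun t => h^\+ t + h^\- t)%E); last first.
  by move=> t _; rewrite -[RHS]/((h^\+ \+ h^\-)%E t) -fune_abse.
by rewrite ge0_integralD// lte_add_pinfty.
Qed.

Section lebesgue_ae.
Context {R : realType} (T : R).
Notation D := (`[0, T]%classic : set (lebR R)).

Lemma ae_leb_integral (f g : lebR R -> \bar R) : measurable_fun D g ->
  (\forall t \ae leb, 0 <= t <= T -> f t = g t) ->
  (\int[leb]_(t in D) f t = \int[leb]_(t in D) g t)%E.
Proof.
move=> mg fg; have fgD : ae_eq leb D f g.
  by apply: ae_leb1 fg => t; rewrite /= in_itv.
apply: (@ae_eq_integral _ _ _ leb D g f) => //; first exact: mD0T.
apply: (ae_measurable_fun (@completed_lebesgue_measure_is_complete R) (f := g)) => //.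
exact: ae_eq_sym.
Qed.

End lebesgue_ae.

Section orlicz_space.
Context {R : realType} {d : nat} (T : R) (G : 'cV[R]_d -> R).
Hypotheses (T0 : 0 < T) (cG : convexf G) (G0 : G 0 = 0).
Notation D := (`[0, T]%classic : set (lebR R)).

Lemma conjugate_ge0 x : (0 <= conjugate (EFin \o G) x)%E.
Proof.
apply: le_trans (ereal_sup_ubound _); last by exists 0.
by rewrite /= dotp0r G0 -EFinB lee_fin subrr.
Qed.

Lemma measurable_conjugate_comp (u : lebR R -> 'cV[R]_d) : vmeasurable D u ->
  measurable_fun D (fun t => conjugate (EFin \o G) (u t)).
Proof.
move=> mu; apply: (measurable_conjugate (H := fun=> G)) => //.
by move=> t _; exact: convexf_continuous.
Qed.

(** Testing the conjugate at plus and minus [basis_vec i] bounds [l * |u t i 0|] by the conjugate at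
    [l *: u t] plus a constant. Applied to [xi], this makes the slope in the lower bound on [H]
    integrable. *)
Lemma orlicz_vintg u : orlicz T (conjugate (EFin \o G)) u -> vintg leb D u.
Proof.
move=> [mu [l l0 loo]] i.
pose M := `|G (basis_vec i)| + `|G (- basis_vec i)|.
have mf : measurable_fun D (fun t => conjugate (EFin \o G) (l *: u t)).
  by apply: measurable_conjugate_comp; exact: vmeasurableZ.
have f0 t : (0 <= conjugate (EFin \o G) (l *: u t))%E by exact: conjugate_ge0.
have iF : leb.-integrable D (fun t => conjugate (EFin \o G) (l *: u t)).
  have i0 := intg_cst (mD0T T) 0 (leb_itv_lty T).
  by apply: (integrable_lb_lty (mD0T T) mf i0 _ loo) => t _; exact: f0.
have iM : intg leb D (fun=> M) := intg_cst (mD0T T) M (leb_itv_lty T).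
have iFM := integrableZl (mD0T T) l^-1 (integrableD (mD0T T) iF iM).
apply: (le_integrable (mD0T T) _ _ iFM); first exact/measurable_EFinP/(mu i).
move=> t Dt; apply: le_trans (lee_abs _).
rewrite muleC lee_pdivlMr// /= -EFinM mulrC -{1}(gtr0_norm l0) -normrM.
have K1 := young (fun=> G) t (l *: u t) (basis_vec i).
have K2 := young (fun=> G) t (l *: u t) (- basis_vec i).
have P1 := normr_ge0 (G (basis_vec i)); have P2 := normr_ge0 (G (- basis_vec i)).
have L1 := ler_norm (G (basis_vec i)); have L2 := ler_norm (G (- basis_vec i)).
rewrite dotpNr dotp_basis mxE in K2; rewrite dotp_basis mxE in K1.
rewrite -leeBlDr//; have [p0|p0] := leP 0 (l * u t i 0).
  by apply: le_trans K1; rewrite -EFinB lee_fin (ger0_norm p0) /M; lra.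
by apply: le_trans K2; rewrite -EFinB lee_fin (ltr0_norm p0) /M; lra.
Qed.

End orlicz_space.

Lemma lower_bound_arith {R : realFieldType} (C1 C2 L x b i a : R) :
  - (C1 * x) - C2 <= b -> C1 * x <= C1 * (L * (i + a)) ->
  (1 - L * (C1 / 2)) * i - (C1 / 2 * L * a + C2 / 2) <= 2^-1 * b + i.
Proof.
move=> h1 h2.
rewrite -subr_ge0 (_ : _ - _ = 2^-1 * ((b - (- (C1 * x) - C2)) + (C1 * (L * (i + a)) - C1 * x))).
  by rewrite mulr_ge0 ?invr_ge0// addr_ge0// subr_ge0.
by field.
Qed.

(** * The dual action of the Hamiltonian system *)

Section hamiltonian.
Context {R : realType} {n : nat} (T : R).
Hypothesis T0 : 0 < T.
Notation D := (`[0, T]%classic : set (lebR R)).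
Local Notation d := (n + n)%N.
Local Notation J := (@Jmx R n).
Variables (G : 'cV[R]_d -> R) (C1 C2 Lam K C : R).
Local Notation Gs := (conjugate (EFin \o G)).
Hypotheses (cG : convexf G) (Gpos : forall x, 0 <= G x) (G0 : G 0 = 0)
  (dG : forall x : 'cV[R]_d, differentiable G x).
Hypotheses (K0 : 0 < K)
  (Gsemi : forall u : 'cV[R]_d, (conjugate Gs (J *m u) <= Gs (K *: u) + C%:E)%E).
Hypotheses (C10 : 0 < C1) (quad : forall v : R -> 'cV[R]_d, W1per T Gs v ->
  (- (C1%:E * \int[leb]_(t in `[0%R, T]) Gs (T *: derive1 v t)%R) - C2%:E
     <= \int[leb]_(t in `[0%R, T]) (dotp (J *m derive1 v t) (v t))%:E)%E).
Hypothesis LamT : T * Num.max 1 (C1 / 2) < Lam^-1.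
Variables (H : lebR R -> 'cV[R]_d -> R) (a : lebR R -> R).
Hypotheses (Hconv : forall t, D t -> convexf (H t))
  (Hmeas : forall y, measurable_fun D (H ^~ y))
  (ia : intg leb D a) (a_ge0 : forall t, D t -> 0 <= a t)
  (Hlb : forall t (y : 'cV[R]_d), D t -> - (a t * `|y|) <= H t y)
  (Hub : forall t (y : 'cV[R]_d), D t -> H t y <= G (Lam *: y) + a t).
Hypothesis coercive : forall M : R, exists r : R, forall y : 'cV[R]_d,
  r < `|y| -> M <= \int[leb]_(t in D) H t y.
Implicit Types (p : lebR R -> 'cV[R]_d) (w : R -> 'cV[R]_d).

Let mD := mD0T T.
Let muD := leb_itv_lty T.
Let cg : convexf (fun y => G (Lam *: y)) := convexf_scale Lam cG.

Lemma Lam_gt0 : 0 < Lam.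
Proof.
rewrite -invr_gt0; apply: le_lt_trans LamT.
by rewrite mulr_ge0 ?(ltW T0)// le_max ler01.
Qed.

Lemma LamT_lt1 : Lam * T < 1.
Proof.
have T1 : T <= T * Num.max 1 (C1 / 2) by rewrite ler_peMr ?(ltW T0)// le_max lexx.
by have := le_lt_trans T1 LamT; rewrite -div1r ltr_pdivlMr ?Lam_gt0// mulrC.
Qed.

Lemma LamTC1_lt1 : Lam * T * (C1 / 2) < 1.
Proof.
have T1 : T * (C1 / 2) <= T * Num.max 1 (C1 / 2).
  by rewrite ler_pM2l// le_max lexx orbT.
rewrite (_ : _ * _ = T * (C1 / 2) * Lam); last by ring.
by rewrite -ltr_pdivlMr ?Lam_gt0// div1r (le_lt_trans T1).
Qed.

Lemma Gs_scaled_le t (x : 'cV[R]_d) : D t -> (Gs (Lam^-1 *: x) <= conjH H t x + (a t)%:E)%E.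
Proof.
move=> Dt; apply: ge_ereal_sup => _ [y _ <-] /=.
have := young H t x (Lam^-1 *: y); have := Hub (Lam^-1 *: y) Dt.
rewrite scalerA divff ?gt_eqF ?Lam_gt0// scale1r dotpZl dotpZr.
case: (conjH H t x) => [c| |]; last by rewrite leeNy_eq.
  by rewrite -EFinB -EFinD !lee_fin; lra.
by move=> _ _; rewrite addye// leey.
Qed.

(** As [G] is nonnegative and [Lam * T < 1], replacing [G y] by [Lam * T * G y] only increases the
    expression under the supremum, and [Lam * T] factors out. *)
Lemma Gs_T_le t (x : 'cV[R]_d) : D t ->
  (Gs (T *: x) <= (Lam * T)%:E * (conjH H t x + (a t)%:E))%E.
Proof.
move=> Dt; apply: ge_ereal_sup => _ [y _ <-] /=.
have LT0 : 0 < Lam * T by rewrite mulr_gt0 ?Lam_gt0.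
have := young H t x (Lam^-1 *: y); have := Hub (Lam^-1 *: y) Dt.
rewrite scalerA divff ?gt_eqF ?Lam_gt0// scale1r dotpZl dotpZr.
case: (conjH H t x) => [c| |]; last by rewrite leeNy_eq.
  rewrite -EFinB -EFinD -EFinM !lee_fin => h1 h2.
  have h3 : Lam^-1 * dotp x y - G y <= c + a t by lra.
  apply: (@le_trans _ _ (Lam * T * (Lam^-1 * dotp x y - G y))); last by rewrite ler_pM2l.
  rewrite mulrBr mulrA (mulrAC Lam) divff ?gt_eqF ?Lam_gt0// mul1r lerB//.
  by rewrite ler_piMl// ltW// LamT_lt1.
by move=> _ _; rewrite addye// gt0_muley ?lte_fin// leey.
Qed.

Lemma orlicz_admissible p w (k : 'cV[R]_d) : admissible T H p -> abs_continuous T w ->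
  (forall t, 0 <= t <= T -> w t = k + vprim T p t) -> W1per T Gs w.
Proof.
move=> [ip p0 cp] acw wE.
have dw := derive_shift_vprim ip wE.
have w0T : w 0 = w T.
  have E0 : 0 <= (0 : R) <= T by rewrite lexx (ltW T0).
  have ET : 0 <= T <= T by rewrite lexx (ltW T0).
  by rewrite (wE _ E0) (wE _ ET) (vprim0 ip) (vprimT p0).
split; last exact: w0T.
split; first exact: acw.
split.
  move=> i; apply: (ae_leb_measurable (intg_measurable (ip i))).
  by apply: ae_leb1 dw => t dw t0T; rewrite (dw t0T).2.
exists Lam^-1; first by rewrite invr_gt0 Lam_gt0.
have mp := vintg_measurable ip.
have mG : measurable_fun D (fun t => Gs (Lam^-1 *: p t)).
  exact: (measurable_conjugate_comp cG (vmeasurableZ _ mp)).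
rewrite (ae_leb_integral mG); last first.
  by apply: ae_leb1 dw => t dw t0T; rewrite (dw t0T).2.
have iC := integrableD mD cp ia.
have mC : measurable_fun D (fun t => conjH H t (p t) + (a t)%:E)%E by have /integrableP[] := iC.
apply: le_lt_trans (integrable_lty mD iC).
apply: ge0_le_integral => //.
- by move=> t _; exact: conjugate_ge0.
- by move=> t Dt; exact: Gs_scaled_le.
Qed.

Lemma admissible_vprim p : admissible T H p -> W1per T Gs (vprim T p).
Proof.
move=> ap; have [ip _ _] := ap.
apply: (orlicz_admissible (k := 0) ap); first exact: abs_continuous_vprim.
by move=> t _; rewrite add0r.
Qed.

(** Translating a closed curve by [k] does not change its dual action, because its derivative has
    zero mean; the action is a function of the derivative alone. *)
Lemma dual_action_value p w (k : 'cV[R]_d) : admissible T H p -> abs_continuous T w ->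
  (forall t, 0 <= t <= T -> w t = k + vprim T p t) ->
  dual_action T H w = (action T H J p)%:E.
Proof.
move=> [ip p0 cp] acw wE.
have dw := derive_shift_vprim ip wE.
have iJ := vintg_mulmx mD J ip.
have iq : intg leb D (fun t => 2^-1 * dotp (J *m p t) (w t)).
  exact: (intgZ mD _ (intg_dotp_ac T0 iJ acw)).
have iS := integrableD mD iq cp.
have mS : measurable_fun D (fun t => (2^-1 * dotp (J *m p t) (w t))%R%:E + conjH H t (p t))%E.
  by have /integrableP[] := iS.
rewrite /dual_action (ae_leb_integral mS); last first.
  by apply: ae_leb1 dw => t dw t0T; rewrite (dw t0T).2.
rewrite (integralD mD iq cp) (iconjE mD cp) (intgE mD iq) -EFinD; congr (_%:E).
rewrite /action (RintegralZl _ mD (intg_dotp_ac T0 iJ acw)); congr (_ * _ + _).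
have ik : intg leb D (fun t => dotp (p t) (- (J *m k))) := vintg_dotp mD _ ip.
transitivity (\int[leb]_(t in D) (dotp (J *m p t) (vprim T p t) + dotp (p t) (- (J *m k)))).
  apply: eq_Rintegral => t; rewrite inE /= in_itv /= => t0T.
  by rewrite (wE t t0T) addrC dotpDr dotpNr -dotp_Jl.
by rewrite (RintegralD mD (intg_bform T0 J ip ip) ik) (Rintegral_dotp_cst mD _ ip p0) addr0.
Qed.

(** The quadratic part is integrable and the conjugate has an integrable minorant, so an action
    below [+oo] forces the conjugate to be integrable. Competitors of infinite action are set aside
    in this way. *)
Lemma dual_action_finite w : W1per T Gs w -> (dual_action T H w < +oo)%E ->
  admissible T H (derive1 w).
Proof.
move=> [[acw ow] wT] fin; have [ip wE] := abs_continuous_primitive T0 acw.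
have iJ := vintg_mulmx mD J ip.
have iq : intg leb D (fun t => 2^-1 * dotp (J *m derive1 w t) (w t)).
  exact: (intgZ mD _ (intg_dotp_ac T0 iJ acw)).
have ig := intg_shift mD muD (fun y => G (Lam *: y)) ia.
have mC := measurable_conjH Hconv Hmeas (vintg_measurable ip).
split=> //.
  have ET : 0 <= T <= T by rewrite lexx (ltW T0).
  have vT : vprim T (derive1 w) T = 0 by apply: (addrI (w 0)); rewrite -(wE _ ET) addr0 wT.
  by move=> i; move/colP/(_ i) : vT; rewrite !mxE primT.
have mS : measurable_fun D (fun t => (2^-1 * dotp (J *m derive1 w t) (w t))%R%:E +
    conjH H t (derive1 w t))%E.
  by have /integrableP[mq _] := iq; exact: (emeasurable_funD mq mC).
have iS := integrable_lb_lty mD mS (intgB mD iq ig) _ fin.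
have {}iS := integrableB mD (iS _) iq.
have -> : fconj leb D H (derive1 w) = leb.-integrable D
  ((fun t => (2^-1 * dotp (J *m derive1 w t) (w t))%R%:E + conjH H t (derive1 w t)) \-
    (EFin \o (fun t => (2^-1 * dotp (J *m derive1 w t) (w t))%R)))%E.
  rewrite /fconj; congr (integrable _ _ _); apply/funext => t /=.
  by rewrite addeAC subee// add0e.
apply: iS => t Dt; rewrite EFinB leeD// leeNl.
have := conjH_lb Hub (derive1 w t) Dt; rewrite addeC -leeBlDl// sub0e.
by rewrite leeNl.
Qed.

(** The quadratic part costs at most [C1 / 2] times the integral of [Gs (T *: p)], up to a constant,
    and [Gs_T_le] bounds the latter by [Lam * T] times the conjugate part, up to a constant. The
    fraction [theta = 1 - Lam * T * (C1 / 2)] remains. *)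
Lemma action_lower_bound : exists2 theta : R, 0 < theta & exists c1 : R,
  forall p, admissible T H p -> theta * iconj leb D H p - c1 <= action T H J p.
Proof.
exists (1 - Lam * T * (C1 / 2)); first by rewrite subr_gt0 LamTC1_lt1.
exists (C1 / 2 * (Lam * T) * \int[leb]_(t in D) a t + C2 / 2) => p ap.
have [ip p0 cp] := ap; have := quad (admissible_vprim ap).
have dw := vprim_derive ip.
have mG : measurable_fun D (fun t => Gs (T *: p t)).
  exact: (measurable_conjugate_comp cG (vmeasurableZ _ (vintg_measurable ip))).
rewrite (ae_leb_integral mG); last first.
  by apply: ae_leb1 dw => t dw t0T; rewrite (dw t0T).2.
have iB := intg_bform T0 J ip ip.
have mB : measurable_fun D (fun t => (dotp (J *m p t) (vprim T p t))%:E).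
  by have /integrableP[] := iB.
rewrite (ae_leb_integral (f := fun t => (dotp (J *m derive1 (vprim T p) t) (vprim T p t))%:E) mB); last first.
  by apply: ae_leb1 dw => t dw t0T; rewrite (dw t0T).2.
rewrite (intgE mD iB) -/(bform T J p p).
have iC := integrableD mD cp ia; have iLC := integrableZl mD (Lam * T) iC.
have GI : (\int[leb]_(t in D) Gs (T *: p t)%R <=
    (Lam * T * (iconj leb D H p + \int[leb]_(t in D) a t))%:E)%E.
  rewrite EFinM EFinD -(iconjE mD cp) -(intgE mD ia) -(integralD mD cp ia) -(integralZl mD iC).
  apply: ge0_le_integral.
  - exact: mD.
  - by move=> t _; exact: conjugate_ge0.
  - exact: mG.
  - by have /integrableP[] := iLC.
  - by move=> t Dt; exact: Gs_T_le.
have G0' : (0 <= \int[leb]_(t in D) Gs (T *: p t)%R)%E.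
  by apply: integral_ge0 => t _; exact: conjugate_ge0.
case E : (\int[leb]_(t in D) Gs (T *: p t)%R)%E GI G0' => [x| |]//.
rewrite lee_fin => GI _; rewrite -EFinM -EFinN -EFinB lee_fin /action => q.
have := ler_wpM2l (ltW C10) GI.
move: q; set b := bform _ _ _ _; set I := iconj _ _ _ _; set A := Rintegral _ _ _.
exact: lower_bound_arith.
Qed.

Lemma abs_continuous_J_shift w (c : 'cV[R]_d) : abs_continuous T w ->
  abs_continuous T (fun t => J *m w t + c).
Proof.
move=> acw e e0; have [del del0 delP] := acw e e0; exists del => // m x y xy txy s.
apply: le_lt_trans (delP m x y xy txy s); apply: ler_sum => i _.
by rewrite opprD addrACA subrr addr0 -mulmxBr /enorm dotp_J.
Qed.

Lemma vprim_mulmx (A : 'M[R]_d) p t : vintg leb D p ->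
  vprim T (fun s => A *m p s) t = A *m vprim T p t.
Proof.
move=> ip; apply/colP => i; rewrite !mxE /prim.
set E := (_ `&` _ : set (lebR R)).
have mE : measurable E by apply: measurableI; exact: measurable_itv_lebR.
have ED : E `<=` D by exact: subIsetr.
have iE j : intg leb E (fun s => p s j 0) := intgS mD mE ED (ip j).
under eq_Rintegral do rewrite mxE.
rewrite (Rintegral_sum mE _ (fun j => intgZ mE (A i j) (iE j))).
by apply: eq_bigr => j _; rewrite (RintegralZl _ mE (iE j)) mxE.
Qed.

(** Biconjugation bounds [G], the semi-symplectic inequality removes [J], and the division by [K]
    cancels its factor, so that [Gs_scaled_le] applies. This is the estimate that puts [u' = J p] in
    the Orlicz space of [G]. *)
Lemma G_J_le t (x : 'cV[R]_d) : D t ->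
  ((G ((Lam^-1 / K) *: (J *m x)))%:E <= conjH H t x + (a t + C)%:E)%E.
Proof.
move=> Dt; rewrite scalemxAr.
apply: le_trans (le_biconjugate cG (dG _)) _; apply: le_trans (Gsemi _) _.
rewrite scalerA mulrCA divff ?gt_eqF// mulr1 EFinD addeA leeD2r//.
exact: Gs_scaled_le.
Qed.

Theorem hamiltonian_solution : exists u : R -> 'cV[R]_d,
  [/\ W1per T (EFin \o G) u,
      \forall t \ae leb, 0 <= t <= T ->
        (mulmx J @` subdifferential (H t) (u t)) (derive1 u t),
      u 0 = u T
    & let v := fun t : R => - (J *m (u t - mean T u)) in
      W1per T Gs v /\
      forall w : R -> 'cV[R]_d, W1per T Gs w ->
        (dual_action T H v <= dual_action T H w)%E].
Proof.
have [theta theta0 [c1 lb]] := action_lower_bound.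
have [p ap pmin] := exists_minimizer T0 Hconv Hmeas cg ia a_ge0 Hlb Hub coercive theta0 lb.
have [ip p0 cp] := ap.
have [c pc] := euler_lagrange T0 Hconv Hmeas cg ia a_ge0 Hlb Hub coercive (@Jmx_tr R n) ap pmin.
pose u (t : R) := J *m vprim T p t + c.
have acv := abs_continuous_vprim ip.
have acu : abs_continuous T u := abs_continuous_J_shift c acv.
have u0T : u 0 = u T by rewrite /u (vprim0 ip) (vprimT p0).
have iJ := vintg_mulmx mD J ip.
have uE t : 0 <= t <= T -> u t = c + vprim T (fun s => J *m p s) t.
  by move=> _; rewrite (vprim_mulmx J t ip) addrC.
have du := derive_shift_vprim iJ uE.
exists u; split.
- split; last exact: u0T.
  split; first exact: acu.
  split.
    move=> i; apply: (ae_leb_measurable (intg_measurable (iJ i))).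
    by apply: ae_leb1 du => t du t0T; rewrite (du t0T).2.
  exists (Lam^-1 / K); first by rewrite divr_gt0// invr_gt0 Lam_gt0.
  have mG : measurable_fun D (fun t => (G ((Lam^-1 / K) *: (J *m p t)))%:E).
    have vm := vmeasurableZ (Lam^-1 / K) (vintg_measurable iJ).
    have mcst (y : 'cV[R]_d) : measurable_fun D (fun=> G y) by exact: measurable_cst.
    apply/measurable_EFinP.
    exact: (measurable_caratheodory_comp (H := fun=> G) (fun _ _ => cG) mcst vm).
  rewrite (ae_leb_integral mG); last first.
    by apply: ae_leb1 du => t du t0T; rewrite /= (du t0T).2.
  have iC := integrableD mD cp (intgD mD ia (intg_cst mD C muD)).
  have mC : measurable_fun D (fun t => conjH H t (p t) + (a t + C)%:E)%E by have /integrableP[] := iC.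
  apply: le_lt_trans (integrable_lty mD iC).
  apply: ge0_le_integral.
  - exact: mD.
  - by move=> t _; rewrite lee_fin.
  - exact: mG.
  - exact: mC.
  - by move=> t Dt; exact: G_J_le.
- apply: ae_leb2 pc du => t pc du t0T; rewrite (du t0T).2.
  exists (p t) => //; have := pc t0T.
  by rewrite Jmx_tr mulNmx opprK.
- exact: u0T.
move=> v.
(* Since [J] squares to minus the identity, [v] is the primitive of [p] up to this constant. The
   mean of [u] enters only here, and the dual action does not see [k]. *)
pose k := - (J *m (c - mean T u)).
have vE t : v t = k + vprim T p t.
  rewrite /v /k; move: (mean T u) => m.
  rewrite /u -addrA mulmxDr JmxK opprD opprK.
  exact: addrC.
have acv' : abs_continuous T v.
  move=> e e0; have [del del0 delP] := acv e e0; exists del => // m x y xy txy s.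
  apply: le_lt_trans (delP m x y xy txy s); apply: ler_sum => i _.
  by rewrite !vE opprD addrACA subrr add0r.
have vE' t : 0 <= t <= T -> v t = k + vprim T p t by [].
split; first exact: orlicz_admissible ap acv' vE'.
move=> w ww; rewrite (dual_action_value ap acv' vE').
have [fin|] := boolP (dual_action T H w < +oo)%E; last by rewrite -leNgt; exact: le_trans (leey _).
have aw := dual_action_finite ww fin; have [[acw ow] wT] := ww.
have [_ wE] := abs_continuous_primitive T0 acw.
by rewrite (dual_action_value aw acw wE) lee_fin; exact: pmin.
Qed.

End hamiltonian.

(** * From almost everywhere bounds to an integrand controlled everywhere *)

Section rational_test_points.
Context {R : realType} {d : nat}.
Implicit Types f : 'cV[R]_d -> R.

Lemma continuous_ge0_ratv f : continuous f -> (forall j, 0 <= f (ratv j)) ->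
  forall y, 0 <= f y.
Proof.
move=> cf f0 y; rewrite -lerN2 oppr0; apply/ler_addgt0Pr => e e0; rewrite add0r.
have [j fj] := continuous_ratv y cf e0.
have := f0 j; have := ler_norm (f (ratv j) - f y); move: fj; lra.
Qed.

(** Each bound on [H] fails on a null set depending on [y]. Outside the countable union over
    rational [y] the bounds hold at all rational points, and continuity extends them to every
    [y]. *)
Lemma convexf_between_ratv f g (w : 'cV[R]_d) (k : R) : convexf f -> convexf g ->
  (forall j, dotp w (ratv j) <= f (ratv j)) -> (forall j, f (ratv j) <= g (ratv j) + k) ->
  forall y, dotp w y <= f y <= g y + k.
Proof.
move=> cf cg lo up y.
have Cf := convexf_continuous cf; have Cg := convexf_continuous cg.
have Cw : continuous (fun y : 'cV[R]_d => dotp w y).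
  apply: convexf_continuous => x z t _; rewrite dotpDr !dotpZr//.
have D1 : continuous (fun y => f y - dotp w y : R^o).
  by move=> x; exact: (cvgB (Cf x) (Cw x)).
have D2 : continuous (fun y => g y + k - f y : R^o).
  by move=> x; exact: (cvgB (cvgD (Cg x) (cvg_cst k)) (Cf x)).
rewrite -subr_ge0 -[X in _ && X]subr_ge0; apply/andP; split.
  by apply: (continuous_ge0_ratv D1) => j; rewrite subr_ge0.
by apply: (continuous_ge0_ratv D2) => j; rewrite subr_ge0.
Qed.

End rational_test_points.

Section dual_action_ae.
Context {R : realType} {n : nat} (T : R).
Hypothesis T0 : 0 < T.
Notation D := (`[0, T]%classic : set (lebR R)).
Local Notation d := (n + n)%N.
Variables (H H' : lebR R -> 'cV[R]_d -> R).
Hypotheses (Hconv' : forall t, D t -> convexf (H' t))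
  (Hmeas' : forall y, measurable_fun D (H' ^~ y))
  (HH' : \forall t \ae leb, 0 <= t <= T -> H t = H' t).

Lemma dual_action_ae (w : R -> 'cV[R]_d) : abs_continuous T w ->
  dual_action T H w = dual_action T H' w.
Proof.
move=> acw; have [ip wE] := abs_continuous_primitive T0 acw.
have iJ := vintg_mulmx (mD0T T) (@Jmx R n) ip.
have iq : intg leb D (fun t => 2^-1 * dotp (@Jmx R n *m derive1 w t) (w t)).
  exact: (intgZ (mD0T T) _ (intg_dotp_ac T0 iJ acw)).
have mC := measurable_conjH Hconv' Hmeas' (vintg_measurable ip).
have mS : measurable_fun D (fun t => (2^-1 * dotp (@Jmx R n *m derive1 w t) (w t))%R%:E +
    conjH H' t (derive1 w t))%E.
  by have /integrableP[mq _] := iq; exact: (emeasurable_funD mq mC).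
by apply: (ae_leb_integral mS); apply: ae_leb1 HH' => t HH t0T; rewrite HH.
Qed.

End dual_action_ae.

Theorem theorem1p4 (R : realType) (n : nat) (T : R)
    (G : 'cV[R]_(n + n) -> R) (C1 : R) (H : R -> 'cV[R]_(n + n) -> R) :
  let J : 'M[R]_(n + n) := Jmx n in
  let Gs : 'cV[R]_(n + n) -> \bar R := conjugate (EFin \o G) in
  (0 < n)%N -> 0 < T ->
  Gfunction (EFin \o G) ->
  (forall x : 'cV[R]_(n + n), differentiable G x) ->
  semi_symplectic Gs ->
  Delta2 Gs ->
  0 < C1 ->
  (exists2 C2 : R, 0 < C2 &
    forall v : R -> 'cV[R]_(n + n), W1per T Gs v ->
      (- (C1%:E * \int[leb]_(t in `[0%R, T]) Gs (T *: derive1 v t)%R) - C2%:E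
       <= \int[leb]_(t in `[0%R, T]) (dotp (J *m derive1 v t) (v t))%:E)%E) ->
  (\forall t \ae leb, 0 <= t <= T ->
    convex_function [set: 'cV[R]_(n + n)] (H t)) ->
  (forall u : 'cV[R]_(n + n),
    measurable_fun (`[0, T] : set (lebR R)) (fun t : lebR R => H t u)) ->
  (exists2 xi : R -> 'cV[R]_(n + n), orlicz T Gs xi &
    forall y : 'cV[R]_(n + n), \forall t \ae leb, 0 <= t <= T ->
      dotp (xi t) y <= H t y) ->
  (exists (Lam : R) (alpha : R -> R),
    [/\ T * Num.max 1 (C1 / 2) < Lam^-1,
        leb.-integrable `[0, T] (EFin \o alpha)
      & forall y : 'cV[R]_(n + n), \forall t \ae leb, 0 <= t <= T ->
          H t y <= G (Lam *: y) + alpha t]) ->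
  tends_to_infty (fun y => \int[leb]_(t in `[0%R, T]) (H t y)%:E)%E ->
  exists u : R -> 'cV[R]_(n + n),
    [/\ W1per T (EFin \o G) u,
        \forall t \ae leb, 0 <= t <= T ->
          (mulmx J @` subdifferential (H t) (u t)) (derive1 u t),
        u 0 = u T
      & let v := fun t : R => - (J *m (u t - mean T u)) in
        W1per T Gs v /\
        forall w : R -> 'cV[R]_(n + n), W1per T Gs w ->
          (dual_action T H v <= dual_action T H w)%E].
Proof.
move=> J Gs n0 T0 [[Gpos cG _] [_ G0 _ _]] dG [_ [K [C [K0 _ Gsemi]]]] _ C10 [C2 _ quad].
move=> Hconv Hmeas [xi oxi xiH] [Lam [alpha [LamT ialpha HG]]] coer.
have {}cG := convex_efun_convexf cG.
have {}Gpos x : 0 <= G x by have := Gpos x; rewrite lee_fin.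
have {}G0 : G 0 = 0 by case: G0.
have cg := convexf_scale Lam cG.
have ixi := orlicz_vintg cG G0 oxi.
pose D := `[0, T]%classic : set (lebR R).
have mD : measurable D := mD0T T.
(* One function for both bounds: the first term dominates [alpha], and the second, multiplied by the
   sup norm of [y], dominates the absolute value of [dotp (xi t) y]. *)
pose a (t : lebR R) := `|alpha t| + (n + n)%:R * \sum_i `|xi t i 0|.
have a0 t : 0 <= a t by rewrite addr_ge0// mulr_ge0// sumr_ge0.
have ia : intg leb D a.
  have isum := intg_sum mD (index_enum ('I_(n + n) : finType)) (fun i => intg_norm mD (ixi i)).
  exact: (intgD mD (intg_norm mD ialpha) (intgZ mD _ isum)).
pose good t := convexf (H t) /\ forall y, dotp (xi t) y <= H t y <= G (Lam *: y) + alpha t.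
have ae_good : \forall t \ae leb, 0 <= t <= T -> good t.
  have q1 := ae_foralln (fun j => xiH (ratv j)).
  have q2 := ae_foralln (fun j => HG (ratv j)).
  apply: ae_leb2 Hconv (ae_leb2 (fun t x y => conj x y) q1 q2) => t ct [lo up] t0T.
  have {}ct := convex_function_convexf (ct t0T); split=> //.
  by apply: (convexf_between_ratv ct cg) => j; [exact: lo|exact: up].
(* On the exceptional null set the zero function is convex and satisfies both bounds because [G] and
   [a] are nonnegative. *)
pose H' (t : lebR R) y := if `[< good t >] then H t y else 0.
have HH' : \forall t \ae leb, 0 <= t <= T -> H t = H' t.
  by apply: ae_leb1 ae_good => t gt t0T; apply/funext => y; rewrite /H' asboolT//; exact: gt.
have Hconv' t : D t -> convexf (H' t).
  move=> _; rewrite /H'; case: asboolP => [[]//|_] x y s _.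
  by rewrite !mulr0 addr0.
have Hmeas' y : measurable_fun D (H' ^~ y).
  by apply: (ae_leb_measurable (Hmeas y)); apply: ae_leb1 HH' => t HH t0T; rewrite HH.
have Hub' t y : D t -> H' t y <= G (Lam *: y) + a t.
  move=> _; rewrite /H'; case: asboolP => [[_ /(_ y)/andP[_ up]]|_]; last by rewrite addr_ge0.
  apply: le_trans up _; rewrite lerD2l; apply: le_trans (ler_norm _) _.
  by rewrite lerDl mulr_ge0// sumr_ge0.
have Hlb' t (y : 'cV[R]_(n + n)) : D t -> - (a t * `|y|) <= H' t y.
  move=> _; rewrite /H'; case: asboolP => [[_ /(_ y)/andP[lo _]]|_]; last first.
    by rewrite oppr_le0 mulr_ge0.
  apply: le_trans lo; rewrite lerNl; apply: le_trans (ler_norm _) _; rewrite normrN.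
  apply: le_trans (normr_dotp_le _ _) _; rewrite ler_wpM2r//.
  rewrite /a ler_wpDl// ler_wpM2l//; apply: ler_norm_coord; first exact: sumr_ge0.
  by move=> i; rewrite (bigD1 i)//= lerDl sumr_ge0.
have coer' (M : R) : exists r : R, forall y : 'cV[R]_(n + n), r < `|y| ->
    M <= \int[leb]_(t in D) H' t y.
  have [r rM] := coer M; exists r => y ry.
  have := rM y (lt_le_trans ry (norm_le_enorm y)).
  have iH : intg leb D (fun t => H' t y).
    apply: (intg_H mD (leb_itv_lty T) Hconv' Hmeas' cg ia (fun t _ => a0 t) Hlb' Hub'
      (u := fun=> y) (b := `|y|)); last by [].
    exact: vmeasurable_cst.
  have mH : measurable_fun D (fun t => (H' t y)%:E) by have /integrableP[] := iH.
  rewrite (ae_leb_integral mH); last by apply: ae_leb1 HH' => t HH t0T; rewrite HH.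
  by rewrite (intgE mD iH) lee_fin.
have [u [Wu du u0T [Wv vmin]]] := hamiltonian_solution T0 cG Gpos G0 dG K0 Gsemi C10 quad LamT
  Hconv' Hmeas' ia (fun t _ => a0 t) Hlb' Hub' coer'.
exists u; split; [exact: Wu| |exact: u0T|].
  by apply: ae_leb2 HH' du => t HH du t0T; rewrite HH//; exact: du.
split; first exact: Wv.
move=> w Ww; have [[acw _] _] := Ww; have [[acv _] _] := Wv.
rewrite (dual_action_ae T0 Hconv' Hmeas' HH' acv) (dual_action_ae T0 Hconv' Hmeas' HH' acw).
exact: vmin.
Qed.
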